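(* For every $X\in\mathcal{M}_g$, $$\tfrac12 I(X)\le I_{\Delta}(X)\le I(X).$$
   Context: $\mathcal{M}_g$ ($g\ge2$) is the moduli space of compact hyperbolic surfaces of genus $g$. For $X\in\mathcal{M}_g$, $\ell_X(\gamma)$ is the length of a closed geodesic $\gamma$ on $X$. For closed geodesics $\gamma_1,\gamma_2$, $i(\gamma_1,\gamma_2)$ is the geometric intersection number: the minimal number of transversal intersection points, counted with multiplicity, between a representative of the homotopy class $[\gamma_1]$ and a representative of $[\gamma_2]$ (so in $i(\gamma,\gamma)$ two different representatives of $[\gamma]$ are used). Define $$I(X)=\sup_{\gamma_1,\gamma_2}\frac{i(\gamma_1,\gamma_2)}{\ell_X(\gamma_1)\ell_X(\gamma_2)},\qquad I_\Delta(X)=\sup_{\gamma}\frac{i(\gamma,\gamma)}{\ell_X(\gamma)^2},$$ the suprema being over all pairs of closed geodesics, respectively all closed geodesics, on $X$. *)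

(* Defs.v *)
From HB Require Import structures.
From mathcomp Require Import all_boot all_order all_algebra.
From mathcomp Require Import all_classical all_reals all_analysis.
Set Implicit Arguments.
Unset Strict Implicit.
Unset Printing Implicit Defensive.
Import Order.TTheory GRing.Theory Num.Theory.
Import numFieldNormedType.Exports.
Local Open Scope classical_set_scope.
Local Open Scope ring_scope.

(** The hyperbolic plane is the upper half-plane; the point x + iy is the pair
    (x, y) of R * R. *)

Section HyperbolicPlane.
Variable R : realType.
Implicit Types (a b c d : R) (z w : R * R).

Definition upper_half_plane : set (R * R) := [set z | 0 < z.2].

(** Real and imaginary part of (a z + b) / (c z + d) when a d - b c = 1. The
    group PSL(2, R) of these maps is the group of orientation-preserving
    isometries of the hyperbolic plane. *)
Definition mobius a b c d z : R * R :=
  let q := (c * z.1 + d) ^+ 2 + (c * z.2) ^+ 2 in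
  (((a * z.1 + b) * (c * z.1 + d) + a * c * z.2 ^+ 2) / q, z.2 / q).

Definition arcosh (u : R) : R := ln (u + Num.sqrt (u ^+ 2 - 1)).

(** Distance of the metric (dx^2 + dy^2) / y^2. *)
Definition hdist z w : R :=
  arcosh (1 + ((z.1 - w.1) ^+ 2 + (z.2 - w.2) ^+ 2) / (2 * z.2 * w.2)).

End HyperbolicPlane.

(** Closed curves are 1-periodic maps on the real line, i.e. maps on R / Z. *)

Section ClosedCurves.
Variables (R : realType) (X : topologicalType).
Implicit Types alpha beta : R -> X.

Definition closed_curve alpha : Prop :=
  continuous alpha /\ forall t, alpha (t + 1) = alpha t.

Definition fundamental_interval : set R := [set t | 0 <= t < 1].

Definition simple_closed_curve alpha : Prop :=
  closed_curve alpha /\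
  {in fundamental_interval &, injective alpha}.

(** Free homotopy: no base point is fixed. *)
Definition homotopic alpha beta : Prop :=
  exists H : R * R -> X,
    [/\ {within [set p : R * R | 0 <= p.1 <= 1], continuous H},
        forall u t, 0 <= u <= 1 -> H (u, t + 1) = H (u, t),
        forall t, H (0, t) = alpha t
      & forall t, H (1, t) = beta t].

(** n pairwise disjoint simple closed curves whose union does not
    disconnect X. *)
Definition nonseparating_system (n : nat) : Prop :=
  exists c : 'I_n -> R -> X,
    [/\ forall i, simple_closed_curve (c i),
        forall i j, i != j -> range (c i) `&` range (c j) = set0
      & connected (~` (\bigcup_i range (c i)))].

(** Genus of a closed orientable surface: the maximal number of disjoint simple
    closed curves along which it can be cut without being disconnected. *)
Definition has_genus (g : nat) : Prop :=
  nonseparating_system g /\ forall n, nonseparating_system n -> (n <= g)%N.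

(** Pairs of parameters on (R / Z) x (R / Z); counting these instead of points
    of X counts intersection points with multiplicity. *)
Definition intersections alpha beta : set (R * R) :=
  [set p | [/\ fundamental_interval p.1, fundamental_interval p.2
             & alpha p.1 = beta p.2]].

End ClosedCurves.

(** Hyperbolic structures as (PSL(2, R), H)-structures: atlases of charts with
    values in the hyperbolic plane whose changes of charts are locally
    orientation-preserving isometries. *)

Section HyperbolicStructures.
Variables (R : realType) (X : topologicalType).

(** The values of [chart_map] outside [chart_dom] are irrelevant. *)
Record chart := Chart { chart_dom : set X; chart_map : X -> R * R }.

Definition hyperbolic_chart (phi : chart) : Prop :=
  [/\ open (chart_dom phi),
      chart_map phi @` chart_dom phi `<=` @upper_half_plane R,
      {in chart_dom phi &, injective (chart_map phi)},
      {in chart_dom phi, continuous (chart_map phi)}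
    & forall W : set X, open W -> W `<=` chart_dom phi ->
        open (chart_map phi @` W)].

Definition compatible_charts (phi psi : chart) : Prop :=
  forall x, chart_dom phi x -> chart_dom psi x ->
    exists a b c d : R, a * d - b * c = 1 /\
      \forall y \near x, chart_map psi y = mobius a b c d (chart_map phi y).

Definition hyperbolic_atlas (A : set chart) : Prop :=
  [/\ forall x, exists2 phi, A phi & chart_dom phi x,
      forall phi, A phi -> hyperbolic_chart phi
    & forall phi psi, A phi -> A psi -> compatible_charts phi psi].

End HyperbolicStructures.

(** Compact hyperbolic surfaces of genus g: a point of the moduli space M_g is
    the isometry class of such a surface. *)
Record hyperbolic_surface (R : realType) (g : nat) := HyperbolicSurface {
  carrier :> topologicalType;
  atlas : set (chart R carrier);
  atlasP : hyperbolic_atlas atlas;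
  surface_hausdorff : hausdorff_space carrier;
  surface_compact : compact [set: carrier];
  surface_connected : connected [set: carrier];
  surface_genus : has_genus R carrier g }.

Section IntersectionNumbers.
Variables (R : realType) (g : nat) (X : hyperbolic_surface R g).

Definition C1_curve (alpha : R -> X) : Prop :=
  forall phi t, atlas phi -> chart_dom phi (alpha t) ->
    derivable (chart_map phi \o alpha) t 1 /\
    {for t, continuous (derive1 (chart_map phi \o alpha))}.

Definition C1_closed_curve (alpha : R -> X) : Prop :=
  closed_curve alpha /\ C1_curve alpha.

(** At every common point the velocity vectors are linearly independent. *)
Definition transversal_curves (alpha beta : R -> X) : Prop :=
  forall phi s t, atlas phi -> chart_dom phi (alpha s) -> alpha s = beta t ->
    let v := derive1 (chart_map phi \o alpha) s in
    let w := derive1 (chart_map phi \o beta) t in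
    v.1 * w.2 - v.2 * w.1 != 0.

(** The possible numbers of intersections of a representative of the free
    homotopy class of alpha and a transversal one of the class of beta. *)
Definition transversal_counts (alpha beta : R -> X) : set nat :=
  [set n | exists alpha' beta' : R -> X,
    [/\ C1_closed_curve alpha' /\ homotopic alpha alpha',
        C1_closed_curve beta' /\ homotopic beta beta',
        transversal_curves alpha' beta'
      & (intersections alpha' beta' #= `I_n)%card]].

(** The infimum is the minimum of a set of natural numbers; the extended reals
    only spare a default value for the empty set. *)
Definition intersection_number (alpha beta : R -> X) : \bar R :=
  ereal_inf [set n%:R%:E | n in transversal_counts alpha beta].

(** Unit-speed curves which locally realize the distance. *)
Definition geodesic (gamma : R -> X) : Prop :=
  continuous gamma /\
  forall phi t0, atlas phi -> chart_dom phi (gamma t0) ->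
    \forall s & t \near t0,
      hdist (chart_map phi (gamma s)) (chart_map phi (gamma t)) = `|s - t|.

(** Closed geodesics need not be primitive: [geod_length] is any positive
    period of the unit-speed parametrization. *)
Record closed_geodesic := ClosedGeodesic {
  geod_map : R -> X;
  geod_length : R;
  geod_length_gt0 : 0 < geod_length;
  geod_geodesic : geodesic geod_map;
  geod_periodic : forall t, geod_map (t + geod_length) = geod_map t }.

Definition geod_curve (c : closed_geodesic) : R -> X :=
  fun t => geod_map c (geod_length c * t).

Definition geom_intersection (c1 c2 : closed_geodesic) : \bar R :=
  intersection_number (geod_curve c1) (geod_curve c2).

Definition I_sup : \bar R :=
  ereal_sup [set (geom_intersection c.1 c.2
                  * ((geod_length c.1 * geod_length c.2)^-1)%:E)%E
            | c in [set: closed_geodesic * closed_geodesic]].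

Definition I_Delta : \bar R :=
  ereal_sup [set (geom_intersection c c * ((geod_length c ^+ 2)^-1)%:E)%E
            | c in [set: closed_geodesic]].

End IntersectionNumbers.

(* Main.v *)
Require Import Defs.
From mathcomp Require Import all_boot all_order all_algebra.
From mathcomp Require Import all_classical all_reals all_analysis.
From mathcomp Require Import ring lra zify.
Set Implicit Arguments.
Unset Strict Implicit.
Unset Printing Implicit Defensive.
Import Order.TTheory GRing.Theory Num.Theory.
Import numFieldNormedType.Exports.
Local Open Scope classical_set_scope.
Local Open Scope ring_scope.

(** For the nontrivial inequality let [c1], [c2] be closed geodesics of lengths
    [l1], [l2], let [T1], [T2] be deck transformations translating along lifts of
    them that cross, and let [N] be their number of intersections. The axis of
    [T1 ^ n * T2 ^ m] projects to a closed geodesic [c] of length at most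
    [n * l1 + m * l2], which runs [n] times along [c1] and then [m] times along
    [c2]. Away from the ends of these two arcs each of the [n] turns meets each
    of the [m] turns in all [N] points, and each point counts twice in [i(c, c)]:
    [i(c, c) >= 2 * N * (n - O(1)) * (m - O(1))]. These intersections are
    essential, because they are crossings of lifts that are pairwise inequivalent
    under the deck group, and curves equivariant under the same translations still
    cross. Choosing [n * l1] close to [m * l2] and letting [n] go to infinity,
    [I_Delta >= 2 * N * n * m / (n * l1 + m * l2) ^ 2 -> N / (2 * l1 * l2)].
    The count [N] is the intersection number unless [c1] and [c2] run along the
    same line, and then both are multiples of one geodesic [d], say of orders [a]
    and [b], and [i(c1, c2) <= a * b * i(d, d)]. *)

(** * Isometries of the upper half-plane *)

(** The lower bound for [i(c, c)] must hold for every representative of the class, so it cannot be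
    read off from the geodesic; only lifts equivariant under the same translation are at hand. Their
    crossing is an existence statement of winding number type, proved with continuous square roots
    in the plane. These square roots, the universal covering and the lifts of homotopies are three
    instances of one continuation of germs. The geometry is done with real 2 by 2 matrices of
    determinant 1. The image of the imaginary axis under K = (a b; c d) ends at b/d and a/c, which 0
    and infinity separate exactly when 0 < a d < 1; this inequality is how crossing is stated
    throughout. For axes of conjugate translations it can be read from traces, which behave well in
    limits. The delicate point is inequivalence: two crossings might differ by powers of the long
    translation, of length L. But L is at least n l1 + m l2 minus a constant, while crossings away
    from the ends of the arcs are closer together than that, so only trivial powers are possible.
    This is why turns near the ends are given up. *)

Section Matrices.
Variable R : realType.
Implicit Types (z w : R * R).

Record mat := Mat { m11 : R; m12 : R; m21 : R; m22 : R }.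
Implicit Types (M N P : mat).

Definition mdet M := m11 M * m22 M - m12 M * m21 M.
Definition mmul M N :=
  Mat (m11 M * m11 N + m12 M * m21 N) (m11 M * m12 N + m12 M * m22 N)
      (m21 M * m11 N + m22 M * m21 N) (m21 M * m12 N + m22 M * m22 N).
Definition mone := Mat 1 0 0 1.
Definition madj M := Mat (m22 M) (- m12 M) (- m21 M) (m11 M).
Definition mtr M := m11 M + m22 M.
Definition mopp M := Mat (- m11 M) (- m12 M) (- m21 M) (- m22 M).

Lemma matP M N : m11 M = m11 N -> m12 M = m12 N -> m21 M = m21 N ->
  m22 M = m22 N -> M = N.
Proof. by case: M => ????; case: N => ???? /= -> -> -> ->. Qed.

Lemma mmulA M N P : mmul M (mmul N P) = mmul (mmul M N) P.
Proof. by apply: matP => /=; ring. Qed.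

Lemma mmul1 M : mmul M mone = M.
Proof. by apply: matP => /=; ring. Qed.

Lemma mul1m M : mmul mone M = M.
Proof. by apply: matP => /=; ring. Qed.

Lemma mdet_mul M N : mdet (mmul M N) = mdet M * mdet N.
Proof. by rewrite /mdet /=; ring. Qed.

Lemma mdet_one : mdet mone = 1.
Proof. by rewrite /mdet /=; ring. Qed.

Lemma mdet_adj M : mdet (madj M) = mdet M.
Proof. by rewrite /mdet /=; ring. Qed.

Lemma madjK M : madj (madj M) = M.
Proof. by apply: matP => /=; ring. Qed.

Lemma madjM M N : madj (mmul M N) = mmul (madj N) (madj M).
Proof. by apply: matP => /=; ring. Qed.

Lemma mmulVm M : mdet M = 1 -> mmul (madj M) M = mone.
Proof. by move=> h; apply: matP => /=; rewrite -?h /mdet; ring. Qed.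

Lemma mmulmV M : mdet M = 1 -> mmul M (madj M) = mone.
Proof. by move=> h; apply: matP => /=; rewrite -?h /mdet; ring. Qed.

Lemma mmulKm M N : mdet M = 1 -> mmul (madj M) (mmul M N) = N.
Proof. by move=> h; rewrite mmulA mmulVm // mul1m. Qed.

Lemma mmulKVm M N : mdet M = 1 -> mmul M (mmul (madj M) N) = N.
Proof. by move=> h; rewrite mmulA mmulmV // mul1m. Qed.

Lemma mmulmK M N : mdet M = 1 -> mmul (mmul N M) (madj M) = N.
Proof. by move=> h; rewrite -mmulA mmulmV // mmul1. Qed.

Lemma mtrC M N : mtr (mmul M N) = mtr (mmul N M).
Proof. by rewrite /mtr /=; ring. Qed.

Lemma mtr_conj M N : mdet M = 1 -> mtr (mmul (mmul M N) (madj M)) = mtr N.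
Proof. by move=> h; rewrite mtrC mmulA mmulVm // mul1m. Qed.

Lemma mdet1_mul M N : mdet M = 1 -> mdet N = 1 -> mdet (mmul M N) = 1.
Proof. by move=> hM hN; rewrite mdet_mul hM hN mul1r. Qed.

Lemma mdet1_adj M : mdet M = 1 -> mdet (madj M) = 1.
Proof. by rewrite mdet_adj. Qed.

Definition act M z := mobius (m11 M) (m12 M) (m21 M) (m22 M) z.

(** The square of |c z + d|, the automorphy factor of [M]. *)
Definition mden M z := (m21 M * z.1 + m22 M) ^+ 2 + (m21 M * z.2) ^+ 2.

Lemma mden_gt0 M z : mdet M = 1 -> 0 < z.2 -> 0 < mden M z.
Proof.
move=> h z0; rewrite /mden.
have [c0|c0] := eqVneq (m21 M) 0.
  rewrite c0 !mul0r add0r expr0n addr0 exprn_even_gt0 //=.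
  by apply/negP => /eqP d0; move: h; rewrite /mdet c0 d0; lra.
rewrite ltr_wpDl ?sqr_ge0 // exprn_even_gt0 //= mulf_neq0 //.
by rewrite gt_eqF.
Qed.

Lemma mden_neq0 M z : mdet M = 1 -> 0 < z.2 -> mden M z != 0.
Proof. by move=> h z0; rewrite gt_eqF // mden_gt0. Qed.

Lemma act2 M z : (act M z).2 = z.2 / mden M z.
Proof. by []. Qed.

Lemma act_gt0 M z : mdet M = 1 -> 0 < z.2 -> 0 < (act M z).2.
Proof. by move=> h z0; rewrite act2 divr_gt0 // mden_gt0. Qed.

(** The cocycle rule for c z + d; it is what makes [act] multiplicative. *)
Lemma mden_mul M N z : mdet N = 1 -> 0 < z.2 ->
  mden (mmul M N) z = mden M (act N z) * mden N z.
Proof.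
move=> h z0; have := mden_neq0 h z0.
rewrite /mden /act /mobius /=; case: M N z h z0 => a b c d [a' b' c' d'] [x y] /=.
rewrite /mdet /= => h z0 q0.
have -> : (c * (((a' * x + b') * (c' * x + d') + a' * c' * y ^+ 2) /
      ((c' * x + d') ^+ 2 + (c' * y) ^+ 2)) + d) =
  (c * ((a' * x + b') * (c' * x + d') + a' * c' * y ^+ 2) + 
   d * ((c' * x + d') ^+ 2 + (c' * y) ^+ 2)) / ((c' * x + d') ^+ 2 + (c' * y) ^+ 2).
  by field.
have -> : c * (y / ((c' * x + d') ^+ 2 + (c' * y) ^+ 2)) =
  (c * (y * (a' * d' - b' * c'))) / ((c' * x + d') ^+ 2 + (c' * y) ^+ 2).
  by rewrite h mulr1 mulrA.
by field.
Qed.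

Lemma act_mul M N z : mdet M = 1 -> mdet N = 1 -> 0 < z.2 ->
  act (mmul M N) z = act M (act N z).
Proof.
move=> hM h z0; have q0 := mden_neq0 h z0.
have r0 := mden_neq0 hM (act_gt0 h z0).
have e := mden_mul M h z0.
have -> : act M (act N z) = (((m11 M * (act N z).1 + m12 M) * (m21 M * (act N z).1 + m22 M)
   + m11 M * m21 M * (act N z).2 ^+ 2) * mden N z / mden (mmul M N) z, 
   z.2 / mden (mmul M N) z).
  rewrite e /act /mobius; congr pair => /=; rewrite -/(mden _ _).
    by rewrite -[in RHS]mulf_div divff // mulr1.
  by rewrite -/(mden M (act N z)) -/(mden N z) -mulrA invfM [_^-1 * _]mulrC.
rewrite [in LHS]/act [in LHS]/mobius; congr pair => //=.
rewrite -/(mden (mmul M N) z); congr (_ / _).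
move: q0; rewrite /act /mobius /mden /=.
case: M N z {r0 e} hM h z0 => a b c d [a' b' c' d'] [x y] /=.
rewrite /mdet /= => hM h z0 q0.
have -> : (y / ((c' * x + d') ^+ 2 + (c' * y) ^+ 2)) =
  (y * (a' * d' - b' * c')) / ((c' * x + d') ^+ 2 + (c' * y) ^+ 2).
  by rewrite h mulr1.
by field.
Qed.

Lemma act_one z : act mone z = z.
Proof.
case: z => x y; rewrite /act /mobius /=; congr pair; 
by rewrite !(mul0r, mul1r, add0r, addr0, expr1n, expr0n, divr1, mulr1).
Qed.

Lemma actK M z : mdet M = 1 -> 0 < z.2 -> act (madj M) (act M z) = z.
Proof. by move=> h z0; rewrite -act_mul ?mdet_adj // mmulVm // act_one. Qed.

Lemma actVK M z : mdet M = 1 -> 0 < z.2 -> act M (act (madj M) z) = z.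
Proof. by move=> h z0; rewrite -act_mul ?mdet_adj // mmulmV // act_one. Qed.

Lemma act_opp M z : act (mopp M) z = act M z.
Proof.
case: M z => a b c d [x y]; rewrite /act /mobius /=.
by congr pair; congr (_ / _); ring.
Qed.

(* [qdist z w] is [2 (cosh (hdist z w) - 1)]. *)
Definition qdist z w := ((z.1 - w.1) ^+ 2 + (z.2 - w.2) ^+ 2) / (z.2 * w.2).

Lemma qdist_ge0 z w : 0 < z.2 -> 0 < w.2 -> 0 <= qdist z w.
Proof.
by move=> z0 w0; rewrite divr_ge0 ?addr_ge0 ?sqr_ge0 // ltW // mulr_gt0.
Qed.

Lemma qdistC z w : qdist z w = qdist w z.
Proof. by rewrite /qdist; congr (_ / _); ring. Qed.

Lemma qdist_act M z w : mdet M = 1 -> 0 < z.2 -> 0 < w.2 ->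
  qdist (act M z) (act M w) = qdist z w.
Proof.
move=> h z0 w0; have := mden_neq0 h z0; have := mden_neq0 h w0.
rewrite /qdist /act /mobius /mden /=; case: M z w h z0 w0 => a b c d [x y] [u v] /=.
rewrite /mdet /= => h z0 w0 q0 r0.
have z1 : y != 0 by rewrite gt_eqF.
have w1 : v != 0 by rewrite gt_eqF.
set q := (c * x + d) ^+ 2 + (c * y) ^+ 2 in r0 *.
set r := (c * u + d) ^+ 2 + (c * v) ^+ 2 in q0 *.
pose D := a * d - b * c.
(* [e1] and [e2] compute the real and imaginary parts of M z - M w with denominators cleared: this
   is z - w times the conjugate of (c z + d)(c w + d). *)
have e1 : ((a * x + b) * (c * x + d) + a * c * y ^+ 2) * r
   - ((a * u + b) * (c * u + d) + a * c * v ^+ 2) * q =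
   D * ((x - u) * ((c * x + d) * (c * u + d) - c ^+ 2 * y * v) 
      + (y - v) * (c * y * (c * u + d) + c * v * (c * x + d))).
  rewrite /q /r /D; ring.
have e2 : y * r - v * q = 
   ((y - v) * ((c * x + d) * (c * u + d) - c ^+ 2 * y * v) 
      - (x - u) * (c * y * (c * u + d) + c * v * (c * x + d))).
  rewrite /q /r; ring.
have -> : ((a * x + b) * (c * x + d) + a * c * y ^+ 2) / q -
   ((a * u + b) * (c * u + d) + a * c * v ^+ 2) / r =
  (((a * x + b) * (c * x + d) + a * c * y ^+ 2) * r
   - ((a * u + b) * (c * u + d) + a * c * v ^+ 2) * q) / (q * r).
  by field; rewrite q0 r0.
have -> : y / q - v / r = (y * r - v * q) / (q * r).
  by field; rewrite q0 r0.
rewrite e1 e2 /D h mul1r !expr_div_n -mulrDl.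
set A := (c * x + d) * (c * u + d) - c ^+ 2 * y * v.
set B := c * y * (c * u + d) + c * v * (c * x + d).
have -> : ((x - u) * A + (y - v) * B) ^+ 2 + ((y - v) * A - (x - u) * B) ^+ 2
  = ((x - u) ^+ 2 + (y - v) ^+ 2) * (q * r) by rewrite /A /B /q /r; ring.
by field; rewrite q0 r0 z1 w1.
Qed.

Lemma hdistE z w : hdist z w = arcosh (1 + qdist z w / 2).
Proof. by rewrite /hdist /qdist; congr arcosh; congr (1 + _); rewrite -!mulrA !invfM; ring. Qed.

(** A fixed point off the real line is a root of the real quadratic c z^2 + (d - a) z - b, whose
    other root is the conjugate. The conclusion is Vieta's formulas without denominators, so it
    includes c = 0. *)
Lemma act_fix M z : mdet M = 1 -> 0 < z.2 -> act M z = z ->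
  m11 M = 2 * m21 M * z.1 + m22 M /\ m12 M = - m21 M * (z.1 ^+ 2 + z.2 ^+ 2).
Proof.
move=> h z0; have := mden_neq0 h z0.
rewrite /act /mobius /mden /=; case: M z h z0 => a b c d [x y] /=.
rewrite /mdet /= => h y0; set q := _ + _ => q0 [e1 e2].
have y1 : y != 0 by rewrite gt_eqF.
have q1 : q = 1 by apply: (mulfI y1); rewrite mulr1 -[in LHS]e2 mulfVK.
have e3 : (a * x + b) * (c * x + d) + a * c * y ^+ 2 = x by move: e1; rewrite q1 divr1.
have e4 : a = 2 * c * x + d.
  apply/subr0_eq; transitivity (a * (1 - q) + (a * d - b * c - 1) * (c * x + d) +
    c * ((a * x + b) * (c * x + d) + a * c * y ^+ 2 - x)); first by rewrite /q; ring.
  by rewrite q1 h e3; ring.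
split=> //.
have e5 : a * x + b = (c * x + d) * x - c * y ^+ 2.
  apply/subr0_eq; transitivity ((a * x + b) * (1 - q) - c * y ^+ 2 * (a * d - b * c - 1)
    + (c * x + d) * ((a * x + b) * (c * x + d) + a * c * y ^+ 2 - x)); first by rewrite /q; ring.
  by rewrite q1 h e3; ring.
have -> : b = (a * x + b) - a * x by ring.
by rewrite e5 e4; ring.
Qed.

Lemma act_fix2 M z w : mdet M = 1 -> 0 < z.2 -> 0 < w.2 -> z != w ->
  act M z = z -> act M w = w -> M = mone \/ M = mopp mone.
Proof.
move=> h z0 w0 zw ez ew.
have [e1 e2] := act_fix h z0 ez; have [f1 f2] := act_fix h w0 ew.
have c0 : m21 M = 0.
  apply/eqP; apply: contraNT zw => c0.
  have xx : z.1 = w.1 by apply: (mulfI c0); lra.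
  have rr : z.1 ^+ 2 + z.2 ^+ 2 = w.1 ^+ 2 + w.2 ^+ 2 by apply: (mulfI c0); lra.
  apply/eqP; move: xx rr z0 w0; case: z {ez e1 e2} => x y; case: w {ew f1 f2} => u v /= <- yv y0 v0.
  by congr pair; apply/eqP; rewrite -(@eqrXn2 _ 2%N) ?ltW //; apply/eqP; lra.
move: e1 e2; rewrite c0 !(mulr0, mul0r, add0r, oppr0) => e1 e2.
move: h; rewrite /mdet e1 c0 mulr0 subr0 -expr2 => /eqP; rewrite sqrf_eq1.
case/orP => /eqP d1; [left|right]; apply: matP => //=; lra.
Qed.

(** An orientation-preserving isometry other than the identity fixes at most one point of the plane;
    the sign is the kernel of the map to PSL(2, R). *)
Lemma act_eq2 M N z w : mdet M = 1 -> mdet N = 1 -> 0 < z.2 -> 0 < w.2 -> z != w ->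
  act M z = act N z -> act M w = act N w -> M = N \/ M = mopp N.
Proof.
move=> hM hN z0 w0 zw ez ew.
have F v : 0 < v.2 -> act M v = act N v -> act (mmul (madj N) M) v = v.
  by move=> v0 e; rewrite act_mul ?mdet_adj // e actK.
have hh : mdet (mmul (madj N) M) = 1 by rewrite mdet_mul mdet_adj hM hN mul1r.
case: (act_fix2 hh z0 w0 zw (F _ z0 ez) (F _ w0 ew)) => e; [left|right];
  rewrite -(mmulKVm M hN) e ?mmul1 //; apply: matP => /=; ring.
Qed.

End Matrices.

(** * Continuation of germs over boxes *)

Section Continuation.
Variable R : realType.
Implicit Types (z w : R * R) (a b c d x y t e : R).

Lemma near_boxP z (P : set (R * R)) :
  nbhs z P <-> exists2 e, 0 < e &
    forall w, `|z.1 - w.1| < e -> `|z.2 - w.2| < e -> P w.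
Proof.
split=> [/nbhs_ballP[e /= e0 he]|[e e0 he]]; first by exists e => // w w1 w2; apply: he; split.
by apply/nbhs_ballP; exists e => // w [w1 w2]; apply: he.
Qed.

Lemma near_lineP t (P : set R) :
  nbhs t P <-> exists2 e, 0 < e & forall s, `|t - s| < e -> P s.
Proof.
split=> [/nbhs_ballP[e /= e0 he]|[e e0 he]]; first by exists e.
by apply/nbhs_ballP; exists e.
Qed.

(** Connectedness of [a, b] for a transitive relation: the supremum of the points reachable from [a]
    has a neighbourhood that can be reached as well. It serves both to propagate agreement of germs
    and to glue extensions. *)
Lemma interval_induction (Q : R -> R -> Prop) a b : a <= b ->
  (forall x y t, x <= y -> y <= t -> Q x y -> Q y t -> Q x t) ->
  (forall t, a <= t <= b -> exists2 e, 0 < e &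
     forall x y, t - e < x -> x <= y -> y < t + e -> Q x y) ->
  Q a b.
Proof.
move=> ab Qtrans Qloc.
have Qaa : Q a a.
  have [|e e0 he] := Qloc a; first by rewrite lexx ab.
  by apply: he => //; lra.
pose S := [set y | a <= y <= b /\ Q a y].
have supS : has_sup S.
  split; first by exists a; split; rewrite ?lexx.
  by exists b => y [/andP[_ yb] _].
have Sa : S a by split; rewrite ?lexx.
have as_ : a <= sup S by apply: ub_le_sup => //; exact: supS.2.
have sb : sup S <= b by apply: ge_sup; [exact: supS.1|move=> y [/andP[_ yb] _]].
have [|e e0 he] := Qloc (sup S); first by rewrite as_ sb.
have [y [/andP[ay yb] Qay] ye] := sup_adherent e0 supS.
have ys : y <= sup S by apply: ub_le_sup; [exact: supS.2|split; rewrite ?ay].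
have step u : y <= u -> u < sup S + e -> Q a u.
  by move=> yu us; apply: (Qtrans a y u) => //; apply: he.
have [bs|bs] := ltP b (sup S + e); first by apply: step => //; lra.
have : sup S + e / 2 <= sup S; last by lra.
apply: ub_le_sup; first exact: supS.2.
split; first by apply/andP; split; lra.
by apply: step; lra.
Qed.

Variables (Y : Type) (L : R * R -> (R * R -> Y) -> Prop).

(** [L z f] stands for [f] being an admissible germ at [z]. The instances are continuous square
    roots, local isometries into the surface, and lifts of a map. *)
Definition germ_property := forall z f g, L z f ->
  (\forall w \near z, f w = g w) -> L z g.

(** The identity principle as a closedness statement: points where the germs agree cannot accumulate
    at a point where they differ. *)
Definition germ_rigid := forall z f g, L z f -> L z g ->
  \forall w \near z, (\forall v \near w, f v = g v) -> \forall v \near z, f v = g v.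

(** Boxes are closed and may be degenerate, so that the seam of a gluing is itself a box. *)
Definition in_box a b c d z := (a <= z.1 <= b) && (c <= z.2 <= d).

Definition extends_to_box a b c d := forall z f, in_box a b c d z -> L z f ->
  exists2 g, (forall w, in_box a b c d w -> L w g) & \forall w \near z, f w = g w.

Hypotheses (Lgerm : germ_property) (Lrigid : germ_rigid).

(** Along the segment the parameters with equal germs form a set that is open by the nature of germs
    and closed by rigidity. *)
Lemma agree_along_segment f g z w :
  (forall t, 0 <= t <= 1 -> let v := (z.1 + t * (w.1 - z.1), z.2 + t * (w.2 - z.2)) in
     L v f /\ L v g) ->
  (\forall v \near z, f v = g v) -> \forall v \near w, f v = g v.
Proof.
move=> hL.
pose seg t := (z.1 + t * (w.1 - z.1), z.2 + t * (w.2 - z.2)).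
pose Q s t := (\forall v \near seg s, f v = g v) -> \forall v \near seg t, f v = g v.
suff : Q 0 1.
  rewrite /Q /seg !mul0r !mul1r !addr0 /=; case: z w {hL seg Q} => [x y] [u v] /=.
  by rewrite !(addrC _ (_ - _)) !subrK.
apply: interval_induction; rewrite ?ler01 /Q //; first by move=> x y t _ _ h1 h2 /h1/h2.
move=> t t01.
have segc (A : set (R * R)) : nbhs (seg t) A -> \forall s \near t, A (seg s).
  have : {for t, continuous seg}.
    have lin p q : p + s * q @[s --> t] --> p + t * q.
      by apply: cvgD; [exact: cvg_cst|apply: cvgM; [exact: cvg_id|exact: cvg_cst]].
    exact: (cvg_pair (lin _ _) (lin _ _)).
  by move=> /(_ A).
suff : \forall s \near t,
   ((\forall v \near seg s, f v = g v) -> \forall v \near seg t, f v = g v) /\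
   ((\forall v \near seg t, f v = g v) -> \forall v \near seg s, f v = g v).
  move=> /near_lineP[e e0 he]; exists e => // x y tx xy yt.
  have [|h1 _] := he x; first by rewrite ltr_norml; apply/andP; split; lra.
  have [|_ h2] := he y; first by rewrite ltr_norml; apply/andP; split; lra.
  by move=> /h1/h2.
have [hf hg] := hL t t01.
have A1 := segc _ (Lrigid hf hg).
have A2 : \forall s \near t, (\forall v \near seg t, f v = g v) ->
   \forall v \near seg s, f v = g v.
  have [/nbhs_interior h|h] := pselect (\forall v \near seg t, f v = g v).
    by apply: filterS (segc _ h) => s hs _.
  by apply: filterS filterT => s _ /h.
by apply: filterS2 A1 A2 => s h1 h2; split.
Qed.

Lemma in_box_seg a b c d z w t : in_box a b c d z -> in_box a b c d w ->
  0 <= t <= 1 -> in_box a b c d (z.1 + t * (w.1 - z.1), z.2 + t * (w.2 - z.2)).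
Proof.
move=> /andP[/andP[h1 h2] /andP[h3 h4]] /andP[/andP[k1 k2] /andP[k3 k4]] /andP[t0 t1].
by rewrite /in_box /=; apply/andP; split; apply/andP; split; nra.
Qed.

Lemma agree_on_box a b c d f g z w : in_box a b c d z -> in_box a b c d w ->
  (forall v, in_box a b c d v -> L v f) -> (forall v, in_box a b c d v -> L v g) ->
  (\forall v \near z, f v = g v) -> \forall v \near w, f v = g v.
Proof.
move=> hz hw hf hg; apply: agree_along_segment => t t01 v.
by split; [apply: hf|apply: hg]; apply: in_box_seg.
Qed.

Lemma near_fst_lt z b : z.1 < b -> \forall w \near z, w.1 < b.
Proof.
move=> zb; apply/near_boxP; exists (b - z.1); first by lra.
by move=> w; rewrite ltr_norml => /andP[h1 h2] _; lra.
Qed.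

Lemma near_fst_gt z b : b < z.1 -> \forall w \near z, b < w.1.
Proof.
move=> zb; apply/near_boxP; exists (z.1 - b); first by lra.
by move=> w; rewrite ltr_norml => /andP[h1 h2] _; lra.
Qed.

Lemma near_snd_lt z b : z.2 < b -> \forall w \near z, w.2 < b.
Proof.
move=> zb; apply/near_boxP; exists (b - z.2); first by lra.
by move=> w _; rewrite ltr_norml => /andP[h1 h2]; lra.
Qed.

Lemma near_snd_gt z b : b < z.2 -> \forall w \near z, b < w.2.
Proof.
move=> zb; apply/near_boxP; exists (z.2 - b); first by lra.
by move=> w _; rewrite ltr_norml => /andP[h1 h2]; lra.
Qed.

Let glue (f g : R * R -> Y) b z := if z.1 <= b then f z else g z.

(** Agreement at the single point [z0] spreads over the whole seam, a degenerate box contained in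
    both halves. Hence near every point the glued map has the germ of one of the two pieces. *)
Lemma glue_L a b c d x f g z0 : a <= b -> b <= x -> z0.1 = b -> c <= z0.2 <= d ->
  (forall w, in_box a b c d w -> L w f) -> (forall w, in_box b x c d w -> L w g) ->
  (\forall v \near z0, f v = g v) ->
  [/\ forall w, in_box a x c d w -> L w (glue f g b),
      forall w, in_box a b c d w -> \forall v \near w, glue f g b v = f v
    & forall w, in_box b x c d w -> \forall v \near w, glue f g b v = g v].
Proof.
move=> ab bx zb zcd hf hg fg.
have E w : w.1 = b -> c <= w.2 <= d -> \forall v \near w, f v = g v.
  move=> wb wcd; apply: (@agree_on_box b b c d f g z0 w) => //.
  - by rewrite /in_box zb lexx.
  - by rewrite /in_box wb lexx.
  - move=> v /andP[/andP[h1 h2] h3]; apply: hf; rewrite /in_box h3 h2.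
    by rewrite (le_trans ab h1).
  - move=> v /andP[/andP[h1 h2] h3]; apply: hg; rewrite /in_box h3 h1.
    by rewrite (le_trans h2 bx).
have F w : in_box a b c d w -> \forall v \near w, glue f g b v = f v.
  move=> /andP[/andP[h1 h2] h3].
  have [wb|wb|wb] := ltgtP w.1 b; last 1 first.
  - apply: filterS (E _ wb h3) => v e; rewrite /glue; case: ifP => // _.
  - by apply: filterS (near_fst_lt wb) => v vb; rewrite /glue (ltW vb).
  - by move: h2; rewrite leNgt wb.
have G w : in_box b x c d w -> \forall v \near w, glue f g b v = g v.
  move=> /andP[/andP[h1 h2] h3].
  have [wb|wb|wb] := ltgtP w.1 b; last 1 first.
  - apply: filterS (E _ wb h3) => v e; rewrite /glue; case: ifP => // _.
  - by move: h1; rewrite leNgt wb.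
  - by apply: filterS (near_fst_gt wb) => v vb; rewrite /glue leNgt vb.
split=> // w /andP[/andP[h1 h2] h3].
have [wb|wb] := leP w.1 b.
  have wB : in_box a b c d w by rewrite /in_box h1 wb.
  by apply: (Lgerm (hf w wB)); apply: filterS (F w wB) => v ->.
have wB : in_box b x c d w by rewrite /in_box h2 h3 ltW.
by apply: (Lgerm (hg w wB)); apply: filterS (G w wB) => v ->.
Qed.

Lemma extends_glue_fst a b x c d : a <= b -> b <= x -> extends_to_box a b c d ->
  extends_to_box b x c d -> extends_to_box a x c d.
Proof.
move=> ab bx E1 E2 z h zB Lh.
have /andP[/andP[z1 z2] z34] := zB.
have [zb|zb] := leP z.1 b.
  have zB1 : in_box a b c d z by rewrite /in_box z1 zb.
  have [f hf hz] := E1 z h zB1 Lh.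
  have [||g hg hz'] := E2 (b, z.2) f; first by rewrite /in_box /= lexx bx.
    by apply: hf; rewrite /in_box /= lexx ab.
  have [k1 k2 k3] := @glue_L a b c d x f g (b, z.2) ab bx erefl z34 hf hg hz'.
  exists (glue f g b) => //; apply: filterS2 hz (k2 z zB1) => v -> ->; done.
have zB1 : in_box b x c d z by rewrite /in_box z2 z34 ltW.
have [f hf hz] := E2 z h zB1 Lh.
have [||g hg hz'] := E1 (b, z.2) f; first by rewrite /in_box /= lexx ab.
  by apply: hf; rewrite /in_box /= lexx bx.
have hz'' : \forall w \near (b, z.2), g w = f w by apply: filterS hz' => v ->.
have [k1 k2 k3] := @glue_L a b c d x g f (b, z.2) ab bx erefl z34 hg hf hz''.
exists (glue g f b) => //; apply: filterS2 hz (k3 z zB1) => v -> ->; done.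
Qed.

End Continuation.

Section ContinuationBoxes.
Variables (R : realType) (Y : Type).
Implicit Types (z w : R * R) (a b c d x y t e : R).
Variable L : R * R -> (R * R -> Y) -> Prop.
Hypotheses (Lgerm : germ_property L) (Lrigid : germ_rigid L).

Definition flip z : R * R := (z.2, z.1).

Lemma flipK z : flip (flip z) = z.
Proof. by case: z. Qed.

Lemma near_flip z (P : set (R * R)) :
  (\forall w \near flip z, P w) <-> \forall w \near z, P (flip w).
Proof.
split=> /near_boxP[e e0 he]; apply/near_boxP; exists e => // w w1 w2.
  exact: he.
by have := he (flip w) w2 w1; rewrite flipK.
Qed.

(** Exchanging the coordinates turns vertical gluing into horizontal gluing. *)
Let L' z f := L (flip z) (f \o flip).

Let L'germ : germ_property L'.
Proof.
by move=> z f g Lf fg; apply: (Lgerm Lf); apply/near_flip;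
  apply: filterS fg => w; rewrite /= flipK.
Qed.

Let L'rigid : germ_rigid L'.
Proof.
move=> z f g Lf Lg; have /near_flip h := Lrigid Lf Lg.
apply: filterS h => w h fw.
have {}h : \forall v \near flip z, (f \o flip) v = (g \o flip) v.
  by apply: h; apply/near_flip; apply: filterS fw => v; rewrite /= flipK.
by move/near_flip: h; apply: filterS => v; rewrite /= flipK.
Qed.

Let in_box_flip a b c d z : in_box c d a b (flip z) = in_box a b c d z.
Proof. by rewrite /in_box andbC. Qed.

Let extends_flip a b c d :
  extends_to_box L' c d a b <-> extends_to_box L a b c d.
Proof.
split=> E z f zB Lf.
  have [||g hg gz] := E (flip z) (f \o flip); first by rewrite in_box_flip.
    rewrite /L' flipK; apply: (Lgerm Lf); apply: filterE => w.
    by rewrite /= flipK.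
  exists (g \o flip).
    move=> w wB; have := hg (flip w); rewrite /L' flipK; apply.
    by rewrite in_box_flip.
  by move/near_flip: gz; apply: filterS => w; rewrite /= flipK.
have [||g hg gz] := E (flip z) (f \o flip) => //; first by rewrite in_box_flip.
exists (g \o flip).
  move=> w wB; apply: (Lgerm (hg (flip w) _)); first by rewrite in_box_flip.
  by apply: filterE => v /=; rewrite flipK.
by move/near_flip: gz; apply: filterS => w; rewrite /= flipK.
Qed.

Lemma extends_glue_snd a b c y d : c <= y -> y <= d -> extends_to_box L a b c y ->
  extends_to_box L a b y d -> extends_to_box L a b c d.
Proof.
move=> cy yd /extends_flip E1 /extends_flip E2; apply/extends_flip.
exact: (extends_glue_fst L'germ L'rigid cy yd E1 E2).
Qed.

Definition extends_locally z := exists2 e, 0 < e &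
  forall a b c d, z.1 - e < a -> a <= b -> b < z.1 + e ->
    z.2 - e < c -> c <= d -> d < z.2 + e -> extends_to_box L a b c d.

Lemma extends_locally_box a b c d : a <= b -> c <= d ->
  (forall z, in_box a b c d z -> extends_locally z) -> extends_to_box L a b c d.
Proof.
move=> ab cd hloc.
pose Q1 x y := extends_to_box L x y c d.
apply: (@interval_induction R Q1 a b ab); rewrite /Q1.
  by move=> x y t xy yt; exact: extends_glue_fst.
move=> x xab.
(* The width [e] is part of the inner relation, so that a whole column of small boxes is glued at
   one common width before the columns are glued side by side. *)
pose Q2 u v := exists2 e, 0 < e & forall x1 x2, x - e < x1 -> x1 <= x2 -> x2 < x + e ->
  extends_to_box L x1 x2 u v.
apply: (@interval_induction R Q2 c d cd); rewrite /Q2.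
  move=> u v w uv vw [e1 e10 h1] [e2 e20 h2]; exists (Num.min e1 e2); first by rewrite lt_min e10.
  move=> x1 x2 k1 k12 k2; apply: (extends_glue_snd uv vw).
    apply: h1 => //; [apply: le_lt_trans k1|apply: lt_le_trans k2 _].
      by rewrite lerD2l lerN2 ge_min lexx.
    by rewrite lerD2l ge_min lexx.
  apply: h2 => //; [apply: le_lt_trans k1|apply: lt_le_trans k2 _].
    by rewrite lerD2l lerN2 ge_min lexx orbT.
  by rewrite lerD2l ge_min lexx orbT.
move=> y ycd; have [|e e0 he] := hloc (x, y); first by rewrite /in_box /= xab ycd.
by exists e => // u v yu uv vy; exists e => // x1 x2 k1 k2 k3; apply: he.
Qed.

Variables (A B C D : nat -> R).
Hypothesis AB : forall n, A n <= B n.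
Hypothesis CD : forall n, C n <= D n.
Hypothesis nested : forall n, [/\ A n.+1 <= A n, B n <= B n.+1, C n.+1 <= C n & D n <= D n.+1].

Definition exhausted z := exists n, A n < z.1 < B n /\ C n < z.2 < D n.

Lemma extends_exhaustion z0 f0 : (forall n z, in_box (A n) (B n) (C n) (D n) z -> extends_locally z) ->
  in_box (A 0%N) (B 0%N) (C 0%N) (D 0%N) z0 -> exhausted z0 -> L z0 f0 ->
  exists2 g, (forall z, exhausted z -> L z g) & \forall z \near z0, f0 z = g z.
Proof.
move=> hloc z00 z0E Lf0.
have nest m n z : (m <= n)%N -> in_box (A m) (B m) (C m) (D m) z -> in_box (A n) (B n) (C n) (D n) z.
  move=> /subnK <-; elim: (n - m)%N => [|k IH]; first by rewrite add0n.
  move=> /IH /andP[/andP[h1 h2] /andP[h3 h4]]; rewrite addSn.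
  have [k1 k2 k3 k4] := nested (k + m)%N.
  by rewrite /in_box (le_trans k1 h1) (le_trans h2 k2) (le_trans k3 h3) (le_trans h4 k4).
have z0n n := nest _ _ _ (leq0n n) z00.
have /choice[g hg] : forall n, exists g, (forall w, in_box (A n) (B n) (C n) (D n) w -> L w g) /\
  \forall w \near z0, f0 w = g w.
  move=> n; have [g h1 h2] := extends_locally_box (AB n) (CD n) (hloc n) (z0n n) Lf0.
  by exists g.
have agree m n z : (m <= n)%N -> in_box (A m) (B m) (C m) (D m) z ->
  \forall w \near z, g m w = g n w.
  move=> mn zm; have [L1 e1] := hg m; have [L2 e2] := hg n.
  apply: (agree_on_box (z := z0) Lrigid (z0n m) zm L1).
  - by move=> v vm; apply: L2; apply: nest vm.
  - by apply: filterS2 e1 e2 => v <- <-.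
(* Each point uses some box that has it in its interior; by [agree] the choice does not affect the
   value, and 0 is only a default. *)
pose N z := xget 0%N [set n | A n < z.1 < B n /\ C n < z.2 < D n].
have NP z : exhausted z -> A (N z) < z.1 < B (N z) /\ C (N z) < z.2 < D (N z).
  by move=> [n hn]; rewrite /N; case: xgetP => [m _ //|/(_ n)].
have inN n z : A n < z.1 < B n -> C n < z.2 < D n -> in_box (A n) (B n) (C n) (D n) z.
  by move=> /andP[h1 h2] /andP[h3 h4]; rewrite /in_box !ltW.
pose G z := g (N z) z.
have agreeG n z : A n < z.1 < B n -> C n < z.2 < D n -> G z = g n z.
  move=> h1 h2; have [h3 h4] : A (N z) < z.1 < B (N z) /\ C (N z) < z.2 < D (N z).
    by apply: NP; exists n.
  rewrite /G; have [mn|/ltnW mn] := leqP (N z) n.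
    exact: nbhs_singleton (agree _ _ _ mn (inN _ _ h3 h4)).
  exact/esym/(nbhs_singleton (agree _ _ _ mn (inN _ _ h1 h2))).
have agreeGn n z : A n < z.1 < B n -> C n < z.2 < D n -> \forall w \near z, G w = g n w.
  move=> /andP[h1 h2] /andP[h3 h4].
  apply: filterS2 (filterI (near_fst_gt h1) (near_fst_lt h2))
    (filterI (near_snd_gt h3) (near_snd_lt h4)) => w [k1 k2] [k3 k4].
  by apply: agreeG; rewrite ?k1 ?k2 ?k3 ?k4.
exists G.
  move=> z [n [h1 h2]]; apply: (Lgerm ((hg n).1 z (inN _ _ h1 h2))).
  by apply: filterS (agreeGn _ _ h1 h2) => w ->.
have [n [h1 h2]] := z0E; apply: filterS2 (agreeGn _ _ h1 h2) (hg n).2 => w -> ->.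
by [].
Qed.

End ContinuationBoxes.

(** * Limits of algebraic expressions *)

Section Limits.
Variables (R : realType) (T : Type) (F : set_system T).
Context {FF : Filter F}.
Implicit Types (f g : T -> R) (p : T -> R * R) (a b : R).

Lemma lim_cst (k : R) : (fun=> k) x @[x --> F] --> k.
Proof. exact: cvg_cst. Qed.

Lemma lim_add f g a b : f x @[x --> F] --> a -> g x @[x --> F] --> b ->
  f x + g x @[x --> F] --> a + b.
Proof. exact: cvgD. Qed.

Lemma lim_opp f a : f x @[x --> F] --> a -> - f x @[x --> F] --> - a.
Proof. exact: cvgN. Qed.

Lemma lim_mul f g a b : f x @[x --> F] --> a -> g x @[x --> F] --> b ->
  f x * g x @[x --> F] --> a * b.
Proof. exact: cvgM. Qed.

Lemma lim_sqr f a : f x @[x --> F] --> a -> f x ^+ 2 @[x --> F] --> a ^+ 2.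
Proof. by move=> h; rewrite expr2; under eq_fun do rewrite expr2; exact: lim_mul. Qed.

Lemma lim_inv f a : a != 0 -> f x @[x --> F] --> a -> (f x)^-1 @[x --> F] --> a^-1.
Proof. exact: cvgV. Qed.

Lemma lim_sqrt f a : f x @[x --> F] --> a -> Num.sqrt (f x) @[x --> F] --> Num.sqrt a.
Proof. by move=> h; apply: (cvg_comp _ _ h); exact: sqrt_continuous. Qed.

Lemma lim_fst p (a : (R * R)%type) : p x @[x --> F] --> a -> (p x).1 @[x --> F] --> a.1.
Proof. by move=> h; apply: (cvg_comp _ _ h); exact: cvg_fst. Qed.

Lemma lim_snd p (a : (R * R)%type) : p x @[x --> F] --> a -> (p x).2 @[x --> F] --> a.2.
Proof. by move=> h; apply: (cvg_comp _ _ h); exact: cvg_snd. Qed.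

Lemma lim_pair f g a b : f x @[x --> F] --> a -> g x @[x --> F] --> b ->
  (f x, g x) @[x --> F] --> (a, b).
Proof. exact: cvg_pair. Qed.

End Limits.

(* Syntactic dispatch: blind unification of the lemmas above diverges. *)
Ltac lim1 := lazymatch goal with
  | |- cvg_to (nbhs (fmap (fun x => x) _)) _ => exact: cvg_id
  | |- cvg_to (nbhs (fmap (fun x => (@?a x, @?b x)) _)) _ => apply: lim_pair
  | |- cvg_to (nbhs (fmap (fun x => @?a x + @?b x) _)) _ => apply: lim_add
  | |- cvg_to (nbhs (fmap (fun x => - @?a x) _)) _ => apply: lim_opp
  | |- cvg_to (nbhs (fmap (fun x => @?a x * @?b x) _)) _ => apply: lim_mul
  | |- cvg_to (nbhs (fmap (fun x => @?a x ^+ 2) _)) _ => apply: lim_sqr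
  | |- cvg_to (nbhs (fmap (fun x => Num.sqrt (@?a x)) _)) _ => apply: lim_sqrt
  | |- cvg_to (nbhs (fmap (fun x => (@?a x)^-1) _)) _ => apply: lim_inv
  | |- cvg_to (nbhs (fmap (fun x => fst (@?a x)) _)) _ => apply: lim_fst
  | |- cvg_to (nbhs (fmap (fun x => snd (@?a x)) _)) _ => apply: lim_snd
  end.
Ltac lims := repeat first [
    match goal with H : ?A |- ?A => exact: H end
  | match goal with |- cvg_to (nbhs (fmap ?f _)) _ =>
      match f with fun _ => ?c => let g := constr:(c) in exact: lim_cst end end
  | lim1
  | match goal with H : cvg_to _ _ |- cvg_to _ _ => exact: H end ].

Lemma near_eq_continuous (T U : topologicalType) (f g : T -> U) x :
  (\forall y \near x, f y = g y) -> f @ x --> f x -> g @ x --> g x.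
Proof.
move=> fg fx; rewrite -(nbhs_singleton fg); move: fx; apply: cvg_trans.
by apply: near_eq_cvg; apply: filterS fg => y ->.
Qed.

(** * The planar Poincare-Miranda theorem *)

Section ComplexSquareRoot.
Variable R : realType.
Implicit Types (z w u v : R * R).

Definition csq u : R * R := (u.1 ^+ 2 - u.2 ^+ 2, 2 * u.1 * u.2).
Definition dot u v : R := u.1 * v.1 + u.2 * v.2.

Lemma csq_eq u v : csq u = csq v -> u = v \/ u = (- v.1, - v.2).
Proof.
case: u v => a b [c d]; rewrite /csq /= => -[h1 h2].
have e1 : (a - c) * (a + c) = (b - d) * (b + d) by lra.
have e2 : (a - c) * (b + d) = - (b - d) * (a + c) by lra.
have e3 : (a - c) * ((a + c) ^+ 2 + (b + d) ^+ 2) = 0.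
  transitivity ((a - c) * (a + c) * (a + c) + (a - c) * (b + d) * (b + d)); first by ring.
  by rewrite e1 e2; ring.
have e4 : (b - d) * ((a + c) ^+ 2 + (b + d) ^+ 2) = 0.
  transitivity ((b - d) * (b + d) * (b + d) + (b - d) * (a + c) * (a + c)); first by ring.
  by rewrite -e1 -[(b - d) * _]opprK -mulNr -e2; ring.
have [s0|s0] := eqVneq ((a + c) ^+ 2 + (b + d) ^+ 2) 0; last first.
  left; move/eqP: e3; move/eqP: e4; rewrite !mulf_eq0 (negPf s0) !orbF !subr_eq0.
  by move=> /eqP-> /eqP->.
right; move/eqP: s0; rewrite paddr_eq0 ?sqr_ge0 // !sqrf_eq0 !addr_eq0.
by move=> /andP[/eqP-> /eqP->].
Qed.

(** The principal branch of the complex square root, defined off the closed negative half-axis. *)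
Definition psqrt u : R * R :=
  let p := Num.sqrt ((Num.sqrt (u.1 ^+ 2 + u.2 ^+ 2) + u.1) / 2) in (p, u.2 / (2 * p)).

Lemma psqrt_gt0 u : 0 < Num.sqrt (u.1 ^+ 2 + u.2 ^+ 2) + u.1 -> 0 < (psqrt u).1.
Proof. by move=> u0; rewrite /= sqrtr_gt0 divr_gt0. Qed.

Lemma csq_psqrt u : 0 < Num.sqrt (u.1 ^+ 2 + u.2 ^+ 2) + u.1 -> csq (psqrt u) = u.
Proof.
move=> u0; have p0 := psqrt_gt0 u0; move: p0 u0; rewrite /csq /=.
set r := Num.sqrt (_ + _); set p := Num.sqrt _ => p0 u0.
have p1 : p != 0 by rewrite gt_eqF.
have r2 : r ^+ 2 = u.1 ^+ 2 + u.2 ^+ 2 by rewrite sqr_sqrtr // addr_ge0 ?sqr_ge0.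
have p2 : p ^+ 2 = (r + u.1) / 2 by rewrite sqr_sqrtr // divr_ge0 // ltW.
move: r p u0 p0 p1 r2 p2; case: u => a b /= r p u0 p0 p1 r2 p2; congr pair; last by field.
have -> : (b / (2 * p)) ^+ 2 = b ^+ 2 / (4 * p ^+ 2) by field.
have b2 : b ^+ 2 = r ^+ 2 - a ^+ 2 by lra.
by rewrite b2 p2; field; rewrite gt_eqF.
Qed.

Lemma csq_surj v : exists r, csq r = v.
Proof.
have [v0|v0] := ltP 0 (Num.sqrt (v.1 ^+ 2 + v.2 ^+ 2) + v.1).
  by exists (psqrt v); exact: csq_psqrt.
have [->|vn] := eqVneq v (0, 0).
  by exists (0, 0); rewrite /csq /= expr0n /= subr0 mulr0.
(* Here [v] lies on the negative half-axis, and its root is i times the principal root of its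
   opposite. *)
pose v' : R * R := (- v.1, - v.2).
have h : csq (psqrt v') = v'.
  apply: csq_psqrt; rewrite /= !sqrrN.
  suff : 0 < Num.sqrt (v.1 ^+ 2 + v.2 ^+ 2) by lra.
  move: vn; case: (v) => a b; rewrite xpair_eqE negb_and sqrtr_gt0 /= => /orP[h|h].
    by rewrite ltr_pwDl ?sqr_ge0 // exprn_even_gt0.
  by rewrite ltr_wpDl ?sqr_ge0 // exprn_even_gt0.
exists (- (psqrt v').2, (psqrt v').1); move: (psqrt v') h; rewrite /v' /csq => -[p q] /=.
by clear; case: v => a b /= [h1 h2]; congr pair; lra.
Qed.

Lemma sqrt_add_gt0 u : 0 < u.1 -> 0 < Num.sqrt (u.1 ^+ 2 + u.2 ^+ 2) + u.1.
Proof. by move=> u0; rewrite ltr_wpDl // sqrtr_ge0. Qed.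

Lemma psqrt_continuous u : 0 < u.1 -> psqrt @ u --> psqrt u.
Proof.
move=> u0; have p0 := psqrt_gt0 (sqrt_add_gt0 u0); rewrite /= in p0.
have n2 : (2 : R) != 0 by rewrite pnatr_eq0.
have p1 := mulf_neq0 n2 (lt0r_neq0 p0).
by rewrite /psqrt /=; lims.
Qed.

Variable F : R * R -> R * R.
Hypotheses (Fc : forall z, F @ z --> F z) (F0 : forall z, F z != (0, 0)).

Definition local_sqrt z f := \forall w \near z, csq (f w) = F w /\ f @ w --> f w.

Lemma local_sqrt_germ : germ_property local_sqrt.
Proof.
move=> z f g hf /nbhs_interior fg; apply: filterS2 hf fg => w [h1 h2] h3.
by split; [rewrite -(nbhs_singleton h3)|exact: near_eq_continuous h2].
Qed.

Lemma dot_continuous (T : topologicalType) (f g : T -> R * R) x :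
  f @ x --> f x -> g @ x --> g x -> dot (f y) (g y) @[y --> x] --> dot (f x) (g x).
Proof.
by move=> fx gx; rewrite /dot; lims.
Qed.

Lemma dot_self_gt0 v : v != (0, 0) -> 0 < dot v v.
Proof.
case: v => a b; rewrite xpair_eqE negb_and /dot /= -!expr2 => /orP[h|h].
  by rewrite ltr_pwDl ?sqr_ge0 // exprn_even_gt0.
by rewrite ltr_wpDl ?sqr_ge0 // exprn_even_gt0.
Qed.

Lemma local_sqrt_neq0 z f : csq (f z) = F z -> f z != (0, 0).
Proof.
move=> e; apply: contraNneq (F0 z) => f0.
by rewrite -e f0 /csq /= expr0n /= subr0 mulr0.
Qed.

Lemma local_sqrt_eq z f g : local_sqrt z f -> local_sqrt z g -> f z = g z ->
  \forall w \near z, f w = g w.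
Proof.
move=> hf hg e; have [f1 f2] := nbhs_singleton hf; have [g1 g2] := nbhs_singleton hg.
have : 0 < dot (f z) (g z) by rewrite -e dot_self_gt0 // local_sqrt_neq0.
move=> /(cvgr_gt _ (dot_continuous f2 g2)); apply: filterS3 hf hg => w [h1 _] [h2 _] h3.
have [//|e1] := csq_eq (etrans h1 (esym h2)).
move: h3; rewrite e1 /dot /= => h3; exfalso.
by have := sqr_ge0 (g w).1; have := sqr_ge0 (g w).2; lra.
Qed.

(** Two roots at [z] are equal or opposite. Equal ones agree nearby; opposite ones stay at an obtuse
    angle, so there is no nearby point of agreement and the implication is vacuous. *)
Lemma local_sqrt_rigid : germ_rigid local_sqrt.
Proof.
move=> z f g hf hg; have [f1 f2] := nbhs_singleton hf; have [g1 g2] := nbhs_singleton hg.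
have [e|e] := csq_eq (etrans f1 (esym g1)).
  by apply: filterE => w _; apply: local_sqrt_eq.
have : dot (f z) (g z) < 0.
  have : 0 < dot (g z) (g z) by rewrite dot_self_gt0 // local_sqrt_neq0.
  by rewrite e /dot /=; lra.
move=> /(cvgr_lt _ (dot_continuous f2 g2)); apply: filterS => w h h1; exfalso.
move: h; rewrite (nbhs_singleton h1) /dot; have := sqr_ge0 (g w).1; have := sqr_ge0 (g w).2; lra.
Qed.

(** The branch is [r] times the principal root of F w / F z, a quotient whose real part is positive
    when [F w] and [F z] form an acute angle. *)
Lemma sqrt_branch z r : csq r = F z -> exists g : R * R -> R * R, g z = r /\
  forall w, 0 < dot (F w) (F z) -> csq (g w) = F w /\ g @ w --> g w.
Proof.
move=> fz; pose n := dot (F z) (F z); have n0 : 0 < n by exact: dot_self_gt0.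
pose u w : R * R := (dot (F w) (F z) / n, ((F w).2 * (F z).1 - (F w).1 * (F z).2) / n).
pose mul (v w : R * R) : R * R := (v.1 * w.1 - v.2 * w.2, v.1 * w.2 + v.2 * w.1).
have csq_mul v w : csq (mul v w) = mul (csq v) (csq w).
  by rewrite /csq /mul /=; congr pair; ring.
have uc w : u @ w --> u w.
  have n1 : n != 0 by rewrite gt_eqF.
  by have Fw := @Fc w; rewrite /u /dot; lims.
exists (fun w => mul r (psqrt (u w))); split.
  have -> : u z = (1, 0).
    by rewrite /u -/n divff ?gt_eqF // [(F z).1 * _]mulrC subrr mul0r.
  rewrite /psqrt /= !mul0r expr1n expr0n addr0 sqrtr1 -[1 + 1]/(2 : R) divff // sqrtr1.
  by rewrite /mul /= !(mul0r, mulr1, mulr0, subr0, add0r) -surjective_pairing.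
move=> w d0; have u0 : 0 < (u w).1 by rewrite divr_gt0.
split.
  rewrite csq_mul fz csq_psqrt ?sqrt_add_gt0 // /u /mul /dot /=.
  move: n0; rewrite /n /dot; case: (F z) (F w) => p q [r' s] /= n0.
  have n1 : p * p + q * q != 0 by rewrite gt_eqF.
  by congr pair; field.
have cs : psqrt (u v) @[v --> w] --> psqrt (u w).
  by apply: (cvg_comp _ _ (uc w)); exact: psqrt_continuous.
by rewrite /mul; lims.
Qed.

Lemma near_dot_gt0 z : \forall p \near (z, z), 0 < dot (F p.1) (F p.2).
Proof.
have dc : dot (F p.1) (F p.2) @[p --> (z, z)] --> dot (F (z, z).1) (F (z, z).2).
  have h1 : F p.1 @[p --> (z, z)] --> F z.
    by apply: (@cvg_comp _ _ _ fst F (nbhs (z, z)) (nbhs z)); [exact: cvg_fst|exact: Fc].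
  have h2 : F p.2 @[p --> (z, z)] --> F z.
    by apply: (@cvg_comp _ _ _ snd F (nbhs (z, z)) (nbhs z)); [exact: cvg_snd|exact: Fc].
  by rewrite /dot; lims.
exact: (cvgr_gt _ dc _ (dot_self_gt0 (F0 z))).
Qed.

(** On a ball where any two values of [F] form an acute angle, a branch started at any point is
    valid throughout. *)
Lemma local_sqrt_extends z : extends_locally local_sqrt z.
Proof.
have /nbhs_ballP[e /= e0 he] := near_dot_gt0 z.
exists e => // a b c d za ab bz zc cd dz z' f zB Lf.
have box w : in_box a b c d w -> ball z e w.
  by move=> /andP[/andP[h1 h2] /andP[h3 h4]]; split; rewrite /ball /= ltr_norml; apply/andP; split; lra.
have [g [gz gP]] := sqrt_branch (nbhs_singleton Lf).1.
have Lg w : in_box a b c d w -> local_sqrt w g.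
  move=> /box wB; have dw : 0 < dot (F w) (F z') by apply: (he (w, z')); split=> //; apply: box.
  have dc : dot (F v) (F z') @[v --> w] --> dot (F w) (F z').
    by have Fw := @Fc w; rewrite /dot; lims.
  by apply: filterS (cvgr_gt _ dc _ dw) => v; exact: gP.
by exists g => //; apply: local_sqrt_eq => //; exact: Lg.
Qed.

Lemma complex_sqrt_exists : exists f : R * R -> R * R,
  forall z, csq (f z) = F z /\ f @ z --> f z.
Proof.
pose A n : R := - n.+1%:R; pose B n : R := n.+1%:R.
have AB n : A n <= B n by rewrite /A /B; have := ler0n R n.+1; lra.
have nested n : [/\ A n.+1 <= A n, B n <= B n.+1, A n.+1 <= A n & B n <= B n.+1].
  by rewrite /A /B lerN2 ler_nat.
pose o : R * R := (0, 0).
have o0 : in_box (A 0%N) (B 0%N) (A 0%N) (B 0%N) o.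
  by rewrite /in_box /A /B /=; apply/andP; split; lra.
have ex z : exhausted A B A B z.
  have := archi_boundP (addr_ge0 (normr_ge0 z.1) (normr_ge0 z.2)).
  set k := Num.bound _ => hk; exists k; rewrite /A /B -!ltr_norml -natr1.
  by have := normr_ge0 z.1; have := normr_ge0 z.2; move=> h1 h2; split; lra.
have [r hr] := csq_surj (F o).
have [f0 [f0o f0P]] := sqrt_branch hr.
have Lf0 : local_sqrt o f0.
  have dc : dot (F v) (F o) @[v --> o] --> dot (F o) (F o).
    by have Fw := @Fc o; rewrite /dot; lims.
  by apply: filterS (cvgr_gt _ dc _ (dot_self_gt0 (F0 o))) => v; exact: f0P.
have [g hg _] := extends_exhaustion local_sqrt_germ local_sqrt_rigid AB AB nested
  (fun n z _ => local_sqrt_extends z) o0 (ex o) Lf0.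
by exists g => z; exact: nbhs_singleton (hg z (ex z)).
Qed.

End ComplexSquareRoot.

Section PoincareMiranda.
Variable R : realType.
Implicit Types (z w : R * R) (s t : R).

Lemma same_sign (k : R -> R) s t : s <= t -> (forall u, k @ u --> k u) ->
  (forall u, s <= u <= t -> k u != 0) -> 0 < k s * k t.
Proof.
move=> st kc k0.
have wc : {within `[s, t], continuous k} by apply: continuous_subspaceT; exact: kc.
rewrite ltNge; apply/negP => h.
have : Num.min (k s) (k t) <= 0 <= Num.max (k s) (k t).
  rewrite ge_min le_max; have [s0|s0] := ltP 0 (k s); last first.
    rewrite /=; have [t0|t0] := leP 0 (k t); first by rewrite orbT.
    by rewrite orbF; nra.
  have [t0|t0] := ltP 0 (k t); last by rewrite orbT (ltW s0).
  by move: h; rewrite leNgt mulr_gt0.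
move=> /(IVT st wc)[u]; rewrite in_itv /= => ust ku.
by have := k0 u ust; rewrite ku eqxx.
Qed.

(** A map without zeros would have a continuous square root [G]. The signs of [F] keep the first
    component of [G] from vanishing on the right side of the square, the second on the left side,
    and both on the top and the bottom. This contradicts the odd winding number of [F] along the
    boundary. *)
Lemma poincare_miranda (F : R * R -> R * R) (S : R) : 0 < S ->
  (forall z, F @ z --> F z) ->
  (forall t, - S <= t <= S -> (F (- S, t)).1 < 0 /\ 0 < (F (S, t)).1) ->
  (forall s, - S <= s <= S -> (F (s, - S)).2 < 0 /\ 0 < (F (s, S)).2) ->
  exists z, F z = (0, 0).
Proof.
move=> S0 Fc h1 h2; apply: contrapT => noz.
have F0 z : F z != (0, 0) by apply/eqP => Fz; apply: noz; exists z.
have [G hG] := complex_sqrt_exists Fc F0.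
have Gsq z : (G z).1 ^+ 2 - (G z).2 ^+ 2 = (F z).1 /\ 2 * (G z).1 * (G z).2 = (F z).2.
  by have [<- _] := hG z.
have ch1 s u : (G (s, t)).1 @[t --> u] --> (G (s, u)).1.
  apply: lim_fst; apply: (@cvg_comp _ _ _ (fun t => (s, t)) G _ (nbhs (s, u))); last by have [] := hG (s, u).
  by apply: lim_pair; [exact: lim_cst|exact: cvg_id].
have ch2 s u : (G (s, t)).2 @[t --> u] --> (G (s, u)).2.
  apply: lim_snd; apply: (@cvg_comp _ _ _ (fun t => (s, t)) G _ (nbhs (s, u))); last by have [] := hG (s, u).
  by apply: lim_pair; [exact: lim_cst|exact: cvg_id].
have cv1 t u : (G (s, t)).1 @[s --> u] --> (G (u, t)).1.
  apply: lim_fst; apply: (@cvg_comp _ _ _ (fun s => (s, t)) G _ (nbhs (u, t))); last by have [] := hG (u, t).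
  by apply: lim_pair; [exact: cvg_id|exact: lim_cst].
have cv2 t u : (G (s, t)).2 @[s --> u] --> (G (u, t)).2.
  apply: lim_snd; apply: (@cvg_comp _ _ _ (fun s => (s, t)) G _ (nbhs (u, t))); last by have [] := hG (u, t).
  by apply: lim_pair; [exact: cvg_id|exact: lim_cst].
have SS : - S <= S by lra.
have right_ : 0 < (G (S, - S)).1 * (G (S, S)).1.
  apply: (same_sign SS (ch1 S)) => u /h1[_ hu]; apply: contraTneq hu => e.
  by have [<- _] := Gsq (S, u); rewrite e; have := sqr_ge0 (G (S, u)).2; lra.
have left_ : 0 < (G (- S, - S)).2 * (G (- S, S)).2.
  apply: (same_sign SS (ch2 (- S))) => u /h1[hu _]; apply: contraTneq hu => e.
  by have [<- _] := Gsq (- S, u); rewrite e; have := sqr_ge0 (G (- S, u)).1; lra.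
have top1 : 0 < (G (- S, S)).1 * (G (S, S)).1.
  apply: (same_sign SS (cv1 S)) => u /h2[_ hu]; apply: contraTneq hu => e.
  by have [_ <-] := Gsq (u, S); rewrite e mulr0 mul0r ltxx.
have top2 : 0 < (G (- S, S)).2 * (G (S, S)).2.
  apply: (same_sign SS (cv2 S)) => u /h2[_ hu]; apply: contraTneq hu => e.
  by have [_ <-] := Gsq (u, S); rewrite e mulr0 ltxx.
have bot1 : 0 < (G (- S, - S)).1 * (G (S, - S)).1.
  apply: (same_sign SS (cv1 (- S))) => u /h2[hu _]; apply: contraTneq hu => e.
  by have [_ <-] := Gsq (u, - S); rewrite e mulr0 mul0r ltxx.
have bot2 : 0 < (G (- S, - S)).2 * (G (S, - S)).2.
  apply: (same_sign SS (cv2 (- S))) => u /h2[hu _]; apply: contraTneq hu => e.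
  by have [_ <-] := Gsq (u, - S); rewrite e mulr0 ltxx.
have [_ tr] := Gsq (S, S); have [_ br] := Gsq (S, - S).
have [_] : (F (S, - S)).2 < 0 /\ 0 < (F (S, S)).2 by apply: h2; rewrite SS lexx.
have [+ _] : (F (S, - S)).2 < 0 /\ 0 < (F (S, S)).2 by apply: h2; rewrite SS lexx.
rewrite -tr -br => n1' p1'.
have n1 : (G (S, - S)).1 * (G (S, - S)).2 < 0 by lra.
have p1 : 0 < (G (S, S)).1 * (G (S, S)).2 by lra.
(* The second component of [G] keeps its sign along bottom, left side and top, the first along the
   right side. So their product, which is half of [(F z).2], would have the same sign at (S, - S)
   and (S, S). *)
have : 0 < ((G (S, - S)).1 * (G (S, S)).1) * (((G (- S, - S)).2 * (G (- S, S)).2) *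
  ((G (- S, S)).2 * (G (S, S)).2) * ((G (- S, - S)).2 * (G (S, - S)).2)).
  exact: (mulr_gt0 right_ (mulr_gt0 (mulr_gt0 left_ top2) bot2)).
have -> : ((G (S, - S)).1 * (G (S, S)).1) * (((G (- S, - S)).2 * (G (- S, S)).2) *
  ((G (- S, S)).2 * (G (S, S)).2) * ((G (- S, - S)).2 * (G (S, - S)).2)) =
  ((G (S, - S)).1 * (G (S, - S)).2) * ((G (S, S)).1 * (G (S, S)).2 *
   ((G (- S, - S)).2 ^+ 2 * (G (- S, S)).2 ^+ 2)) by ring.
rewrite nmulr_rgt0 // pmulr_rlt0 //.
by rewrite ltNge mulr_ge0 ?sqr_ge0.
Qed.

End PoincareMiranda.

(** * Crossing of equivariant curves *)

Section EquivariantCurves.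
Variable R : realType.
Implicit Types (z w : R * R) (M N K : mat R).

(** Translation by [x] along the imaginary axis, that is z -> e^x z. *)
Definition diagm (x : R) : mat R := Mat (expR (x / 2)) 0 0 (expR (- (x / 2))).

Lemma mdet_diagm x : mdet (diagm x) = 1.
Proof. by rewrite /mdet /= mul0r subr0 -expRD subrr expR0. Qed.

Lemma diagmD x y : mmul (diagm x) (diagm y) = diagm (x + y).
Proof.
by apply: matP; rewrite /= ?mulr0 ?mul0r ?addr0 ?add0r // -expRD; congr expR; field.
Qed.

Lemma diagm0 : diagm 0 = mone R.
Proof. by rewrite /diagm mul0r oppr0 expR0. Qed.

Lemma madj_diagm x : madj (diagm x) = diagm (- x).
Proof. by apply: matP; rewrite /= ?oppr0 // -?mulNr ?opprK. Qed.

Lemma act_diagm x z : act (diagm x) z = (expR x * z.1, expR x * z.2).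
Proof.
have e2 : expR x * expR (- (x / 2)) ^+ 2 = 1.
  by rewrite expr2 -!expRD -[RHS]expR0; congr expR; field.
have n0 : expR (- (x / 2)) != 0 by rewrite gt_eqF // expR_gt0.
have e1 : expR (x / 2) = expR x * expR (- (x / 2)) by rewrite -expRD; congr expR; field.
rewrite /act /mobius /= !mul0r !add0r !mulr0 !addr0 expr0n addr0.
have q0 : expR (- (x / 2)) ^+ 2 != 0 by rewrite expf_neq0.
congr pair; apply: (mulIf q0); rewrite divfK //.
  by rewrite e1; ring.
by rewrite mulrAC e2 mul1r.
Qed.

Definition nsq z : R := z.1 ^+ 2 + z.2 ^+ 2.

Lemma nsq_gt0 z : 0 < z.2 -> 0 < nsq z.
Proof. by move=> z0; rewrite ltr_wpDl ?sqr_ge0 // exprn_gt0. Qed.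

Lemma nsq_act M z : mdet M = 1 -> 0 < z.2 -> nsq (act M z) =
  ((m11 M * z.1 + m12 M) ^+ 2 + (m11 M * z.2) ^+ 2) / mden M z.
Proof.
move=> h z0; have := mden_neq0 h z0; rewrite /nsq /act /mobius /mden /=.
case: M z h z0 => a b c d [x y]; rewrite /mdet /= => h z0; set q := _ + _ => q0.
rewrite !expr_div_n -mulrDl.
have -> : ((a * x + b) * (c * x + d) + a * c * y ^+ 2) ^+ 2 + y ^+ 2 =
  ((a * x + b) ^+ 2 + (a * y) ^+ 2) * q + (1 - (a * d - b * c) ^+ 2) * y ^+ 2.
  by rewrite /q; ring.
by rewrite h expr1n subrr mul0r addr0; field.
Qed.

(* Circles centred at 0 and their images under [K] meet at most once in the
   upper half-plane. *)
Lemma nsq_inj K z w : mdet K = 1 -> 0 < m11 K * m22 K < 1 -> 0 < z.2 -> 0 < w.2 ->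
  nsq z = nsq w -> nsq (act K z) = nsq (act K w) -> z = w.
Proof.
move=> h ad z0 w0 e1; rewrite !nsq_act // => /eqP.
rewrite eqr_div ?mden_neq0 //.
rewrite /mden; case: K z w h ad z0 w0 e1 => a b c d [x y] [u v]; rewrite /mdet /nsq /=.
move=> h /andP[ad0 ad1] y0 v0 e1 /eqP e2.
have bc : b * c < 0 by lra.
have xu : x = u.
  (* Clearing denominators leaves a multiple of (x - u) k, and k does not vanish because b d and - a
     c have the same sign. *)
  pose k := b * d - a * c * (x ^+ 2 + y ^+ 2).
  have k0 : k != 0.
    have kk : k * (b * d) = (b * d) ^+ 2 + (- (a * d * (b * c))) * (x ^+ 2 + y ^+ 2).
      by rewrite /k; ring.
    have abcd : a * d * (b * c) < 0 by rewrite pmulr_rlt0.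
    have bd : b * d != 0.
      by apply: contraTneq abcd => bd; rewrite (_ : _ * _ = b * d * (a * c)); [rewrite bd mul0r ltxx|ring].
    have : 0 < k * (b * d).
      by rewrite kk ltr_pwDl ?exprn_even_gt0 // mulr_ge0 ?addr_ge0 ?sqr_ge0 // oppr_ge0 ltW.
    by apply: contraTneq => ->; rewrite mul0r ltxx.
  have nE (p q s t : R) : (p * s + q) ^+ 2 + (p * t) ^+ 2 = p ^+ 2 * (s ^+ 2 + t ^+ 2) + 2 * p * q * s + q ^+ 2.
    by ring.
  have : (x - u) * (k * (a * d - b * c)) = 0.
    apply/(mulfI (_ : (2 : R) != 0)); rewrite ?pnatr_eq0 // mulr0.
    move: e2; rewrite !nE -e1 => /eqP; rewrite -subr_eq0 => /eqP <-.
    by rewrite /k; ring.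
  by rewrite h mulr1 => /eqP; rewrite mulf_eq0 (negPf k0) orbF subr_eq0 => /eqP.
move: e1; rewrite xu => /addrI e1; congr pair.
by apply/eqP; rewrite -(@eqrXn2 _ 2%N) ?ltW //; apply/eqP.
Qed.

(** The cone is a tube of bounded radius about the imaginary axis. Its image under [K] can approach
    the real line only at b/d and a/c, both finite and different from 0. *)
Lemma nsq_act_cone K (th : R) : mdet K = 1 -> 0 < m11 K * m22 K < 1 -> 0 <= th < 1 ->
  exists m B : R, 0 < m /\ forall z, 0 < z.2 -> z.1 ^+ 2 <= th ^+ 2 * nsq z ->
    m < nsq (act K z) < B.
Proof.
case: K => a b c d; rewrite /mdet /= => h /andP[ad0 ad1] /andP[th0 th1].
have bc : b * c < 0 by lra.
have a2 : 0 < a ^+ 2.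
  by rewrite exprn_even_gt0 //=; apply: contraTneq ad0 => ->; rewrite mul0r ltxx.
have b2 : 0 < b ^+ 2.
  by rewrite exprn_even_gt0 //=; apply: contraTneq bc => ->; rewrite mul0r ltxx.
have c2 : 0 < c ^+ 2.
  by rewrite exprn_even_gt0 //=; apply: contraTneq bc => ->; rewrite mulr0 ltxx.
have d2 : 0 < d ^+ 2.
  by rewrite exprn_even_gt0 //=; apply: contraTneq ad0 => ->; rewrite mulr0 ltxx.
(* In the cone the cross term 2 p q x is at most [th] times p^2 |z|^2 + q^2 in absolute value, so |p
   z + q|^2 is comparable with that sum. *)
have bnd p q z : 0 < z.2 -> z.1 ^+ 2 <= th ^+ 2 * nsq z ->
  (1 - th) * (p ^+ 2 * nsq z + q ^+ 2) <= (p * z.1 + q) ^+ 2 + (p * z.2) ^+ 2 <=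
    2 * (p ^+ 2 * nsq z + q ^+ 2).
  move=> z0 hz; have -> : (p * z.1 + q) ^+ 2 + (p * z.2) ^+ 2 = p ^+ 2 * nsq z + q ^+ 2 + 2 * (p * q * z.1).
    by rewrite /nsq; ring.
  set u := p ^+ 2 * nsq z + q ^+ 2; set v := p * q * z.1.
  have u0 : 0 <= u by rewrite addr_ge0 ?sqr_ge0 // mulr_ge0 ?sqr_ge0 // ltW // nsq_gt0.
  have uv : (2 * v) ^+ 2 <= (th * u) ^+ 2.
    apply: (@le_trans _ _ (4 * (p * q) ^+ 2 * (th ^+ 2 * nsq z))).
      rewrite (_ : (2 * v) ^+ 2 = 4 * (p * q) ^+ 2 * z.1 ^+ 2); last by rewrite /v; ring.
      by rewrite ler_wpM2l // mulr_ge0 ?sqr_ge0.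
    rewrite -subr_ge0 (_ : _ - _ = (th * (p ^+ 2 * nsq z - q ^+ 2)) ^+ 2) ?sqr_ge0 //.
    by rewrite /u; ring.
  have tu : 0 <= th * u by rewrite mulr_ge0.
  have : `|2 * v| <= th * u by rewrite -(ler_pXn2r (n := 2)) ?nnegrE // real_normK // num_real.
  by rewrite ler_norml => /andP[h1 h2]; apply/andP; split; nra.
have k0 : 0 < 1 - th by lra.
pose mab := Num.min (a ^+ 2) (b ^+ 2); pose mcd := Num.min (c ^+ 2) (d ^+ 2).
have mab0 : 0 < mab by rewrite lt_min a2 b2.
have mcd0 : 0 < mcd by rewrite lt_min c2 d2.
exists ((1 - th) * mab / (4 * (c ^+ 2 + d ^+ 2))), (4 * (a ^+ 2 + b ^+ 2) / ((1 - th) * mcd)).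
have ab0 : 0 < 4 * (a ^+ 2 + b ^+ 2) by rewrite mulr_gt0 // addr_gt0.
have cd0 : 0 < 4 * (c ^+ 2 + d ^+ 2) by rewrite mulr_gt0 // addr_gt0.
have kab0 := mulr_gt0 k0 mab0; have kcd0 := mulr_gt0 k0 mcd0.
split; first by rewrite divr_gt0.
move=> z z0 hz; rewrite nsq_act // /=.
have n0 := nsq_gt0 z0.
have /andP[l1 r1] := bnd a b z z0 hz; have /andP[l2 r2] := bnd c d z z0 hz.
have q0 : 0 < mden (Mat a b c d) z by rewrite mden_gt0.
rewrite /mden /= in q0 *.
move: l1 r1 l2 r2 q0; set A := (a * z.1 + b) ^+ 2 + _; set C := (c * z.1 + d) ^+ 2 + _.
move=> l1 r1 l2 r2 C0.
have s0 : 0 < nsq z + 1 by rewrite addr_gt0.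
have A1 : (1 - th) * mab * (nsq z + 1) <= A.
  apply: le_trans l1; rewrite -mulrA ler_wpM2l ?(ltW k0) // mulrDr mulr1 lerD //.
    by rewrite ler_wpM2r ?(ltW n0) // ge_min lexx.
  by rewrite ge_min lexx orbT.
have C1 : (1 - th) * mcd * (nsq z + 1) <= C.
  apply: le_trans l2; rewrite -mulrA ler_wpM2l ?(ltW k0) // mulrDr mulr1 lerD //.
    by rewrite ler_wpM2r ?(ltW n0) // ge_min lexx.
  by rewrite ge_min lexx orbT.
have A2 : A < 4 * (a ^+ 2 + b ^+ 2) * (nsq z + 1) by nra.
have C2 : C < 4 * (c ^+ 2 + d ^+ 2) * (nsq z + 1) by nra.
apply/andP; split.
  rewrite ltr_pdivrMr // mulrAC ltr_pdivlMr //.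
  have : C * ((1 - th) * mab) < 4 * (c ^+ 2 + d ^+ 2) * (nsq z + 1) * ((1 - th) * mab).
    by rewrite ltr_pM2r.
  have : 4 * (c ^+ 2 + d ^+ 2) * ((1 - th) * mab * (nsq z + 1)) <= 4 * (c ^+ 2 + d ^+ 2) * A.
    by rewrite ler_wpM2l // ltW.
  lra.
rewrite ltr_pdivlMr // mulrAC ltr_pdivrMr //.
have : A * ((1 - th) * mcd) < 4 * (a ^+ 2 + b ^+ 2) * (nsq z + 1) * ((1 - th) * mcd).
  by rewrite ltr_pM2r.
have : 4 * (a ^+ 2 + b ^+ 2) * ((1 - th) * mcd * (nsq z + 1)) <= 4 * (a ^+ 2 + b ^+ 2) * C.
  by rewrite ler_wpM2l // ltW.
lra.
Qed.

End EquivariantCurves.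

Lemma periodic_int (R : realType) (Y : Type) (f : R -> Y) (l : R) :
  (forall t, f (t + l) = f t) -> forall (n : int) t, f (t + l * n%:~R) = f t.
Proof.
move=> fl n t; have fn m u : f (u + l * m%:R) = f u.
  elim: m u => [|m IH] u; first by rewrite mulr0 addr0.
  by rewrite -natr1 mulrDr mulr1 addrA fl IH.
case: n => m; first exact: fn.
by rewrite NegzE mulrNz -pmulrn -(fn m.+1 (t + _)) mulrN subrK.
Qed.

Section EquivariantCurvesCross.
Variable R : realType.
Implicit Types (z w : R * R) (M N K : mat R) (A B : R -> R * R) (L s t : R).

Lemma frac_itv t : 0 <= t - (Num.floor t)%:~R < 1.
Proof. by have := Num.Theory.floor_itv t; rewrite intrD subr_ge0 ltrBlDl addrC. Qed.

Lemma nsq_diagm L z : nsq (act (diagm L) z) = expR L ^+ 2 * nsq z.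
Proof. by rewrite act_diagm /nsq /= !exprMn mulrDr. Qed.

(** The ratio x^2 / |z|^2 is invariant under dilations, hence periodic along [A]; its maximum over
    one period is below 1. *)
Lemma equivariant_in_cone A L : (forall t, A @ t --> A t) -> (forall t, 0 < (A t).2) ->
  (forall t, A (t + 1) = act (diagm L) (A t)) ->
  exists2 th, 0 <= th < 1 & forall t, (A t).1 ^+ 2 <= th ^+ 2 * nsq (A t).
Proof.
move=> Ac A0 AL; have n0 t := nsq_gt0 (A0 t).
pose q t := (A t).1 ^+ 2 / nsq (A t).
have qc t : q s @[s --> t] --> q t.
  by have n1 := lt0r_neq0 (n0 t); have At := Ac t; move: n1; rewrite /q /nsq => n1; lims.
have [c _ cmax] := @EVT_max R q 0 1 ler01 (continuous_subspaceT qc).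
have q0 t : 0 <= q t by rewrite divr_ge0 ?sqr_ge0 // ltW.
have q1 t : q t < 1.
  by rewrite ltr_pdivrMr // mul1r /nsq ltrDl exprn_gt0.
exists (Num.sqrt (q c)).
  by rewrite sqrtr_ge0 -(@sqrtr1 R) ltr_sqrt // q1.
move=> t; rewrite sqr_sqrtr // -ler_pdivrMr // -/(q t).
have qp u : q (u + 1) = q u.
  rewrite /q AL nsq_diagm act_diagm /= exprMn -mulf_div divff ?mul1r //.
  by rewrite expf_neq0 // gt_eqF ?expR_gt0.
rewrite -(periodic_int qp (- Num.floor t)) mulrNz mul1r; apply: cmax.
by rewrite in_itv /=; have /andP[-> /ltW->] := frac_itv t.
Qed.

Lemma nsq_equivariant A L n : (forall t, 0 < (A t).2) ->
  (forall t, A (t + 1) = act (diagm L) (A t)) ->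
  nsq (A n%:R) = expR (2 * L * n%:R) * nsq (A 0) /\
  nsq (A (- n%:R)) = expR (- (2 * L * n%:R)) * nsq (A 0).
Proof.
move=> A0 AL.
have e t : nsq (A (t + 1)) = expR (2 * L) * nsq (A t).
  by rewrite AL nsq_diagm expr2 -expRD; congr (expR _ * _); ring.
elim: n => [|n [IH1 IH2]]; first by rewrite !mulr0 !oppr0 expR0 mul1r.
rewrite -natr1; split; first by rewrite e IH1 mulrA -expRD; congr (expR _ * _); ring.
apply: (mulfI (lt0r_neq0 (expR_gt0 (2 * L)))); rewrite -e opprD subrK IH2 mulrA -expRD.
by congr (expR _ * _); ring.
Qed.

Lemma expR_ge_bound (L C : R) : 0 < L -> exists n : nat, (0 < n)%N /\
   forall m, (n <= m)%N -> C < expR (2 * L * m%:R).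
Proof.
move=> L0; exists (Num.bound (`|C| / (2 * L))).+1; split=> // m nm.
have L2 : 0 < 2 * L by rewrite mulr_gt0.
apply: le_lt_trans (ler_norm C) _; apply: lt_le_trans (expR_ge1Dx _); apply: ltr_wpDl => //.
rewrite mulrC -ltr_pdivrMr //; apply: lt_le_trans (archi_boundP _) _.
  by rewrite divr_ge0 // ltW.
by rewrite ler_nat (leq_trans _ nm).
Qed.

(* By [nsq_inj], a common zero of [|A s| - |K (B t)|] and [|B t| - |K^-1 (A s)|]
   is a crossing; Poincare-Miranda provides one on a large square. *)
Lemma equivariant_curves_cross A B K L : 0 < L -> mdet K = 1 -> 0 < m11 K * m22 K < 1 ->
  (forall t, A @ t --> A t) -> (forall t, B @ t --> B t) ->
  (forall t, 0 < (A t).2) -> (forall t, 0 < (B t).2) ->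
  (forall t, A (t + 1) = act (diagm L) (A t)) ->
  (forall t, B (t + 1) = act (diagm L) (B t)) ->
  exists s t, A s = act K (B t).
Proof.
move=> L0 hK ad Ac Bc A0 B0 AL BL.
have [thA thA1 cA] := equivariant_in_cone Ac A0 AL.
have [thB thB1 cB] := equivariant_in_cone Bc B0 BL.
have adj : 0 < m11 (madj K) * m22 (madj K) < 1 by rewrite /= mulrC.
have [m1 [M1 [m10 b1]]] := nsq_act_cone hK ad thB1.
have [m2 [M2 [m20 b2]]] := nsq_act_cone (mdet1_adj hK) adj thA1.
have nA := nsq_gt0 (A0 0); have nB := nsq_gt0 (B0 0).
(* [m1] and [M1] bound |K B|^2, [m2] and [M2] bound |K^-1 A|^2. After [n] periods in either
   direction |A|^2 and |B|^2 lie outside these bounds, which gives the boundary signs. *)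
pose C := Num.max (Num.max (M1 / nsq (A 0)) (nsq (A 0) / m1))
                  (Num.max (M2 / nsq (B 0)) (nsq (B 0) / m2)).
have [n [n0 hn]] := expR_ge_bound C L0; have {hn} := hn n (leqnn _).
rewrite /C !gt_max => /andP[/andP[k1 k2] /andP[k3 k4]].
pose F z : R * R := (nsq (A z.1) - nsq (act K (B z.2)), nsq (B z.2) - nsq (act (madj K) (A z.1))).
have actc N (D : R -> R * R) t : mdet N = 1 -> D @ t --> D t -> 0 < (D t).2 ->
    act N (D s) @[s --> t] --> act N (D t).
  move=> hN Dt D0; have := mden_neq0 hN D0; rewrite /mden => q0.
  by rewrite /act /mobius; lims.
have Fc z : F @ z --> F z.
  have cA' : A w.1 @[w --> z] --> A z.1 by apply: (cvg_comp _ _ cvg_fst); exact: Ac.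
  have cB' : B w.2 @[w --> z] --> B z.2 by apply: (cvg_comp _ _ cvg_snd); exact: Bc.
  have cKB : act K (B w.2) @[w --> z] --> act K (B z.2).
    by apply: (@cvg_comp _ _ _ snd (fun t => act K (B t)) (nbhs z) (nbhs z.2)); [exact: cvg_snd|exact: actc].
  have cKA : act (madj K) (A w.1) @[w --> z] --> act (madj K) (A z.1).
    apply: (@cvg_comp _ _ _ fst (fun t => act (madj K) (A t)) (nbhs z) (nbhs z.1)); first exact: cvg_fst.
    by apply: actc => //; exact: mdet1_adj.
  by rewrite /F /nsq; lims.
have [|||[s t] /= [e1 e2]] := @poincare_miranda R F n%:R _ Fc.
- by rewrite ltr0n.
- move=> t _; rewrite /F /=; have [-> ->] := nsq_equivariant n A0 AL.
  have /andP[h1 h2] := b1 _ (B0 t) (cB t).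
  rewrite expRN; split; rewrite ?subr_lt0 ?subr_gt0.
    apply: lt_trans h1; rewrite mulrC ltr_pdivrMr ?expR_gt0 // mulrC -ltr_pdivrMr //.
  by apply: lt_trans h2 _; rewrite -ltr_pdivrMr.
- move=> s _; rewrite /F /=; have [-> ->] := nsq_equivariant n B0 BL.
  have /andP[h1 h2] := b2 _ (A0 s) (cA s).
  rewrite expRN; split; rewrite ?subr_lt0 ?subr_gt0.
    apply: lt_trans h1; rewrite mulrC ltr_pdivrMr ?expR_gt0 // mulrC -ltr_pdivrMr //.
  by apply: lt_trans h2 _; rewrite -ltr_pdivrMr.
exists s, t.
have z0 := A0 s; have w0 := act_gt0 hK (B0 t).
apply: (@nsq_inj R (madj K)) => //; first exact: mdet1_adj.
  by apply/eqP; rewrite -subr_eq0 e1.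
by rewrite actK //; apply/eqP; rewrite eq_sym -subr_eq0 e2.
Qed.

End EquivariantCurvesCross.

(** * The universal covering *)

Section HyperbolicMaps.
Variables (R : realType) (g : nat) (X : hyperbolic_surface R g).
Implicit Types (z w v : R * R) (M N : mat R) (phi psi : chart R X) (f h : R * R -> X).

Lemma act_continuous M z : mdet M = 1 -> 0 < z.2 -> act M @ z --> act M z.
Proof.
move=> hM z0; have := mden_neq0 hM z0; rewrite /mden => q0.
by rewrite /act /mobius /=; lims.
Qed.

Lemma near_neq z (P : set (R * R)) : nbhs z P -> exists2 w, w != z /\ w.2 = z.2 & P w.
Proof.
move=> /near_boxP[e e0 he]; exists (z.1 + e / 2, z.2); last first.
  by apply: he => /=; rewrite ?subrr ?normr0 // ltr_norml; apply/andP; split; lra.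
split=> //; case: z {he} => x y /=; rewrite xpair_eqE negb_and; apply/orP; left.
by apply/eqP => h; lra.
Qed.

Lemma act_near_eq M N w : mdet M = 1 -> mdet N = 1 -> 0 < w.2 ->
  (\forall v \near w, act M v = act N v) -> forall v, act M v = act N v.
Proof.
move=> hM hN w0 h; have [u [uw u2] eu] := near_neq h.
have u0 : 0 < u.2 by rewrite u2.
have [->|->] := act_eq2 hM hN u0 w0 uw eu (nbhs_singleton h); first by [].
by move=> v; rewrite act_opp.
Qed.

(** In the chart [phi] the map [f] reads as the isometry [M]; so [f] is locally an inverse branch of
    a developing map. *)
Definition chart_germ phi M z f :=
  \forall w \near z, chart_dom phi (f w) /\ chart_map phi (f w) = act M w.

Definition hloc z f := 0 < z.2 /\
  exists phi M, [/\ atlas phi, mdet M = 1 & chart_germ phi M z f].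

Lemma atlas_inj phi x y : atlas phi -> chart_dom phi x -> chart_dom phi y ->
  chart_map phi x = chart_map phi y -> x = y.
Proof.
move=> aphi dx dy; have [_ hc _] := atlasP X.
by have [_ _ inj _ _] := hc _ aphi; apply: inj; rewrite inE.
Qed.

Lemma atlas_open phi : atlas phi -> open (chart_dom phi).
Proof. by move=> aphi; have [_ hc _] := atlasP X; have [] := hc _ aphi. Qed.

Lemma atlas_gt0 phi x : atlas phi -> chart_dom phi x -> 0 < (chart_map phi x).2.
Proof.
move=> aphi dx; have [_ hc _] := atlasP X; have [_ sub _ _ _] := hc _ aphi.
by apply: sub; exists x.
Qed.

Lemma atlas_near phi x (V : set X) : atlas phi -> chart_dom phi x -> nbhs x V ->
  \forall z \near chart_map phi x, exists y, [/\ chart_dom phi y, V y & chart_map phi y = z].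
Proof.
move=> aphi dx xV; have [_ hc _] := atlasP X.
have [od _ _ _ op] := hc _ aphi.
have oW : open (V° `&` chart_dom phi) by apply: openI => //; exact: open_interior.
have := op _ oW (@subIsetr _ _ _) => oi.
have : nbhs (chart_map phi x) (chart_map phi @` (V° `&` chart_dom phi)).
  by apply: open_nbhs_nbhs; split=> //; exists x.
by apply: filterS => z [y [Vy dy] <-]; exists y; split=> //; exact: interior_subset.
Qed.

Lemma chart_germ_continuous phi M z f : atlas phi -> mdet M = 1 -> 0 < z.2 ->
  chart_germ phi M z f -> f @ z --> f z.
Proof.
move=> aphi hM z0 hf V Vf; have [dz ez] := nbhs_singleton hf.
have := atlas_near aphi dz Vf; rewrite ez => /(act_continuous hM z0) h.
apply: filterS2 hf h => w [dw ew] [y [dy Vy ey]].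
by rewrite /= (atlas_inj aphi dw dy) // ew ey.
Qed.

Lemma hloc_continuous z f : hloc z f -> f @ z --> f z.
Proof. by move=> [z0 [phi [M [aphi hM hf]]]]; exact: (chart_germ_continuous aphi hM z0 hf). Qed.

Lemma near_gt0 z : 0 < z.2 -> \forall w \near z, 0 < w.2.
Proof. exact: near_snd_gt. Qed.

Lemma near_chart_germ phi M z f : chart_germ phi M z f -> \forall w \near z, chart_germ phi M w f.
Proof. exact: nbhs_interior. Qed.

(** Since changes of charts are isometries, every chart at [f z] may serve. *)
Lemma hloc_chart psi z f : hloc z f -> atlas psi -> chart_dom psi (f z) ->
  exists2 M, mdet M = 1 & chart_germ psi M z f.
Proof.
move=> hf apsi dz; have fc := hloc_continuous hf; have [z0 [phi [M [aphi hM hg]]]] := hf.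
have [_ _ comp] := atlasP X; have [dz' _] := nbhs_singleton hg.
have [a [b [c [d [det]]]]] := comp _ _ aphi apsi _ dz' dz.
move=> /fc h; pose N := Mat a b c d.
have hN : mdet N = 1 by [].
exists (mmul N M); first exact: mdet1_mul.
have dn : \forall w \near z, chart_dom psi (f w).
  by apply: fc; apply: open_nbhs_nbhs; split=> //; exact: atlas_open.
apply: filterS2 (filterI hg (near_gt0 z0)) (filterI h dn) => w [[_ ew] w0] [ew' dw].
by split=> //; rewrite /= in ew'; rewrite ew' ew act_mul.
Qed.

Lemma hloc_germ : germ_property hloc.
Proof.
move=> z f h [z0 [phi [M [aphi hM hf]]]] fh; split=> //; exists phi, M; split=> //.
by apply: filterS2 hf fh => w [? ?] <-.
Qed.

Lemma chart_germ_eq phi M z f h : atlas phi -> chart_germ phi M z f -> chart_germ phi M z h ->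
  \forall w \near z, f w = h w.
Proof.
move=> aphi hf hh; apply: filterS2 hf hh => w [d1 e1] [d2 e2].
by apply: (atlas_inj aphi) => //; rewrite e1 e2.
Qed.

Lemma near_neq_continuous (T U : topologicalType) (x : T) (f h : T -> U) :
  hausdorff_space U -> f @ x --> f x -> h @ x --> h x -> f x <> h x -> \forall y \near x, f y <> h y.
Proof.
move=> hU fc hc fh; apply: contrapT => nn; apply: fh; apply: hU.
move=> A B fA hB.
have {}fA : \forall y \near x, A (f y) by exact: fc.
have {}hB : \forall y \near x, B (h y) by exact: hc.
apply: contrapT => AB; apply: nn; apply: filterS2 fA hB => y Ay By e.
by apply: AB; exists (f y); split=> //; rewrite e.
Qed.

Lemma hloc_agree z f h : hloc z f -> hloc z h -> f z = h z ->
  exists phi M N, [/\ atlas phi, mdet M = 1 /\ mdet N = 1, chart_germ phi M z f & chart_germ phi N z h].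
Proof.
move=> hf hh e; have [cov _ _] := atlasP X; have [phi aphi dz] := cov (f z).
have [M hM gM] := hloc_chart hf aphi dz.
rewrite e in dz; have [N hN gN] := hloc_chart hh aphi dz.
by exists phi, M, N.
Qed.

(** Different values at [z] stay different nearby, the surface being Hausdorff. Equal values allow a
    common chart, and there two isometries that agree near one point agree everywhere. *)
Lemma hloc_rigid : germ_rigid hloc.
Proof.
move=> z f h hf hh; have z0 := hf.1.
have [e|ne] := pselect (f z = h z); last first.
  apply: filterS (near_neq_continuous (@surface_hausdorff R g X) (hloc_continuous hf) (hloc_continuous hh) ne) => w nw.
  by move=> /nbhs_singleton.
have [phi [M [N [aphi [hM hN] gM gN]]]] := hloc_agree hf hh e.
apply: filterS2 (filterI (near_chart_germ gM) (near_chart_germ gN)) (near_gt0 z0) => w [kM kN] w0 fh.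
have MN : \forall v \near w, act M v = act N v.
  by apply: filterS3 kM kN fh => v [_ <-] [_ <-] ->.
have {}MN := act_near_eq hM hN w0 MN.
apply: (chart_germ_eq aphi gM); apply: filterS gN => v; rewrite MN; exact.
Qed.

(** Completeness, in the form that continuation requires: compactness yields one radius such that
    every point has a chart containing the whole disc of that radius about it. *)
Lemma uniform_radius : exists2 rho : R, 0 < rho & forall x : X, exists phi,
  [/\ atlas phi, chart_dom phi x & forall w, 0 < w.2 -> qdist (chart_map phi x) w < rho ->
      exists2 y, chart_dom phi y & chart_map phi y = w].
Proof.
pose P (rho : R) (x : X) := exists phi,
  [/\ atlas phi, chart_dom phi x & forall w, 0 < w.2 -> qdist (chart_map phi x) w < rho ->
      exists2 y, chart_dom phi y & chart_map phi y = w].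
suff : \forall rho \near (0 : R)^'+, forall x, [set: X] x -> P rho x.
  move=> h; have h0 : \forall rho \near (0 : R)^'+, 0 < rho by exact: nbhs_right_gt.
  have [rho [h1 h2]] := filter_ex (filterI h0 h).
  by exists rho => // x; exact: h2.
have /compact_near_coveringP := @surface_compact R g X; apply => x _.
have [cov hc _] := atlasP X; have [phi aphi dx] := cov x.
have [od _ _ pc _] := hc _ aphi.
have {}pc : chart_map phi @ x --> chart_map phi x by apply: pc; rewrite inE.
set z := chart_map phi x in pc; have z0 : 0 < z.2 := atlas_gt0 aphi dx.
have [e e0 he] := (near_boxP _ _).1 (atlas_near aphi dx (filterT : nbhs x setT)).
rewrite -/z in he.
have e2 : 0 < e / 2 by lra.
have near_z : \forall u \near z, `|z.1 - u.1| < e / 2 /\ `|z.2 - u.2| < e / 2.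
  by apply/near_boxP; exists (e / 2).
pose m := z.2 + e; have m0 : 0 < m by rewrite addr_gt0.
(* The bound 1 forces [w.2 <= 3 * u.2], so [u.2 * w.2] is at most 3 m^2, and [qdist] below [r]
   leaves a Euclidean distance below e / 2. *)
pose r := Num.min 1 (e ^+ 2 / (12 * m ^+ 2)).
have r0 : 0 < r by rewrite lt_min ltr01 /= divr_gt0 ?exprn_gt0 // mulr_gt0 // exprn_gt0.
have near_x : \forall y \near x, chart_dom phi y /\ `|z.1 - (chart_map phi y).1| < e / 2 /\
   `|z.2 - (chart_map phi y).2| < e / 2.
  have nd : \forall y \near x, chart_dom phi y by apply: open_nbhs_nbhs; split.
  have nz : \forall y \near x, `|z.1 - (chart_map phi y).1| < e / 2 /\
    `|z.2 - (chart_map phi y).2| < e / 2 by exact: (pc _ near_z).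
  exact: filterI nd nz.
have near_rho : \forall rho \near (0 : R)^'+, rho < r by exact: nbhs_right_lt.
exists ([set y | chart_dom phi y /\ `|z.1 - (chart_map phi y).1| < e / 2 /\
   `|z.2 - (chart_map phi y).2| < e / 2], [set rho | rho < r]) => //=.
move=> [y rho] /= [[dy [y1 y2]] rr]; exists phi; split=> // w w0.
have u0 := atlas_gt0 aphi dy; move: (chart_map phi y) y1 y2 u0 => u y1 y2 u0.
rewrite /qdist ltr_pdivrMr ?mulr_gt0 // => hq.
have : r <= 1 /\ r * (12 * m ^+ 2) <= e ^+ 2.
  split; first by rewrite ge_min lexx.
  by rewrite -ler_pdivlMr ?mulr_gt0 ?exprn_gt0 // ge_min lexx orbT.
move=> [r1 rm]; have um : u.2 < m by move: y2; rewrite ltr_norml /m => /andP[a b]; lra.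
have uw0 := mulr_gt0 u0 w0.
have w3 : w.2 <= 3 * u.2.
  rewrite leNgt; apply/negP => h.
  have : (u.2 - w.2) ^+ 2 < u.2 * w.2 by have := sqr_ge0 (u.1 - w.1); nra.
  nra.
have uwm : u.2 * w.2 <= 3 * m ^+ 2 by nra.
have key : (u.1 - w.1) ^+ 2 + (u.2 - w.2) ^+ 2 < (e / 2) ^+ 2 by nra.
have [y' [dy' _ ey']] : exists y, [/\ chart_dom phi y, True & chart_map phi y = w]; last by exists y'.
have sl (a c : R) : 0 < c -> a ^+ 2 < c ^+ 2 -> `|a| < c.
  by move=> c0 h; rewrite -ltr_sqr ?nnegrE ?(ltW c0) // real_normK ?num_real.
have n1 : `|u.1 - w.1| < e / 2.
  apply: sl => //; by have := sqr_ge0 (u.2 - w.2); lra.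
have n2 : `|u.2 - w.2| < e / 2.
  apply: sl => //; by have := sqr_ge0 (u.1 - w.1); lra.
apply: he; rewrite [e]splitr.
  by apply: le_lt_trans (ler_distD u.1 _ _) _; rewrite ltrD.
by apply: le_lt_trans (ler_distD u.2 _ _) _; rewrite ltrD.
Qed.

End HyperbolicMaps.

(** * The covering map and its deck transformations *)

Section Covering.
Variables (R : realType) (g : nat) (X : hyperbolic_surface R g).
Implicit Types (z w v : R * R) (M N : mat R) (phi psi : chart R X) (f h p q : R * R -> X).

Definition chart_inv phi (x0 : X) z : X := xget x0 [set y | chart_dom phi y /\ chart_map phi y = z].

Lemma chart_invP phi x0 z : (exists2 y, chart_dom phi y & chart_map phi y = z) ->
  chart_dom phi (chart_inv phi x0 z) /\ chart_map phi (chart_inv phi x0 z) = z.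
Proof. by move=> [y dy ey]; rewrite /chart_inv; case: xgetP => // /(_ y); case. Qed.

(** The box is small compared with the height of [z], so a disc of the uniform radius about any of
    its points contains it, and a single chart serves the whole box. *)
Lemma hloc_extends z : 0 < z.2 -> extends_locally (@hloc R g X) z.
Proof.
move=> z0; have [rho rho0 hrho] := uniform_radius X.
pose r := Num.min rho 1; have r0 : 0 < r by rewrite lt_min rho0 ltr01.
have r1 : r <= 1 by rewrite ge_min lexx orbT.
have rr : r <= rho by rewrite ge_min lexx.
(* Any two points of the box then have [qdist] below 8 e^2 / (z.2 / 2)^2 = r^2 / 2, and r^2 is at
   most [rho] because [r] is at most 1. *)
pose e := z.2 * r / 8; have e0 : 0 < e by rewrite divr_gt0 ?mulr_gt0.
pose near_z w := `|z.1 - w.1| < e /\ `|z.2 - w.2| < e.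
have gt0 w : near_z w -> z.2 / 2 < w.2.
  by rewrite /near_z /e !ltr_norml => -[_ /andP[h1 h2]]; nra.
have close w w' : near_z w -> near_z w' -> qdist w w' < rho.
  move=> hw hw'; have := gt0 w hw; have := gt0 w' hw'.
  move: hw hw'; rewrite /near_z /qdist !ltr_norml => -[/andP[a1 a2] /andP[a3 a4]] [/andP[b1 b2] /andP[b3 b4]] k' k.
  rewrite ltr_pdivrMr; last by rewrite mulr_gt0; lra.
  have h1 : (w.1 - w'.1) ^+ 2 <= (2 * e) ^+ 2 by nra.
  have h2 : (w.2 - w'.2) ^+ 2 <= (2 * e) ^+ 2 by nra.
  have h3 : z.2 ^+ 2 / 4 < w.2 * w'.2 by nra.
  have h4 : (2 * e) ^+ 2 = z.2 ^+ 2 * r ^+ 2 / 16 by rewrite /e; field.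
  have z2 : 0 < z.2 ^+ 2 by rewrite exprn_gt0.
  have h5 : z.2 ^+ 2 * r ^+ 2 <= z.2 ^+ 2 * rho.
    by rewrite ler_wpM2l ?(ltW z2) //; nra.
  have h6 : rho * (z.2 ^+ 2 / 4) < rho * (w.2 * w'.2) by rewrite ltr_pM2l.
  nra.
exists e => // a b c d za ab bz zc cd dz z' f zB hf.
have box w : in_box a b c d w -> near_z w.
  by move=> /andP[/andP[h1 h2] /andP[h3 h4]]; split; rewrite ltr_norml; apply/andP; split; lra.
have nz' := box _ zB; have z'0 := hf.1.
have [phi [aphi dx hphi]] := hrho (f z').
have [M hM gM] := hloc_chart hf aphi dx.
have [_ eM] := nbhs_singleton gM.
pose h w := chart_inv phi (f z') (act M w).
have hP w : near_z w -> chart_dom phi (h w) /\ chart_map phi (h w) = act M w.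
  move=> nw; have w0 : 0 < w.2 by have := gt0 w nw; lra.
  apply: chart_invP; apply: hphi; first exact: act_gt0.
  by rewrite eM qdist_act //; exact: close.
have gh w : near_z w -> chart_germ phi M w h.
  move=> [h1 h2]; apply/near_boxP.
  exists (Num.min (e - `|z.1 - w.1|) (e - `|z.2 - w.2|)); first by rewrite lt_min !subr_gt0 h1.
  move=> u; rewrite !lt_min => /andP[u1 _] /andP[_ u2]; apply: hP.
  split; [apply: le_lt_trans (ler_distD w.1 _ _) _|apply: le_lt_trans (ler_distD w.2 _ _) _]; lra.
exists h; last exact: (chart_germ_eq aphi gM (gh _ nz')).
move=> w /box nw; split; first by have := gt0 w nw; lra.
by exists phi, M; split=> //; exact: gh.
Qed.

Lemma covering_exists (x0 : X) : exists2 p : R * R -> X, p (0, 1) = x0 &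
  forall z, 0 < z.2 -> hloc z p.
Proof.
pose A n : R := - n.+1%:R; pose B n : R := n.+1%:R.
pose C n : R := (n.+2%:R)^-1; pose D n : R := n.+2%:R.
have n0 n : 0 < n.+1%:R :> R by rewrite ltr0n.
have Cgt0 n : 0 < C n by rewrite invr_gt0.
have AB n : A n <= B n by rewrite /A /B; have := n0 n; lra.
have CD n : C n <= D n.
  by apply: (@le_trans _ _ 1); rewrite /C /D ?invf_le1 // ler1n.
have nested n : [/\ A n.+1 <= A n, B n <= B n.+1, C n.+1 <= C n & D n <= D n.+1].
  by rewrite /A /B /C /D lerN2 !ler_nat lef_pV2 ?posrE // ler_nat.
have ex z : 0 < z.2 -> exhausted A B C D z.
  move=> z0.
  have s0 : 0 <= `|z.1| + `|z.2| + (z.2)^-1 by rewrite !addr_ge0 // invr_ge0 ltW.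
  have := archi_boundP s0; set k := Num.bound _ => hk; exists k.
  have i0 : 0 < (z.2)^-1 by rewrite invr_gt0.
  have k0 := n0 k.+1; rewrite /A /B -ltr_norml /C /D.
  have k2 : k.+2%:R = k%:R + 2 :> R by rewrite -addn2 natrD.
  have k1 : k.+1%:R = k%:R + 1 :> R by rewrite -addn1 natrD.
  have p1 := normr_ge0 z.1; have p2 := ler_norm z.2; have p3 := normr_ge0 z.2.
  split; first by rewrite k1; lra.
  apply/andP; split; last by rewrite k2; lra.
  by rewrite -(invrK z.2) ltf_pV2 ?posrE // k2; lra.
pose o : R * R := (0, 1); have o1 : 0 < o.2 by [].
have o0 : in_box (A 0%N) (B 0%N) (C 0%N) (D 0%N) o.
  rewrite /in_box /A /B /C /D /=; apply/andP; split; apply/andP; split; lra.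
have [cov hc _] := atlasP X; have [phi aphi dx] := cov x0.
have u0 := atlas_gt0 aphi dx; set u := chart_map phi x0 in u0.
pose q := Num.sqrt u.2; have q0 : 0 < q by rewrite sqrtr_gt0.
have qq : q ^+ 2 = u.2 by rewrite sqr_sqrtr // ltW.
have qn : q != 0 by rewrite gt_eqF.
(* An isometry taking i, the point (0, 1), to the chart image of [x0]; it starts the continuation
   with the prescribed value. *)
pose M := Mat q (u.1 / q) 0 q^-1.
have hM : mdet M = 1 by rewrite /mdet /= mulr0 subr0 divff.
have eM : act M o = u.
  rewrite /act /mobius /= !mul0r !mulr0 !add0r !mul1r expr0n !addr0 (surjective_pairing u).
  by congr pair; [field|rewrite -qq; field].
have [f0 f0o hf0] : exists2 f0, f0 o = x0 & hloc o f0.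
  have xT : nbhs x0 [set: X] by exact: filterT.
  have nP := atlas_near aphi dx xT.
  have oE : chart_inv phi x0 (act M o) = x0.
    by have [|d e] := @chart_invP phi x0 (act M o); [exists x0|apply: (atlas_inj aphi d dx); rewrite e].
  exists (fun w => chart_inv phi x0 (act M w)) => //.
  split=> //; exists phi, M; split=> //.
  have nP' : \forall w \near o, exists y, [/\ chart_dom phi y, [set: X] y & chart_map phi y = act M w].
    by have := act_continuous hM o1; rewrite eM => /(_ _ nP).
  by apply: filterS nP' => w [y [d _ e]]; apply: chart_invP; exists y.
have [|p hp ep] := extends_exhaustion (@hloc_germ R g X) (@hloc_rigid R g X) AB CD nested _ o0 (ex o o1) hf0.
  by move=> n z /andP[_ /andP[h _]]; apply: hloc_extends; exact: lt_le_trans h.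
exists p; first by rewrite -f0o (nbhs_singleton ep).
by move=> z z0; apply: hp; exact: ex.
Qed.

(** Only a local condition; even covering and lifting are derived from it with the help of
    [uniform_radius]. *)
Definition covering (p : R * R -> X) := forall z, 0 < z.2 -> hloc z p.

Definition deck (p : R * R -> X) M := mdet M = 1 /\ forall z, 0 < z.2 -> p (act M z) = p z.

Lemma hloc_act M z f : mdet M = 1 -> 0 < z.2 -> hloc (act M z) f -> hloc z (f \o act M).
Proof.
move=> hM z0 [_ [phi [N [aphi hN gN]]]]; split=> //; exists phi, (mmul N M).
split=> //; first exact: mdet1_mul.
have nN : \forall w \near z, chart_dom phi (f (act M w)) /\ chart_map phi (f (act M w)) = act N (act M w).
  exact: (act_continuous hM z0 gN).
by apply: filterS2 nN (near_gt0 z0) => w [h1 h2] w0; rewrite /= act_mul.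
Qed.

Lemma covering_act p M : mdet M = 1 -> covering p -> covering (p \o act M).
Proof. by move=> hM hp z z0; apply: hloc_act => //; apply: hp; exact: act_gt0. Qed.

Lemma covering_agree p q z w : covering p -> covering q -> 0 < z.2 -> 0 < w.2 ->
  (\forall v \near z, p v = q v) -> p w = q w.
Proof.
move=> hp hq z0 w0 pq.
suff H : \forall v \near w, p v = q v by exact: nbhs_singleton H.
apply: (agree_along_segment (@hloc_rigid R g X) _ pq) => t /andP[t0 t1] v.
by have v0 : 0 < v.2 by [rewrite /v /=; nra]; split; [apply: hp|apply: hq].
Qed.

(** In a chart at the common point both maps are isometries. Their quotient carries one germ to the
    other, and rigidity spreads the identity over the plane. For [q = p] this is transitivity of the
    deck group on fibres. *)
Lemma covering_transitive p q z w : covering p -> covering q -> 0 < z.2 -> 0 < w.2 -> p z = q w ->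
  exists2 M, mdet M = 1 /\ (forall v, 0 < v.2 -> q (act M v) = p v) & act M z = w.
Proof.
move=> hp hq z0 w0 e; have [cov _ _] := atlasP X; have [phi aphi dz] := cov (p z).
have [M hM gM] := hloc_chart (hp z z0) aphi dz.
rewrite e in dz; have [N hN gN] := hloc_chart (hq w w0) aphi dz.
have [_ eM] := nbhs_singleton gM; have [_ eN] := nbhs_singleton gN.
pose T := mmul (madj N) M; have hN' := mdet1_adj hN; have hT : mdet T = 1 by exact: mdet1_mul.
have Tz : act T z = w by rewrite act_mul // -eM e eN actK.
exists T => //; split=> // v v0.
apply: (covering_agree (covering_act hT hq) hp z0 v0).
have nN : \forall u \near z, chart_dom phi (q (act T u)) /\ chart_map phi (q (act T u)) = act N (act T u).
  by have := act_continuous hT z0; rewrite Tz => /(_ _ gN).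
apply: filterS3 nN gM (near_gt0 z0) => u [d1 e1] [d2 e2] u0 /=.
apply: (atlas_inj aphi d1 d2); rewrite e1 e2 -act_mul // mmulA mmulmV // mul1m //.
Qed.

Lemma hloc_near_inj p z : hloc z p ->
  exists2 e, 0 < e & forall w v, ball z e w -> ball z e v -> p w = p v -> w = v.
Proof.
move=> [z0 [phi [M [aphi hM gM]]]].
have nb : \forall w \near z, (chart_dom phi (p w) /\ chart_map phi (p w) = act M w) /\ 0 < w.2.
  exact: filterI gM (near_gt0 z0).
have [e /= e0 he] := (nbhs_ballP _ _).1 nb.
exists e => // w v /he[[d1 e1] w0] /he[[d2 e2] v0] pe.
by rewrite -(actK hM w0) -(actK hM v0) -e1 -e2 pe.
Qed.

(** Near the common image [p] is injective, so the two transformations agree in a neighbourhood of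
    [z]. *)
Lemma deck_free p M N z : covering p -> deck p M -> deck p N -> 0 < z.2 -> act M z = act N z ->
  M = N \/ M = mopp N.
Proof.
move=> hp [hM pM] [hN pN] z0 e.
have [d d0 inj] := hloc_near_inj (hp _ (act_gt0 hM z0)).
have nM : \forall w \near z, ball (act M z) d (act M w).
  by have := act_continuous hM z0 => /(_ _ (nbhsx_ballx _ _ d0)).
have nN : \forall w \near z, ball (act M z) d (act N w).
  by rewrite e; have := act_continuous hN z0 => /(_ _ (nbhsx_ballx _ _ d0)).
have nE : \forall w \near z, act M w = act N w.
  apply: filterS3 nM nN (near_gt0 z0) => w bM bN w0.
  by apply: inj => //; rewrite pM // pN.
have [u [uz u2] eu] := near_neq nE.
have u0 : 0 < u.2 by rewrite u2.
exact: act_eq2 hM hN u0 z0 uz eu e.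
Qed.

Lemma deck_mul p M N : deck p M -> deck p N -> deck p (mmul M N).
Proof.
move=> [hM pM] [hN pN]; split; first exact: mdet1_mul.
by move=> z z0; rewrite act_mul // pM ?pN //; exact: act_gt0.
Qed.

Lemma deck_adj p M : deck p M -> deck p (madj M).
Proof.
move=> [hM pM]; have hM' := mdet1_adj hM; split=> // z z0.
by rewrite -pM ?actVK //; exact: act_gt0.
Qed.

End Covering.

(** * Lifting maps from the plane *)

Section Lifting.
Variables (R : realType) (g : nat) (X : hyperbolic_surface R g).
Implicit Types (z w v y : R * R) (M N : mat R) (phi psi : chart R X).
Variable p : R * R -> X.
Hypothesis hp : covering p.

Lemma act_comp_continuous (T : topologicalType) M (f : T -> R * R) t : mdet M = 1 ->
  f @ t --> f t -> 0 < (f t).2 -> act M (f s) @[s --> t] --> act M (f t).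
Proof. by move=> hM fc f0; apply: (cvg_comp _ _ fc); exact: act_continuous. Qed.

Lemma segment_gt0 (a b t : R) : 0 < a -> 0 < b -> 0 <= t <= 1 -> 0 < a + t * (b - a).
Proof. by move=> a0 b0 /andP[t0 t1]; nra. Qed.

(** The inequality [qdist c v < rho] without denominators. It describes a Euclidean disc, whose
    convexity permits continuation along straight segments. *)
Definition hdisc c (rho : R) v := (v.1 - c.1) ^+ 2 + (v.2 - c.2) ^+ 2 < rho * (v.2 * c.2).

Lemma hdiscE c rho v : 0 < c.2 -> 0 < v.2 -> hdisc c rho v <-> qdist c v < rho.
Proof. by move=> c0 v0; rewrite qdistC /qdist ltr_pdivrMr ?mulr_gt0. Qed.

Lemma hdisc_convex c rho v w t : hdisc c rho v -> hdisc c rho w -> 0 <= t <= 1 ->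
  hdisc c rho (v.1 + t * (w.1 - v.1), v.2 + t * (w.2 - v.2)).
Proof.
rewrite /hdisc /= => hv hw /andP[t0 t1].
case: v w hv hw => a b [a' b'] /= hv hw; case: c hv hw => c d /= hv hw.
have cvx (x y : R) : (x + t * (y - x)) ^+ 2 <= (1 - t) * x ^+ 2 + t * y ^+ 2.
  rewrite -subr_ge0 (_ : _ - _ = t * (1 - t) * (x - y) ^+ 2); last by ring.
  by rewrite mulr_ge0 ?sqr_ge0 // mulr_ge0 // subr_ge0.
have k1 := cvx (a - c) (a' - c); have k2 := cvx (b - d) (b' - d).
have e1 : (a + t * (a' - a) - c) = (a - c) + t * ((a' - c) - (a - c)) by ring.
have e2 : (b + t * (b' - b) - d) = (b - d) + t * ((b' - d) - (b - d)) by ring.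
rewrite e1 e2.
have [t00|t00] := eqVneq t 0; first by rewrite t00 !mul0r !addr0.
have tp : 0 < t by rewrite lt_def t00.
have k3 : t * ((a' - c) ^+ 2 + (b' - d) ^+ 2) < t * (rho * (b' * d)) by rewrite ltr_pM2l.
have k4 : (1 - t) * ((a - c) ^+ 2 + (b - d) ^+ 2) <= (1 - t) * (rho * (b * d)).
  by rewrite ler_wpM2l ?subr_ge0 // ltW.
have -> : rho * ((b + t * (b' - b)) * d) = (1 - t) * (rho * (b * d)) + t * (rho * (b' * d)) by ring.
lra.
Qed.

Lemma hdisc_open c rho v : hdisc c rho v -> \forall w \near v, hdisc c rho w.
Proof.
rewrite /hdisc -subr_lt0 => h.
have dc : (w.1 - c.1) ^+ 2 + (w.2 - c.2) ^+ 2 - rho * (w.2 * c.2) @[w --> v] -->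
  (v.1 - c.1) ^+ 2 + (v.2 - c.2) ^+ 2 - rho * (v.2 * c.2) by lims.
by apply: filterS (cvgr_lt _ dc _ h) => w; rewrite subr_lt0.
Qed.

(* A chart containing a hyperbolic disc is evenly covered over that disc. *)
Lemma covering_sheet phi x M y (rho : R) : atlas phi -> chart_dom phi x ->
  (forall w, 0 < w.2 -> qdist (chart_map phi x) w < rho ->
      exists2 y, chart_dom phi y & chart_map phi y = w) ->
  mdet M = 1 -> 0 < y.2 -> chart_germ phi M y p -> qdist (chart_map phi x) (act M y) < rho ->
  forall x', chart_dom phi x' -> qdist (chart_map phi x) (chart_map phi x') < rho ->
  p (act (madj M) (chart_map phi x')) = x'.
Proof.
move=> aphi dx hrho hM y0 gM yr x' dx' xr'.
pose c := act (madj M) (chart_map phi x).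
have hM' := mdet1_adj hM.
have u0 := atlas_gt0 aphi dx; have u0' := atlas_gt0 aphi dx'.
have c0 : 0 < c.2 := act_gt0 hM' u0.
have cE v : 0 < v.2 -> qdist c v = qdist (chart_map phi x) (act M v).
  by move=> v0; rewrite -(qdist_act hM c0 v0) actVK.
pose q v := chart_inv phi x' (act M v).
have qP v : 0 < v.2 -> hdisc c rho v -> chart_dom phi (q v) /\ chart_map phi (q v) = act M v.
  move=> v0 /(hdiscE _ c0 v0); rewrite cE // => hv.
  by apply: chart_invP; apply: hrho => //; exact: act_gt0.
have qg v : 0 < v.2 -> hdisc c rho v -> chart_germ phi M v q.
  by move=> v0 hv; apply: filterS2 (near_gt0 v0) (hdisc_open hv) => w w0; exact: qP.
pose v := act (madj M) (chart_map phi x').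
have v0 : 0 < v.2 := act_gt0 hM' u0'.
have hv : hdisc c rho v by apply/(hdiscE _ c0 v0); rewrite cE // actVK.
have hy : hdisc c rho y by apply/(hdiscE _ c0 y0); rewrite cE.
have pq : \forall w \near y, p w = q w by exact: (chart_germ_eq aphi gM (qg y y0 hy)).
have H : \forall w \near v, p w = q w.
  apply: (agree_along_segment (@hloc_rigid R g X) _ pq) => t t01 u.
  have u_0 : 0 < u.2 by exact: segment_gt0.
  split; first exact: hp.
  split=> //; exists phi, M; split=> //; apply: qg => //.
  exact: hdisc_convex.
rewrite -/v (nbhs_singleton H); have [d e] := qP v v0 hv.
by apply: (atlas_inj aphi d dx'); rewrite e /v actVK.
Qed.

Variable F : R * R -> X.
Hypothesis Fc : forall z, F @ z --> F z.

Definition lift_at z (f : R * R -> R * R) :=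
  \forall w \near z, [/\ 0 < (f w).2, p (f w) = F w & f @ w --> f w].

Lemma lift_at_germ : germ_property lift_at.
Proof.
move=> z f h hf fh; apply: filterS2 hf (nbhs_interior fh) => w [h1 h2 h3] fhw.
have e := nbhs_singleton fhw.
by split; [rewrite -e|rewrite -e|exact: near_eq_continuous fhw h3].
Qed.

Lemma lift_at_eq z f h : lift_at z f -> lift_at z h -> f z = h z -> \forall w \near z, f w = h w.
Proof.
move=> hf hh e; have [f0 pf fc] := nbhs_singleton hf; have [h0 ph hc] := nbhs_singleton hh.
have [d d0 inj] := hloc_near_inj (hp f0).
have nf : \forall w \near z, ball (f z) d (f w) by exact: (fc _ (nbhsx_ballx _ _ d0)).
have nh : \forall w \near z, ball (f z) d (h w).
  by move: hc; rewrite -e => hc; exact: (hc _ (nbhsx_ballx _ _ d0)).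
apply: filterS2 (filterI hf hh) (filterI nf nh) => w [[_ e1 _] [_ e2 _]] [b1 b2].
by apply: inj => //; rewrite e1 e2.
Qed.

Lemma lift_at_rigid : germ_rigid lift_at.
Proof.
move=> z f h hf hh; have [f0 pf fc] := nbhs_singleton hf; have [h0 ph hc] := nbhs_singleton hh.
have [e|ne] := pselect (f z = h z).
  by apply: filterE => w _; exact: lift_at_eq.
have hU : hausdorff_space (R * R)%type by exact: norm_hausdorff.
by apply: filterS (near_neq_continuous hU fc hc ne) => w nw /nbhs_singleton.
Qed.

(** The radius [e] depends on [z] alone, not on the starting point [z'] or on the point [y] above
    its image; this uniformity is what continuation over boxes asks for. *)
Lemma local_lift z : exists2 e, 0 < e & forall z' y, `|z.1 - z'.1| < e -> `|z.2 - z'.2| < e ->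
  0 < y.2 -> p y = F z' -> exists h, h z' = y /\ forall w, `|z.1 - w.1| < e -> `|z.2 - w.2| < e ->
    [/\ 0 < (h w).2, p (h w) = F w & h @ w --> h w].
Proof.
have [rho rho0 hrho] := uniform_radius X.
have [phi [aphi dx hphi]] := hrho (F z).
have [_ hc _] := atlasP X; have [od _ _ pc _] := hc _ aphi.
have {}pc x : chart_dom phi x -> chart_map phi @ x --> chart_map phi x.
  by move=> dx'; apply: pc; rewrite inE.
have u0 := atlas_gt0 aphi dx.
have nd : \forall w \near z, chart_dom phi (F w).
  have oF : nbhs (F z) (chart_dom phi) by apply: open_nbhs_nbhs; split.
  exact: (Fc oF).
have nr : \forall w \near z, hdisc (chart_map phi (F z)) rho (chart_map phi (F w)).
  have hd : hdisc (chart_map phi (F z)) rho (chart_map phi (F z)).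
    by apply/hdiscE => //; rewrite /qdist !subrr expr0n addr0 mul0r.
  have cc : chart_map phi (F w) @[w --> z] --> chart_map phi (F z).
    by apply: (cvg_comp _ _ (Fc (z := z))); exact: pc.
  exact: (cc _ (hdisc_open hd)).
have [e e0 he] := (near_boxP _ _).1 (filterI nd nr).
exists e => // z' y z'1 z'2 y0 py.
have [d' r'] := he z' z'1 z'2; rewrite -py in d'.
have [M hM gM] := hloc_chart (hp y0) aphi d'.
have hM' := mdet1_adj hM.
have [_ eM] := nbhs_singleton gM; rewrite py in eM d'.
exists (fun w => act (madj M) (chart_map phi (F w))); split; first by rewrite eM actK.
move=> w w1 w2; have [dw rw] := he w w1 w2; have w0 := atlas_gt0 aphi dw.
split; first exact: act_gt0.
  apply: (covering_sheet aphi dx hphi hM y0 gM) => //.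
    by rewrite -eM; apply/hdiscE => //; exact: atlas_gt0.
  by apply/hdiscE.
apply: act_comp_continuous => //.
by apply: (cvg_comp _ _ (Fc (z := w))); exact: pc.
Qed.

Lemma lift_extends z : extends_locally lift_at z.
Proof.
have [e e0 he] := local_lift z.
exists e => // a b c d za ab bz zc cd dz z' f zB hf.
have box w : in_box a b c d w -> `|z.1 - w.1| < e /\ `|z.2 - w.2| < e.
  by move=> /andP[/andP[h1 h2] /andP[h3 h4]]; split; rewrite ltr_norml; apply/andP; split; lra.
have [z'1 z'2] := box _ zB; have [f0 pf fc] := nbhs_singleton hf.
have [h [hz' hh]] := he z' (f z') z'1 z'2 f0 pf.
have Lh w : in_box a b c d w -> lift_at w h.
  move=> /box[w1 w2]; apply/near_boxP.
  exists (Num.min (e - `|z.1 - w.1|) (e - `|z.2 - w.2|)); first by rewrite lt_min !subr_gt0 w1.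
  move=> u; rewrite !lt_min => /andP[u1 _] /andP[_ u2]; apply: hh.
    by apply: le_lt_trans (ler_distD w.1 _ _) _; lra.
  by apply: le_lt_trans (ler_distD w.2 _ _) _; lra.
by exists h => //; apply: lift_at_eq => //; exact: Lh.
Qed.

Definition lift (f : R * R -> R * R) :=
  forall w, [/\ 0 < (f w).2, p (f w) = F w & f @ w --> f w].

Lemma lift_exists y : 0 < y.2 -> p y = F (0, 0) -> exists2 f, lift f & f (0, 0) = y.
Proof.
move=> y0 py; pose o : R * R := (0, 0).
pose A n : R := - n.+1%:R; pose B n : R := n.+1%:R.
have AB n : A n <= B n by rewrite /A /B; have := ler0n R n.+1; lra.
have nested n : [/\ A n.+1 <= A n, B n <= B n.+1, A n.+1 <= A n & B n <= B n.+1].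
  by rewrite /A /B lerN2 ler_nat.
have o0 : in_box (A 0%N) (B 0%N) (A 0%N) (B 0%N) o.
  by rewrite /in_box /A /B /=; apply/andP; split; lra.
have ex z : exhausted A B A B z.
  have := archi_boundP (addr_ge0 (normr_ge0 z.1) (normr_ge0 z.2)).
  set k := Num.bound _ => hk; exists k; rewrite /A /B -!ltr_norml -natr1.
  by have := normr_ge0 z.1; have := normr_ge0 z.2; move=> h1 h2; split; lra.
have [e e0 he] := local_lift o.
have oo : `|o.1 - o.1| < e by rewrite subrr normr0.
have [f0 [f0o hf0]] := he o y oo oo y0 py.
have Lf0 : lift_at o f0 by apply/near_boxP; exists e => // w w1 w2; exact: hf0.
have [f hf ef] := extends_exhaustion lift_at_germ lift_at_rigid AB AB nested
  (fun n z _ => lift_extends z) o0 (ex o) Lf0.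
exists f; last by rewrite -(nbhs_singleton ef).
by move=> w; exact: nbhs_singleton (hf w (ex w)).
Qed.

Lemma lift_unique f h z w : lift f -> lift h -> f z = h z -> f w = h w.
Proof.
move=> hf hh e.
have Lf v : lift_at v f by exact: filterE.
have Lh v : lift_at v h by exact: filterE.
have H : \forall v \near w, f v = h v.
  apply: (agree_along_segment lift_at_rigid _ (lift_at_eq (Lf z) (Lh z) e)) => t _ v.
  by split.
exact: nbhs_singleton H.
Qed.

End Lifting.

(** * Equivariant lifting of homotopies *)

Section HomotopyLifting.
Variables (R : realType) (g : nat) (X : hyperbolic_surface R g).
Implicit Types (z w v y : R * R) (M N : mat R) (alpha beta gamma : R -> X) (a b : R -> R * R).
Variable p : R * R -> X.
Hypothesis hp : covering p.

Definition path_lift gamma a :=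
  forall t, [/\ 0 < (a t).2, p (a t) = gamma t & a @ t --> a t].

Let snd_continuous (U : topologicalType) (k : R -> U) : (forall t, k @ t --> k t) ->
  forall z, (k \o snd) @ z --> (k \o snd) z.
Proof.
move=> kc z; apply: (@cvg_comp _ _ _ snd k (nbhs z) (nbhs z.2)); first exact: cvg_snd.
exact: kc.
Qed.

Lemma path_lift_exists gamma y : (forall t, gamma @ t --> gamma t) -> 0 < y.2 ->
  p y = gamma 0 -> exists2 a, path_lift gamma a & a 0 = y.
Proof.
move=> gc y0 py.
have [f hf f0] := lift_exists hp (snd_continuous gc) y0 py.
exists (fun t => f (0, t)) => // t; have [h1 h2 h3] := hf (0, t); split=> //.
apply: (@cvg_comp _ _ _ (fun s => (0, s)) f _ (nbhs ((0 : R), t))); last exact: h3.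
by apply: lim_pair; [exact: lim_cst|exact: cvg_id].
Qed.

Lemma path_lift_unique gamma a b s t : path_lift gamma a ->
  path_lift gamma b -> a s = b s -> a t = b t.
Proof.
move=> ha hb e.
have L c : path_lift gamma c -> lift p (gamma \o snd) (c \o snd).
  by move=> hc z; have [h1 h2 h3] := hc z.2; split=> //; apply: snd_continuous => u; have [] := hc u.
exact: (@lift_unique _ _ _ _ hp _ _ _ (0, s) (0, t) (L _ ha) (L _ hb) e).
Qed.

Lemma path_lift_act gamma a M : deck p M -> path_lift gamma a -> path_lift gamma (fun t => act M (a t)).
Proof.
move=> [hM pM] ha t; have [h1 h2 h3] := ha t.
by split; [exact: act_gt0|rewrite pM|exact: act_comp_continuous].
Qed.

Definition clamp01 (u : R) : R := Num.max 0 (Num.min 1 u).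

Lemma clamp01_itv u : 0 <= clamp01 u <= 1.
Proof. by rewrite /clamp01 le_max lexx ge_max ler01 ge_min lexx. Qed.

Lemma clamp01_continuous u : clamp01 @ u --> clamp01 u.
Proof.
have c1 : {for u, continuous (fun v : R => Num.min 1 v)}.
  by apply: (@continuous_min R R (cst 1) id); [exact: cst_continuous|move=> ?].
by apply: (@continuous_max R R (cst 0) _ u); [exact: cst_continuous|exact: c1].
Qed.

(** Shifting the lifted homotopy by one period and applying [T] to it give two lifts of the same
    map. They agree at one point, hence everywhere, so the final curve inherits the translation
    [T]. *)
Lemma homotopy_lift alpha beta a T : closed_curve alpha -> homotopic alpha beta ->
  path_lift alpha a -> deck p T -> (forall t, a (t + 1) = act T (a t)) ->
  exists2 b, path_lift beta b & forall t, b (t + 1) = act T (b t).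
Proof.
move=> [ac _] [H [Hc Hper H0 H1]] ha hT aT.
(* [H] is continuous only on the strip; clamping the first parameter extends it continuously to the
   plane without changing the two ends. *)
pose F z := H (clamp01 z.1, z.2).
have Fc z : F @ z --> F z.
  have cz : (clamp01 w.1, w.2) @[w --> z] --> (clamp01 z.1, z.2).
    apply: lim_pair; last exact: cvg_snd.
    by apply: (@cvg_comp _ _ _ fst clamp01 (nbhs z) (nbhs z.1)); [exact: cvg_fst|exact: clamp01_continuous].
  move=> V FV; have/subspace_continuousP := Hc.
  move=> /(_ (clamp01 z.1, z.2) (clamp01_itv _) V FV) nV.
  have {}nV : \forall w \near (clamp01 z.1, z.2), 0 <= w.1 <= 1 -> V (H w) by exact: nV.
  have nz : \forall w \near z, 0 <= clamp01 w.1 <= 1 -> V (F w) by exact: (cz _ nV).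
  by apply: filterS nz => w; apply; exact: clamp01_itv.
have F0 t : F (0, t) = alpha t.
  by rewrite /F /= /clamp01 minEle ler10 maxxx H0.
have F1 t : F (1, t) = beta t by rewrite /F /= /clamp01 minxx maxEle ler01 H1.
have Fper u t : F (u, t + 1) = F (u, t) by rewrite /F /= Hper // clamp01_itv.
have [a0 pa _] := ha 0.
have py : p (a 0) = F (0, 0) by rewrite F0.
have [f hf f00] := lift_exists hp Fc a0 py.
have line c u : path_lift c (fun t => f (u, t)) <-> (forall t, c t = F (u, t)).
  split=> [h t|h t].
    by have [_ <- _] := h t; have [_ -> _] := hf (u, t).
  have [h1 h2 h3] := hf (u, t); split; rewrite ?h //.
  apply: (@cvg_comp _ _ _ (fun s => (u, s)) f _ (nbhs (u, t))); last exact: h3.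
  by apply: lim_pair; [exact: lim_cst|exact: cvg_id].
exists (fun t => f (1, t)).
  by apply/line => t; rewrite F1.
move=> t.
have fa s : f (0, s) = a s.
  apply: (@path_lift_unique alpha (fun s => f (0, s)) a 0 s) => //.
  by apply/line => u; rewrite F0.
have L1 : lift p F (fun w => f (w.1, w.2 + 1)).
  move=> w; have [h1 h2 h3] := hf (w.1, w.2 + 1).
  split=> //; first by rewrite h2 Fper -surjective_pairing.
  have c : (u.1, u.2 + 1) @[u --> w] --> (w.1, w.2 + 1).
    by apply: lim_pair; [exact: cvg_fst|apply: lim_add; [exact: cvg_snd|exact: lim_cst]].
  by apply: (cvg_comp _ _ c); exact: h3.
have L2 : lift p F (fun w => act T (f w)).
  move=> w; have [h1 h2 h3] := hf w; have [hT1 hT2] := hT.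
  by split; [exact: act_gt0|rewrite hT2|exact: act_comp_continuous].
apply: (@lift_unique _ _ _ _ hp _ _ _ (0, 0) (1, t) L1 L2).
by rewrite /= add0r !fa -{1}[1]add0r aT.
Qed.

End HomotopyLifting.

(** * Geodesics and their lifts *)

Section HyperbolicLines.
Variable R : realType.
Implicit Types (z w : R * R) (M N : mat R) (s t d u : R).

Lemma arcosh_cosh d : arcosh ((expR d + expR (- d)) / 2) = `|d|.
Proof.
have key (x : R) : 0 <= x -> arcosh ((expR x + expR (- x)) / 2) = x.
  move=> x0; have e : expR x * expR (- x) = 1 by rewrite -expRD subrr expR0.
  have h : expR (- x) <= expR x by rewrite ler_expR; lra.
  rewrite /arcosh (_ : _ - 1 = ((expR x - expR (- x)) / 2) ^+ 2).
    rewrite sqrtr_sqr ger0_norm; last by lra.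
    by rewrite (_ : _ + _ = expR x) ?expRK //; field.
  transitivity (((expR x + expR (- x)) / 2) ^+ 2 - expR x * expR (- x)); first by rewrite e.
  by field.
have [d0|d0] := leP 0 d; first by rewrite key // ger0_norm.
by rewrite ltr0_norm // -[RHS]key ?opprK 1?addrC //; lra.
Qed.

Lemma arcosh_eq u d : 1 <= u -> arcosh u = d -> 2 * u = expR d + expR (- d).
Proof.
move=> u1; rewrite /arcosh; set r := Num.sqrt _ => h.
have r0 : 0 <= r by exact: sqrtr_ge0.
have r2 : r ^+ 2 = u ^+ 2 - 1 by rewrite sqr_sqrtr //; nra.
have ur : 0 < u + r by lra.
have e1 : expR d = u + r by rewrite -h lnK.
have e2 : expR (- d) = u - r.
  by rewrite expRN e1; apply: (mulfI (lt0r_neq0 ur)); rewrite divff ?lt0r_neq0 //; nra.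
by rewrite e1 e2; lra.
Qed.

(** The imaginary axis, parametrised by arc length. *)
Definition axis t : R * R := (0, expR t).

Lemma axis_gt0 t : 0 < (axis t).2.
Proof. exact: expR_gt0. Qed.

Lemma act_diagm_axis s t : act (diagm s) (axis t) = axis (s + t).
Proof. by rewrite act_diagm /axis /= mulr0 -expRD. Qed.

Lemma axis_inj s t : axis s = axis t -> s = t.
Proof. by move=> [/expR_inj]. Qed.

Lemma axis_continuous t : axis @ t --> axis t.
Proof. by apply: lim_pair; [exact: lim_cst|exact: continuous_expR]. Qed.

Lemma qdist_axis s t : qdist (axis s) (axis t) = expR (s - t) + expR (- (s - t)) - 2.
Proof.
rewrite /qdist /axis /= subrr expr0n add0r opprB !expRD !expRN.
have s0 := lt0r_neq0 (expR_gt0 s); have t0 := lt0r_neq0 (expR_gt0 t).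
by field; rewrite s0 t0.
Qed.

Lemma hdist_axis s t : hdist (axis s) (axis t) = `|s - t|.
Proof. by rewrite hdistE qdist_axis -arcosh_cosh; congr arcosh; field. Qed.

Lemma hdist_act M z w : mdet M = 1 -> 0 < z.2 -> 0 < w.2 ->
  hdist (act M z) (act M w) = hdist z w.
Proof. by move=> *; rewrite !hdistE qdist_act. Qed.

Lemma qdist_of_hdist z w s t : 0 < z.2 -> 0 < w.2 -> hdist z w = `|s - t| ->
  qdist z w = qdist (axis s) (axis t).
Proof.
move=> z0 w0; rewrite hdistE => /arcosh_eq h.
have {h} := h (_ : 1 <= _); have := qdist_ge0 z0 w0; rewrite qdist_axis => q0.
have -> : expR `|s - t| + expR (- `|s - t|) = expR (s - t) + expR (- (s - t)).
  by have [?|?] := leP 0 (s - t); [rewrite ger0_norm|rewrite ltr0_norm // opprK addrC].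
by move=> h; have := h ltac:(lra); lra.
Qed.

(** Distances to two points of a line determine a point up to reflection in that line; here they are
    the distances of a point on the line, which is its own reflection. *)
Lemma axis_of_qdist z s1 s2 t : 0 < z.2 -> s1 <> s2 ->
  qdist z (axis s1) = qdist (axis t) (axis s1) ->
  qdist z (axis s2) = qdist (axis t) (axis s2) -> z = axis t.
Proof.
case: z => x y /= y0 s12.
have E := expR_gt0 t; have S1 := expR_gt0 s1; have S2 := expR_gt0 s2.
have En := lt0r_neq0 E; have yn := lt0r_neq0 y0.
have key s : qdist (x, y) (axis s) = qdist (axis t) (axis s) ->
    (x ^+ 2 + y ^+ 2 + expR s ^+ 2) * expR t = y * (expR t ^+ 2 + expR s ^+ 2).
  have Sn := lt0r_neq0 (expR_gt0 s); rewrite /qdist /axis /= subr0 subrr expr0n add0r => /eqP.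
  rewrite eqr_div ?mulf_neq0 // => /eqP h; apply: (mulIf Sn).
  transitivity ((x ^+ 2 + (y - expR s) ^+ 2) * (expR t * expR s) + 2 * y * expR s * expR t * expR s).
    by ring.
  by rewrite h; ring.
move=> /key k1 /key k2; rewrite /axis.
have yE : y = expR t.
  have : (expR s1 ^+ 2 - expR s2 ^+ 2) * (y - expR t) = 0 by lra.
  move=> /eqP; rewrite mulf_eq0 !subr_eq0 => /orP[|/eqP //].
  rewrite eqrXn2 ?ltW // => /eqP/expR_inj e; by case: s12.
congr pair => //; apply/eqP; rewrite -sqrf_eq0; apply/eqP.
apply: (mulIf En); rewrite mul0r; rewrite yE in k1; lra.
Qed.

Lemma rotation_to_axis z : 0 < z.2 -> exists M,
  [/\ mdet M = 1, act M (0, 1) = (0, 1) & (act M z).1 = 0].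
Proof.
move=> z0; have [x0|x0] := eqVneq z.1 0.
  by exists (mone R); split; rewrite ?mdet_one ?act_one.
case: z z0 x0 => x y /= y0 x0.
pose m := (x ^+ 2 + y ^+ 2 - 1) / 2; pose n := Num.sqrt (m ^+ 2 + x ^+ 2).
have n2 : n ^+ 2 = m ^+ 2 + x ^+ 2 by rewrite sqr_sqrtr // addr_ge0 ?sqr_ge0.
have n0 : n != 0 by rewrite -sqrf_eq0 n2 paddr_eq0 ?sqr_ge0 // !sqrf_eq0 negb_and x0 orbT.
(* The numerator of the real part of the rotated point is 2 c s m + (c^2 - s^2) x. It vanishes when
   (c + i s)^2 is proportional to m - i x, hence the complex square root. *)
have [[c s] [e1 e2]] := csq_surj (m / n, - x / n).
have cs : c ^+ 2 + s ^+ 2 = 1.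
  apply/eqP; rewrite -(@eqrXn2 _ 2%N) ?addr_ge0 ?sqr_ge0 // expr1n; apply/eqP.
  transitivity ((c ^+ 2 - s ^+ 2) ^+ 2 + (2 * c * s) ^+ 2); first by ring.
  rewrite e1 e2; transitivity ((m ^+ 2 + x ^+ 2) / n ^+ 2); first by field.
  by rewrite -n2 divff // expf_neq0.
exists (Mat c (- s) s c); split.
- by rewrite /mdet /=; lra.
- rewrite /act /mobius /= !mulr0 !add0r !mulr1 expr1n mulr1 [c ^+ 2 + _]cs.
  by congr pair; rewrite ?divr1 //; ring.
rewrite /act /mobius /=.
suff -> : (c * x - s) * (s * x + c) + c * s * y ^+ 2 = 0 by rewrite mul0r.
transitivity (2 * c * s * m + (c ^+ 2 - s ^+ 2) * x); first by rewrite /m; field.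
by rewrite e1 e2; ring.
Qed.

Lemma move_to_point z : 0 < z.2 -> exists2 M, mdet M = 1 & act M (0, 1) = z.
Proof.
case: z => x y /= y0; pose q := Num.sqrt y; have q0 : 0 < q by rewrite sqrtr_gt0.
have qq : q ^+ 2 = y by rewrite sqr_sqrtr // ltW.
have qn : q != 0 by rewrite gt_eqF.
exists (Mat q (x / q) 0 q^-1); first by rewrite /mdet /= mulr0 subr0 divff.
rewrite /act /mobius /= !mul0r !mulr0 !add0r !mul1r expr0n !addr0.
by congr pair; [field|rewrite -qq; field].
Qed.

Lemma move_to_axis z w s t : 0 < z.2 -> 0 < w.2 -> s <> t ->
  qdist z w = qdist (axis s) (axis t) ->
  exists M, [/\ mdet M = 1, act M (axis s) = z & act M (axis t) = w].
Proof.
move=> z0 w0 st.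
have [N hN eN] := move_to_point z0; pose N1 := mmul N (diagm (- s)).
have h1 : mdet N1 = 1 by rewrite mdet1_mul // mdet_diagm.
have i0 : axis 0 = (0, 1) by rewrite /axis expR0.
have e1 : act N1 (axis s) = z.
  by rewrite act_mul ?mdet_diagm ?axis_gt0 // act_diagm_axis addNr i0.
clearbody N1.
pose v := act (diagm (- s)) (act (madj N1) w).
have h1' := mdet1_adj h1; have v10 := act_gt0 h1' w0.
have v0 : 0 < v.2 by apply: act_gt0 => //; rewrite mdet_diagm.
have [P [hP Pi Pv]] := rotation_to_axis v0.
have Pv0 := act_gt0 hP v0.
rewrite -e1 -{1}[w](actVK h1 w0) qdist_act ?axis_gt0 //.
rewrite -(@qdist_act _ (diagm (- s))) ?mdet_diagm ?axis_gt0 // -/v.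
rewrite act_diagm_axis addNr i0 -(@qdist_act _ P) // Pi => q.
have ey : act P v = axis (ln (act P v).2).
  by rewrite /axis lnK ?posrE //; rewrite [LHS]surjective_pairing Pv.
set y := ln _ in ey.
have qy : qdist (axis 0) (axis y) = qdist (axis 0) (axis (t - s)).
  by rewrite i0 -ey q -i0 !qdist_axis; congr (expR _ + expR _ - 2); ring.
have yd : `|y| = `|t - s|.
  move: qy; rewrite !qdist_axis !sub0r !opprK -(@arcosh_cosh y) -(@arcosh_cosh (t - s)) => qy.
  by congr arcosh; lra.
have [Q [hQ Qi Qv]] : exists Q, [/\ mdet Q = 1, act Q (axis 0) = axis 0 & act Q (axis (t - s)) = v].
  have vE u : axis y = act P v -> axis u = axis y -> act (madj P) (axis u) = v.
    by move=> e1' ->; rewrite e1' actK.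
  have iE : act (madj P) (axis 0) = axis 0 by rewrite i0 -{1}Pi actK.
  have hP' := mdet1_adj hP.
  have [ye|ye] : y = t - s \/ y = - (t - s).
    by move/eqP: yd; rewrite eqr_norm2 => /orP[] /eqP; [left|right].
    by exists (madj P); split=> //; apply: vE => //; rewrite ye.
  (* The rotation may have put the second point on the wrong side of i; the half-turn [J] about i
     reverses the axis and corrects this. *)
  pose J : mat R := Mat 0 (-1) 1 0; have hJ : mdet J = 1 by rewrite /mdet /=; lra.
  have Ja u : act J (axis u) = axis (- u).
    have un := lt0r_neq0 (expR_gt0 u).
    rewrite /act /mobius /axis /= !(mul0r, mul1r, mulr0, add0r, addr0, expr0n) expRN.
    by congr pair; field.
  exists (mmul (madj P) J); split; first exact: mdet1_mul.
    by rewrite act_mul ?axis_gt0 // Ja oppr0.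
  by rewrite act_mul ?axis_gt0 // Ja; apply: vE => //; rewrite ye.
have [hs hs'] := (mdet_diagm s, mdet_diagm (- s)).
exists (mmul N1 (mmul (diagm s) (mmul Q (diagm (- s))))).
have gs := axis_gt0; have hQd := mdet1_mul hQ hs'; have hsQd := mdet1_mul hs hQd.
have E u : act (mmul N1 (mmul (diagm s) (mmul Q (diagm (- s))))) (axis u) =
    act N1 (act (diagm s) (act Q (axis (u - s)))).
  by rewrite !act_mul ?gs // act_diagm_axis addrC.
split; first exact: mdet1_mul.
  by rewrite E subrr Qi act_diagm_axis addr0.
by rewrite E Qv /v -(@act_mul _ (diagm s)) // diagmD subrr diagm0 act_one actVK.
Qed.

End HyperbolicLines.

(** * Lifts of geodesics are lines *)

Section GeodesicLifts.
Variables (R : realType) (g : nat) (X : hyperbolic_surface R g).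
Implicit Types (z w : R * R) (M N : mat R) (phi : chart R X) (s t d u : R) (gamma : R -> X).
Variable p : R * R -> X.
Hypothesis hp : covering p.

Lemma near2P t0 (P : R -> R -> Prop) : (\forall s & t \near t0, P s t) <->
  exists2 e, 0 < e & forall s t, `|t0 - s| < e -> `|t0 - t| < e -> P s t.
Proof.
split.
  case=> -[A B] /= [/near_lineP[a a0 ha] /near_lineP[b b0 hb]] h.
  exists (Num.min a b); first by rewrite lt_min a0.
  move=> s t; rewrite !lt_min => /andP[s1 _] /andP[_ t2].
  by apply: (h (s, t)); split; [exact: ha|exact: hb].
move=> [e e0 he]; exists ([set s | `|t0 - s| < e], [set s | `|t0 - s| < e]).
  by split; apply/near_lineP; exists e.
by move=> [s t] [/= h1 h2]; exact: he.
Qed.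

Lemma line_agree M N s t : mdet M = 1 -> mdet N = 1 -> s <> t ->
  act M (axis s) = act N (axis s) -> act M (axis t) = act N (axis t) ->
  M = N \/ M = mopp N.
Proof.
move=> hM hN st; apply: act_eq2 => //; try exact: axis_gt0.
by apply/eqP => /axis_inj.
Qed.

(** Two points on either side of [t0] fix the line, and the distances to both of them place every
    nearby point on it. *)
Lemma local_geodesic_line (a : R -> R * R) t0 : (forall t, 0 < (a t).2) ->
  (\forall s & t \near t0, hdist (a s) (a t) = `|s - t|) ->
  exists2 N, mdet N = 1 & \forall t \near t0, a t = act N (axis t).
Proof.
move=> a0 /near2P[e e0 he].
pose s0 := t0 - e / 2; pose s1 := t0 + e / 2.
have n0 : `|t0 - s0| < e by rewrite /s0 ltr_norml; apply/andP; split; lra.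
have n1 : `|t0 - s1| < e by rewrite /s1 ltr_norml; apply/andP; split; lra.
have ne : s0 <> s1 by rewrite /s0 /s1; lra.
have q01 := qdist_of_hdist (a0 s0) (a0 s1) (he _ _ n0 n1).
have [N [hN eN0 eN1]] := move_to_axis (a0 s0) (a0 s1) ne q01.
have hN' := mdet1_adj hN.
exists N => //; apply/near_lineP; exists e => // t nt.
suff -> : axis t = act (madj N) (a t) by rewrite actVK.
apply/esym/(@axis_of_qdist _ _ s0 s1) => //; first exact: act_gt0.
  rewrite -(qdist_of_hdist (a0 t) (a0 s0) (he _ _ nt n0)) -[in RHS](qdist_act hN') // -eN0 actK //.
  exact: axis_gt0.
rewrite -(qdist_of_hdist (a0 t) (a0 s1) (he _ _ nt n1)) -[in RHS](qdist_act hN') // -eN1 actK //.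
exact: axis_gt0.
Qed.

(** The lift is locally a line with arc length parameter. Two such lines that share two parameters
    come from the same isometry up to sign, so the line found at 0 is the lift for all times. *)
Lemma geodesic_lift gamma : geodesic gamma -> (exists2 y, 0 < y.2 & p y = gamma 0) ->
  exists2 N, mdet N = 1 & forall t, p (act N (axis t)) = gamma t.
Proof.
move=> [gc gg] [y y0 py]; have [a ha a_0] := path_lift_exists hp gc y0 py.
have a0 t : 0 < (a t).2 by have [] := ha t.
have [cov _ _] := atlasP X.
have loc t0 : exists2 N, mdet N = 1 & \forall t \near t0, a t = act N (axis t).
  apply: local_geodesic_line => //.
  have [_ pa ac] := ha t0.
  have [phi aphi dphi] := cov (gamma t0).
  have [M hM gM] : exists2 M, mdet M = 1 & chart_germ phi M (a t0) p.
    by apply: hloc_chart => //; [exact: hp|rewrite pa].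
  have /near2P[e1 e10 h1] := gg phi t0 aphi dphi.
  have nM : \forall t \near t0, chart_dom phi (p (a t)) /\ chart_map phi (p (a t)) = act M (a t).
    exact: (ac _ gM).
  have /near_lineP[e2 e20 h2] := nM.
  apply/near2P; exists (Num.min e1 e2); first by rewrite lt_min e10.
  move=> s t; rewrite !lt_min => /andP[s1 s2] /andP[t1 t2].
  rewrite -(h1 s t s1 t1) -(hdist_act hM (a0 s) (a0 t)).
  have [_ <-] := h2 s s2; have [_ <-] := h2 t t2.
  by have [_ -> _] := ha s; have [_ -> _] := ha t.
have [N hN eN] := loc 0; exists N => // t.
suff {t} E t : a t = act N (axis t) by have [_ <- _] := ha t; rewrite E.
pose G u := \forall v \near u, a v = act N (axis v).
suff : G t by move=> /nbhs_singleton.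
have Gint x y' : x <= y' -> (G x <-> G y').
  move=> xy; apply: (@interval_induction R (fun x y => G x <-> G y) x y' xy).
    by move=> ? ? ? _ _ [h1 h2] [h3 h4]; split; [move=> /h1/h3|move=> /h4/h2].
  move=> u _; have [M hM eM] := loc u.
  have /near_lineP[e e0 he] := eM; exists e => //.
  have key (v w : R) : `|u - v| < e -> `|u - w| < e -> G v -> G w.
    move=> uv uw /near_lineP[d d0 hd].
    (* A second parameter close enough to [v] for both descriptions of the lift to hold; agreement
       at [v] and [x'] identifies the isometries up to sign. *)
    have [x' [xv xd xe]] : exists x', [/\ x' <> v, `|v - x'| < d & `|u - x'| < e].
      pose k := Num.min (d / 2) ((e - `|u - v|) / 2).
      have k0 : 0 < k by rewrite lt_min !divr_gt0 ?subr_gt0.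
      have kd : k < d by apply: (@le_lt_trans _ _ (d / 2)); [rewrite ge_min lexx|lra].
      have ke : k < e - `|u - v|.
        apply: (@le_lt_trans _ _ ((e - `|u - v|) / 2)); first by rewrite ge_min lexx orbT.
        by rewrite ltr_pdivrMr // mulr_natr mulr2n ltrDl subr_gt0.
      exists (v + k); split; first by lra.
        by rewrite opprD addrA subrr sub0r normrN gtr0_norm.
      apply: le_lt_trans (ler_distD v _ _) _.
      have vk : v - (v + k) = - k by ring.
      by rewrite vk normrN (gtr0_norm k0); lra.
    have vd : `|v - v| < d by rewrite subrr normr0.
    have MN : M = N \/ M = mopp N.
      apply: (line_agree hM hN xv); first by rewrite -hd // -he.
      by rewrite -hd // -he.
    have MNE z : act M z = act N z by case: MN => ->; rewrite ?act_opp.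
    apply/near_lineP; exists (e - `|u - w|); first by rewrite subr_gt0.
    move=> x1 wx; rewrite -MNE; apply: he.
    by apply: le_lt_trans (ler_distD w _ _) _; lra.
  move=> v w uv vw wu; have nv : `|u - v| < e by rewrite ltr_norml; apply/andP; split; lra.
  have nw : `|u - w| < e by rewrite ltr_norml; apply/andP; split; lra.
  by split; exact: key.
have [t0|/ltW t0] := leP 0 t; first by have [h _] := Gint _ _ t0; exact: h.
by have [_ h] := Gint _ _ t0; exact: h.
Qed.

Lemma line_continuous N t : mdet N = 1 -> act N (axis s) @[s --> t] --> act N (axis t).
Proof. by move=> hN; apply: act_comp_continuous => //; [exact: axis_continuous|exact: axis_gt0]. Qed.

Lemma line_path_lift N gamma : mdet N = 1 -> (forall t, p (act N (axis t)) = gamma t) ->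
  path_lift p gamma (fun t => act N (axis t)).
Proof.
by move=> hN e t; split=> //; [apply: act_gt0 => //; exact: axis_gt0|exact: line_continuous].
Qed.

Lemma line_chart N phi t0 : mdet N = 1 -> atlas phi -> chart_dom phi (p (act N (axis t0))) ->
  exists2 M, mdet M = 1 & \forall t \near t0, chart_dom phi (p (act N (axis t))) /\
    chart_map phi (p (act N (axis t))) = act (mmul M N) (axis t).
Proof.
move=> hN aphi d; have n0 := act_gt0 hN (axis_gt0 t0).
have [M hM gM] := hloc_chart (hp n0) aphi d; exists M => //.
have nM : \forall t \near t0, chart_dom phi (p (act N (axis t))) /\
    chart_map phi (p (act N (axis t))) = act M (act N (axis t)).
  by have := @line_continuous N t0 hN => /(_ _ gM).
by apply: filterS nM => t; rewrite act_mul // axis_gt0.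
Qed.

Lemma line_geodesic N : mdet N = 1 -> geodesic (fun t => p (act N (axis t))).
Proof.
move=> hN; have n0 t := act_gt0 hN (axis_gt0 t); split.
  move=> t; apply: (cvg_comp _ _ (@line_continuous N t hN)); exact: hloc_continuous (hp (n0 t)).
move=> phi t0 aphi d; have [M hM /near_lineP[e e0 he]] := line_chart hN aphi d.
apply/near2P; exists e => // s t ns nt.
have [_ ->] := he s ns; have [_ ->] := he t nt.
by rewrite hdist_act ?axis_gt0 ?hdist_axis // mdet1_mul.
Qed.

End GeodesicLifts.

(** * Counting intersections by double cosets *)

Lemma card_injective_le (T : Type) (J : finType) (A : set T) (f : J -> T) n :
  injective f -> (forall j, A (f j)) -> (A #= `I_n)%card -> (#|J| <= n)%N.
Proof.
move=> finj fA An; rewrite -card_le_II -(card_le_eqr An).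
have e1 : ((f \o @enum_val J predT) @` [set: 'I_#|J|] #= [set: 'I_#|J|])%card.
  apply: inj_card_eq => i j _ _ /finj; exact: enum_val_inj.
have e2 : (`I_#|J| #= [set: 'I_#|J|])%card by exact: card_II.
rewrite (card_le_eql e2) -(card_le_eql e1).
by apply: subset_card_le => _ [i _ <-] /=.
Qed.

Section CountingIntersections.
Variables (R : realType) (g : nat) (X : hyperbolic_surface R g).
Implicit Types (z w : R * R) (M N : mat R) (s t : R).
Variables (p : R * R -> X) (L : R).
Hypotheses (hp : covering p) (L0 : 0 < L) (hL : deck p (diagm L)).

Lemma deck_diagm_int (n : int) : deck p (diagm (L * n%:~R)).
Proof.
have pos (m : nat) : deck p (diagm (L * m%:R)).
  elim: m => [|m IH]; first by rewrite mulr0 diagm0; split=> [|z _]; rewrite ?mdet_one ?act_one.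
  by rewrite -natr1 mulrDr mulr1 -diagmD; exact: deck_mul.
by case: n => m; [exact: pos|rewrite NegzE mulrNz mulrN -madj_diagm; apply: deck_adj; exact: pos].
Qed.

Lemma path_lift_diagm_int gamma (a : R -> R * R) (n : int) t : path_lift p gamma a ->
  (forall t, a (t + 1) = act (diagm L) (a t)) ->
  a (t + n%:~R) = act (diagm (L * n%:~R)) (a t).
Proof.
move=> ha aL; have a0 u : 0 < (a u).2 by have [] := ha u.
have pos (m : nat) u : a (u + m%:R) = act (diagm (L * m%:R)) (a u).
  elim: m u => [|m IH] u; first by rewrite addr0 mulr0 diagm0 act_one.
  rewrite -natr1 addrA aL IH -act_mul ?mdet_diagm // diagmD.
  by congr (act (diagm _) _); ring.
case: n => m; first exact: pos.
rewrite NegzE mulrNz mulrN -pmulrn.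
have := pos m.+1 (t - m.+1%:R); rewrite subrK => ->.
by rewrite -act_mul ?mdet_diagm // diagmD addNr diagm0 act_one.
Qed.

(** The [h j] represent distinct double cosets of the group generated by [diagm L]. The equivariant
    lift of [alpha] crosses the translate by [h j] of that of [beta]. Two indices with the same pair
    of parameters modulo 1 would, the deck group acting freely, give equivalent matrices. *)
Lemma count_lower_bound (J : finType) (h : J -> mat R) (alpha beta : R -> X) n :
  (forall j, deck p (h j)) -> (forall j, 0 < m11 (h j) * m22 (h j) < 1) ->
  (forall j j' (a b : int), (forall z, 0 < z.2 ->
     act (mmul (diagm (L * a%:~R)) (mmul (h j) (diagm (L * b%:~R)))) z = act (h j') z) -> j = j') ->
  closed_curve alpha -> homotopic (fun t => p (axis (L * t))) alpha ->
  closed_curve beta -> homotopic (fun t => p (axis (L * t))) beta ->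
  (intersections alpha beta #= `I_n)%card -> (#|J| <= n)%N.
Proof.
move=> hh hcross hdist ac hal bc hbe hn.
pose c t := p (axis (L * t)).
have axc t : axis (L * s) @[s --> t] --> axis (L * t).
  have lt : L * s @[s --> t] --> L * t by apply: lim_mul; [exact: lim_cst|exact: cvg_id].
  by apply: (cvg_comp _ _ lt); exact: axis_continuous.
have lc : path_lift p c (fun t => axis (L * t)).
  by move=> t; split; [exact: axis_gt0|by []|exact: axc].
have cc : closed_curve c.
  split=> t; first by apply: (cvg_comp _ _ (axc t)); exact: hloc_continuous (hp (axis_gt0 _)).
  by rewrite /c mulrDr mulr1 addrC -act_diagm_axis hL.2 // axis_gt0.
have aL t : axis (L * (t + 1)) = act (diagm L) (axis (L * t)).
  by rewrite act_diagm_axis mulrDr mulr1 addrC.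
have [A hA AL] := homotopy_lift hp cc hal lc hL aL.
have [B hB BL] := homotopy_lift hp cc hbe lc hL aL.
have A0 t : 0 < (A t).2 by have [] := hA t.
have B0 t : 0 < (B t).2 by have [] := hB t.
have /choice[f hf] : forall j, exists st : R * R, A st.1 = act (h j) (B st.2).
  move=> j; have [hj _] := hh j.
  have [||s [t e]] := equivariant_curves_cross L0 hj (hcross j) _ _ A0 B0 AL BL.
  - by move=> t; have [] := hA t.
  - by move=> t; have [] := hB t.
  by exists (s, t).
pose fl (u : R) : int := Num.floor u.
(* Moving both parameters into [0, 1) multiplies [h j] by powers of [diagm L] on either side, which
   is why double cosets occur. *)
pose F j := ((f j).1 - (fl (f j).1)%:~R, (f j).2 - (fl (f j).2)%:~R).
have FE j : A (F j).1 = act (mmul (diagm (L * (- fl (f j).1)%:~R)) (mmul (h j) (diagm (L * (fl (f j).2)%:~R)))) (B (F j).2).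
  have [hj _] := hh j.
  rewrite /F /= -mulrNz (path_lift_diagm_int _ _ hA AL) hf.
  have -> : B (f j).2 = act (diagm (L * (fl (f j).2)%:~R)) (B ((f j).2 - (fl (f j).2)%:~R)).
    by rewrite -(path_lift_diagm_int _ _ hB BL) subrK.
  by rewrite !act_mul ?mdet1_mul ?mdet_diagm // act_gt0 // mdet_diagm.
have hd (a b : int) j : deck p (mmul (diagm (L * a%:~R)) (mmul (h j) (diagm (L * b%:~R)))).
  by apply: deck_mul; [exact: deck_diagm_int|apply: deck_mul => //; exact: deck_diagm_int].
apply: (@card_injective_le _ J (intersections alpha beta) F) => //; last first.
  move=> j; split; rewrite /F /= /fundamental_interval /=; try exact: frac_itv.
  have [_ <- _] := hA (F j).1; have [_ <- _] := hB (F j).2.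
  by rewrite FE (hd _ _ _).2.
move=> j j' e; have E1 := FE j; have E2 := FE j'; rewrite e in E1.
set a1 := (- fl (f j).1) in E1; set b1 := fl (f j).2 in E1.
set a2 := (- fl (f j').1) in E2; set b2 := fl (f j').2 in E2.
have := deck_free hp (hd a1 b1 j) (hd a2 b2 j') (B0 (F j').2) (etrans (esym E1) E2).
move=> E; apply: (hdist j j' (a1 - a2) (b1 - b2)) => z z0.
have [hj _] := hh j; have [hj' _] := hh j'.
have key : act (mmul (diagm (L * a1%:~R)) (mmul (h j) (diagm (L * b1%:~R)))) (act (diagm (L * (- b2)%:~R)) z) =
  act (mmul (diagm (L * a2%:~R)) (mmul (h j') (diagm (L * b2%:~R)))) (act (diagm (L * (- b2)%:~R)) z).
  by case: E => ->; rewrite ?act_opp.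
have dd := mdet_diagm; have da x y : 0 < y.2 -> 0 < (act (diagm x) y).2 by move=> ?; apply: act_gt0.
have hg y : 0 < y.2 -> 0 < (act (h j') y).2 by move=> ?; apply: act_gt0.
move/(congr1 (act (diagm (L * (- a2)%:~R)))): key.
rewrite -!act_mul ?mdet1_mul //; try exact: da.
rewrite (_ : mmul (mmul (diagm (L * (- a2)%:~R)) (mmul (diagm (L * a2%:~R)) (mmul (h j') (diagm (L * b2%:~R)))))
   (diagm (L * (- b2)%:~R)) = h j'); last first.
  rewrite !mmulA diagmD -!mmulA diagmD.
  by rewrite -!mulrDr -!intrD addNr subrr !mulr0 diagm0 mmul1 mul1m.
move=> <-; congr (act _ z); rewrite !mmulA diagmD -!mmulA diagmD.
by rewrite -!mulrDr -!intrD [- a2 + _]addrC.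
Qed.

End CountingIntersections.

(** * Axes of products of long translations *)

Section CrossingAsymptotics.
Variable R : realType.
Implicit Types (z w : R * R) (M N K : mat R) (s t L : R).

(** The fixed-point equation c x^2 + (d - a) x - b = 0, extended from the real line to the
    half-circle over its roots. *)
Definition on_axis M z := m21 M * nsq z + (m22 M - m11 M) * z.1 - m12 M = 0.

Lemma on_axis_line N L t : mdet N = 1 -> on_axis (mmul (mmul N (diagm L)) (madj N)) (act N (axis t)).
Proof.
move=> hN; have z0 := axis_gt0 (R := R) t; have q0 := mden_neq0 hN z0.
rewrite /on_axis nsq_act // /act /mobius /mden /axis /=; move: q0; rewrite /mden /=.
case: N hN => a b c d /= _.
set y := expR t; set l := expR (L / 2); set l1 := expR _ => q0; field.
by move: q0; rewrite mulr0 add0r.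
Qed.

Definition mscale (k : R) M := Mat (k * m11 M) (k * m12 M) (k * m21 M) (k * m22 M).

Lemma on_axis_mscale k M z : k != 0 -> on_axis (mscale k M) z -> on_axis M z.
Proof.
move=> k0; rewrite /on_axis /= => h; apply: (mulfI k0); rewrite mulr0 -[RHS]h; ring.
Qed.

(* [diagm X1 * K * diagm Y * K^-1 * diagm X2] divided by [exp ((X1 + X2 + Y) / 2)],
   as a polynomial in [exp (- X1)], [exp (- X2)], [exp (- Y)]. *)
Definition nmat K (e1 e2 f : R) :=
  Mat (m11 K * m22 K - m12 K * m21 K * f) (- (m11 K * m12 K) * (1 - f) * e2)
      (m21 K * m22 K * (1 - f) * e1) (e1 * e2 * (m11 K * m22 K * f - m12 K * m21 K)).

Lemma nmatE K X1 X2 Y :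
  mmul (mmul (diagm X1) (mmul (mmul K (diagm Y)) (madj K))) (diagm X2) =
  mscale (expR ((X1 + X2 + Y) / 2)) (nmat K (expR (- X1)) (expR (- X2)) (expR (- Y))).
Proof.
have E (x : R) : expR (- x) = (expR (x / 2)) ^-2.
  by rewrite -exprVn -expRN expr2 -expRD; congr expR; field.
have E' (x : R) : expR (- (x / 2)) = (expR (x / 2))^-1 by rewrite expRN.
rewrite !E (_ : (X1 + X2 + Y) / 2 = X1 / 2 + X2 / 2 + Y / 2); last by field.
rewrite !expRD /diagm !E'.
have x0 := lt0r_neq0 (expR_gt0 (X1 / 2)); have u0 := lt0r_neq0 (expR_gt0 (X2 / 2)).
have y0 := lt0r_neq0 (expR_gt0 (Y / 2)).
move: (expR (X1 / 2)) (expR (X2 / 2)) (expR (Y / 2)) x0 u0 y0 => x u y x0 u0 y0.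
by apply: matP => /=; field; rewrite ?x0 ?u0 ?y0.
Qed.

(* Twice the hyperbolic cosine of the distance to [i]. *)
Definition cosh2 z : R := (1 + nsq z) / z.2.

(** In the disc model [|z.1| <= zeta * (1 + nsq z)] is, up to a bounded factor, a Euclidean strip
    about a diameter. Two such neighbourhoods, of axes without common endpoints, meet only in a
    compact part of the plane once they are thin. *)
Lemma near_axis_bounded K : mdet K = 1 -> 0 < m11 K * m22 K < 1 ->
  exists zeta B, 0 < zeta /\ forall z, 0 < z.2 -> `|z.1| <= zeta * (1 + nsq z) ->
    `|(act (madj K) z).1| <= zeta * (1 + nsq (act (madj K) z)) -> cosh2 z <= B.
Proof.
case: K => a b c d; rewrite /mdet /= => h /andP[ad0 ad1].
have bc : b * c < 0 by lra.
pose u := c * d; pose v := a * b.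
have uv : u * v < 0.
  by rewrite (_ : _ * _ = (a * d) * (b * c)); [rewrite pmulr_rlt0|rewrite /u /v; ring].
have u0 : u != 0 by apply: contraTneq uv => ->; rewrite mul0r ltxx.
have v0 : v != 0 by apply: contraTneq uv => ->; rewrite mulr0 ltxx.
pose k := `|u|; pose m := `|v|.
have k0 : 0 < k by rewrite normr_gt0.
have m0 : 0 < m by rewrite normr_gt0.
pose S := a ^+ 2 + b ^+ 2 + c ^+ 2 + d ^+ 2.
have S0 : 0 <= S by rewrite !addr_ge0 ?sqr_ge0.
pose mu := m / (6 * k); have mu0 : 0 < mu by rewrite divr_gt0 // mulr_gt0.
pose H := 1 + 3 * m / k; have H0 : 0 < H by rewrite addr_gt0 // divr_gt0 // mulr_gt0.
(* The second axis meets x = 0 where u |z|^2 + v = 0. The first bound on [zeta] keeps |z|^2 within a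
   factor 3 of m / k, and the second keeps x^2 below [mu], so that y^2 is at least [mu]. *)
pose zeta := Num.min (Num.min k m / (2 * (2 * S + 1))) (Num.sqrt mu / H).
have SS : 0 < 2 * (2 * S + 1) by lra.
have z0 : 0 < zeta by rewrite lt_min !divr_gt0 ?lt_min ?k0 ?m0 ?sqrtr_gt0.
have z1 : zeta * (2 * S + 1) <= k / 2 /\ zeta * (2 * S + 1) <= m / 2.
  have : zeta * (2 * (2 * S + 1)) <= Num.min k m.
    by rewrite -ler_pdivlMr // ge_min lexx.
  by rewrite le_min => /andP[h1 h2]; lra.
have z2 : zeta ^+ 2 * H ^+ 2 <= mu.
  rewrite -exprMn -[leRHS]sqr_sqrtr ?(ltW mu0) // lerXn2r ?nnegrE ?sqrtr_ge0 //.
    by rewrite mulr_ge0 // ltW.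
  by rewrite -ler_pdivlMr // ge_min lexx orbT.
exists zeta, (H / Num.sqrt mu); split=> //.
move: zeta z0 z1 z2 => zeta z0 [z1 z1'] z2 z zz h1 h2.
set r2 := nsq z in h1.
have r20 : 0 < r2 by exact: nsq_gt0.
have hM : mdet (madj (Mat a b c d)) = 1 by rewrite mdet_adj /mdet.
have q0 := mden_gt0 hM zz.
have e1 : (act (madj (Mat a b c d)) z).1 * mden (madj (Mat a b c d)) z = - u * r2 + (a * d + b * c) * z.1 - v.
  rewrite /act /mobius /= -/(mden (madj (Mat a b c d)) z) mulfVK ?gt_eqF //.
  by rewrite /u /v /r2 /nsq; ring.
have e2 : nsq (act (madj (Mat a b c d)) z) * mden (madj (Mat a b c d)) z = d ^+ 2 * r2 - 2 * (b * d) * z.1 + b ^+ 2.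
  by rewrite nsq_act // mulfVK ?gt_eqF //= /r2 /nsq; ring.
have e3 : mden (madj (Mat a b c d)) z = c ^+ 2 * r2 - 2 * (a * c) * z.1 + a ^+ 2.
  by rewrite /mden /= /r2 /nsq; ring.
have x2 : z.1 ^+ 2 <= r2 by rewrite /r2 /nsq lerDl sqr_ge0.
have k1 : `|- u * r2 + (a * d + b * c) * z.1 - v| <= zeta * (2 * S * (1 + r2)).
  rewrite -e1 normrM (gtr0_norm q0).
  apply: (@le_trans _ _ (zeta * (1 + nsq (act (madj (Mat a b c d)) z)) * mden (madj (Mat a b c d)) z)).
    by rewrite ler_pM2r.
  rewrite -mulrA ler_wpM2l ?(ltW z0) // mulrDl mul1r e2 e3.
  have p1 : - (2 * (b * d) * z.1) <= b ^+ 2 + d ^+ 2 * z.1 ^+ 2 by have := sqr_ge0 (b + d * z.1); nra.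
  have p2 : - (2 * (a * c) * z.1) <= a ^+ 2 + c ^+ 2 * z.1 ^+ 2 by have := sqr_ge0 (a + c * z.1); nra.
  have p3 : d ^+ 2 * z.1 ^+ 2 <= d ^+ 2 * r2 by rewrite ler_wpM2l ?sqr_ge0.
  have p4 : c ^+ 2 * z.1 ^+ 2 <= c ^+ 2 * r2 by rewrite ler_wpM2l ?sqr_ge0.
  have p5 : 0 <= a ^+ 2 * r2 by rewrite mulr_ge0 ?sqr_ge0 // ltW.
  have p6 : 0 <= b ^+ 2 * r2 by rewrite mulr_ge0 ?sqr_ge0 // ltW.
  have p7 := sqr_ge0 c; have p8 := sqr_ge0 d.
  rewrite /S; nra.
have k2 : `|(a * d + b * c) * z.1| <= zeta * (1 + r2).
  apply: le_trans h1; rewrite normrM ler_piMl // ler_norml; apply/andP; split; lra.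
have k3 : `|u * r2 + v| <= zeta * (2 * S + 1) * (1 + r2).
  rewrite (_ : u * r2 + v = (a * d + b * c) * z.1 - (- u * r2 + (a * d + b * c) * z.1 - v)); last by ring.
  apply: le_trans (ler_normB _ _) _; lra.
have k4 : `|k * r2 - m| <= zeta * (2 * S + 1) * (1 + r2).
  suff <- : `|u * r2 + v| = `|k * r2 - m| by [].
  rewrite /k /m; have [us|us] := ltP 0 u.
    have vs : v < 0 by rewrite -(pmulr_rlt0 _ us).
    by rewrite (gtr0_norm us) (ltr0_norm vs) opprK.
  have us' : u < 0 by rewrite lt_neqAle u0.
  have vs : 0 < v by rewrite -(nmulr_rlt0 _ us').
  by rewrite (ltr0_norm us') (gtr0_norm vs) -normrN; congr `|_|; ring.
have k5 : zeta * (2 * S + 1) * (1 + r2) <= (k * r2 + m) / 2.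
  have : zeta * (2 * S + 1) * r2 <= k / 2 * r2 by rewrite ler_pM2r.
  lra.
have [k6 k7] : k * r2 <= 3 * m /\ m <= 3 * (k * r2).
  by move: k4; rewrite ler_norml => /andP[a1 a2]; split; lra.
have rH : 1 + r2 <= H.
  by rewrite /H lerD2l ler_pdivlMr // mulrC.
have rmu : 2 * mu <= r2.
  have -> : 2 * mu = m / (3 * k) by rewrite /mu; field; rewrite gt_eqF.
  by rewrite ler_pdivrMr ?mulr_gt0 //; lra.
have xmu : z.1 ^+ 2 <= mu.
  apply: le_trans z2; rewrite -exprMn -[_ ^+ 2]real_normK ?num_real // lerXn2r ?nnegrE //.
    by rewrite mulr_ge0 // ltW.
  by apply: le_trans h1 _; rewrite ler_pM2l.
have ymu : mu <= z.2 ^+ 2 by have : r2 = z.1 ^+ 2 + z.2 ^+ 2 by []; lra.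
have sy : Num.sqrt mu <= z.2.
  by rewrite -(ger0_norm (ltW zz)) -sqrtr_sqr ler_wsqrtr.
rewrite /cosh2 ler_pdivrMr //; apply: le_trans rH _.
by rewrite mulrAC ler_pdivlMr ?sqrtr_gt0 // ler_pM2l.
Qed.

End CrossingAsymptotics.

Section CrossingLimits.
Variable R : realType.
Implicit Types (z w : R * R) (M N K : mat R).

(** Closeness to diag(rho, 0) as far as the axis is concerned: it is then close to the imaginary
    axis. *)
Definition near_rank1 (rho eta : R) N :=
  [/\ `|m12 N| < eta, `|m21 N| < eta & rho / 2 < m11 N - m22 N].

Lemma lim_trace (T : Type) (F : set_system T) {FF : Filter F} (N Q : T -> mat R) K (n q : mat R) :
  m11 (N x) @[x --> F] --> m11 n -> m12 (N x) @[x --> F] --> m12 n ->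
  m21 (N x) @[x --> F] --> m21 n -> m22 (N x) @[x --> F] --> m22 n ->
  m11 (Q x) @[x --> F] --> m11 q -> m12 (Q x) @[x --> F] --> m12 q ->
  m21 (Q x) @[x --> F] --> m21 q -> m22 (Q x) @[x --> F] --> m22 q ->
  mtr (mmul (N x) (mmul (mmul K (Q x)) (madj K))) @[x --> F] -->
    mtr (mmul n (mmul (mmul K q) (madj K))).
Proof.
move=> n1 n2 n3 n4 q1 q2 q3 q4; rewrite /mtr /=.
repeat lim1; lazymatch goal with
  | |- context [fmap (fun x => m11 (N x))] => exact: n1
  | |- context [fmap (fun x => m12 (N x))] => exact: n2
  | |- context [fmap (fun x => m21 (N x))] => exact: n3
  | |- context [fmap (fun x => m22 (N x))] => exact: n4
  | |- context [fmap (fun x => m11 (Q x))] => exact: q1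
  | |- context [fmap (fun x => m12 (Q x))] => exact: q2
  | |- context [fmap (fun x => m21 (Q x))] => exact: q3
  | |- context [fmap (fun x => m22 (Q x))] => exact: q4
  | |- _ => exact: lim_cst end.
Qed.

(** Both matrices tend to diag(rho, 0) and the trace of the product to rho^2 times
    [m11 K' * m22 K'], strictly between 0 and rho^2. The terms [2 * eps] become the constants 2 of
    the trace criterion after rescaling. *)
Lemma nmat_limits (T : Type) (F : set_system T) {FF : Filter F} K K' (eta : R) (e1 e2 f1 f2 : T -> R) :
  mdet K' = 1 -> 0 < m11 K * m22 K < 1 -> 0 < m11 K' * m22 K' < 1 -> 0 < eta ->
  e1 x @[x --> F] --> (0 : R) -> e2 x @[x --> F] --> (0 : R) ->
  f1 x @[x --> F] --> (0 : R) -> f2 x @[x --> F] --> (0 : R) ->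
  \forall x \near F, let N := nmat K (e1 x) (e2 x) (f1 x * f2 x) in
    let Q := nmat (madj K) (f1 x) (f2 x) (e1 x * e2 x) in
    let G := mtr (mmul N (mmul (mmul K' Q) (madj K'))) in
    let eps := e1 x * e2 x * (f1 x * f2 x) in
    [/\ 2 * eps < G, G + 2 * eps < mtr N ^+ 2, m11 K * m22 K / 2 < mtr N,
        near_rank1 (m11 K * m22 K) eta N & near_rank1 (m11 K * m22 K) eta Q].
Proof.
move=> hK' /andP[ad0 ad1] /andP[ad0' ad1'] eta0 c1 c2 d1 d2.
have small (k : T -> R) : k x @[x --> F] --> (0 : R) -> \forall x \near F, `|k x| < eta.
  move=> kc; apply: filterS2 (cvgr_gt _ kc _ (_ : - eta < 0)) (cvgr_lt _ kc _ eta0) => [x h1 h2|].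
    by rewrite ltr_norml h1.
  by rewrite oppr_lt0.
have big (k : T -> R) (l v : R) : k x @[x --> F] --> l -> v < l -> \forall x \near F, v < k x.
  by move=> kc vl; exact: (cvgr_gt _ kc _ vl).
pose N x := nmat K (e1 x) (e2 x) (f1 x * f2 x).
pose Q x := nmat (madj K) (f1 x) (f2 x) (e1 x * e2 x).
pose eps x := e1 x * e2 x * (f1 x * f2 x).
have n11 : m11 (N x) @[x --> F] --> m11 K * m22 K - m12 K * m21 K * (0 * 0) by rewrite /N /=; lims.
have n12 : m12 (N x) @[x --> F] --> - (m11 K * m12 K) * (1 - 0 * 0) * 0 by rewrite /N /=; lims.
have n21 : m21 (N x) @[x --> F] --> m21 K * m22 K * (1 - 0 * 0) * 0 by rewrite /N /=; lims.
have n22 : m22 (N x) @[x --> F] --> 0 * 0 * (m11 K * m22 K * (0 * 0) - m12 K * m21 K) by rewrite /N /=; lims.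
have q11 : m11 (Q x) @[x --> F] --> m22 K * m11 K - - m12 K * - m21 K * (0 * 0) by rewrite /Q /=; lims.
have q12 : m12 (Q x) @[x --> F] --> - (m22 K * - m12 K) * (1 - 0 * 0) * 0 by rewrite /Q /=; lims.
have q21 : m21 (Q x) @[x --> F] --> - m21 K * m11 K * (1 - 0 * 0) * 0 by rewrite /Q /=; lims.
have q22 : m22 (Q x) @[x --> F] --> 0 * 0 * (m22 K * m11 K * (0 * 0) - - m12 K * - m21 K) by rewrite /Q /=; lims.
have ec : eps x @[x --> F] --> (0 : R) * 0 * (0 * 0) by rewrite /eps; lims.
rewrite !(mulr0, mul0r, subr0) in n11 n12 n21 n22 q11 q12 q21 q22 ec.
rewrite [m22 K * m11 K]mulrC in q11.
move: (m11 K * m22 K) ad0 ad1 n11 q11 => rho ad0 ad1 n11 q11.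
suff : \forall x \near F,
    [/\ 2 * eps x < mtr (mmul (N x) (mmul (mmul K' (Q x)) (madj K'))),
       mtr (mmul (N x) (mmul (mmul K' (Q x)) (madj K'))) + 2 * eps x < mtr (N x) ^+ 2,
       rho / 2 < mtr (N x), near_rank1 rho eta (N x) & near_rank1 rho eta (Q x)] by [].
clearbody N Q eps.
have tN : mtr (N x) @[x --> F] --> rho + 0.
  by apply: lim_add; [exact: n11|exact: n22].
have Gc : mtr (mmul (N x) (mmul (mmul K' (Q x)) (madj K'))) @[x --> F] -->
    mtr (mmul (Mat rho 0 0 0) (mmul (mmul K' (Mat rho 0 0 0)) (madj K'))).
  exact: lim_trace.
have GE : mtr (mmul (Mat rho 0 0 0) (mmul (mmul K' (Mat rho 0 0 0)) (madj K'))) =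
    rho ^+ 2 * (m11 K' * m22 K') by rewrite /mtr /=; ring.
rewrite GE in Gc; rewrite addr0 in tN.
have r2 : 0 < rho ^+ 2 by rewrite exprn_gt0.
have b1 : \forall x \near F, 0 < mtr (mmul (N x) (mmul (mmul K' (Q x)) (madj K'))) - 2 * eps x.
  have gc : mtr (mmul (N x) (mmul (mmul K' (Q x)) (madj K'))) - 2 * eps x @[x --> F] -->
    rho ^+ 2 * (m11 K' * m22 K') - 2 * 0.
    apply: lim_add; first exact: Gc.
    by apply: lim_opp; apply: lim_mul; [exact: lim_cst|exact: ec].
  by apply: (big _ _ _ gc); rewrite mulr0 subr0 mulr_gt0.
have b2 : \forall x \near F, 0 < mtr (N x) ^+ 2 - (mtr (mmul (N x) (mmul (mmul K' (Q x)) (madj K'))) + 2 * eps x).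
  have gc : mtr (N x) ^+ 2 - (mtr (mmul (N x) (mmul (mmul K' (Q x)) (madj K'))) + 2 * eps x) @[x --> F] -->
    rho ^+ 2 - (rho ^+ 2 * (m11 K' * m22 K') + 2 * 0).
    apply: lim_add; first by apply: lim_sqr; exact: tN.
    apply: lim_opp; apply: lim_add; first exact: Gc.
    by apply: lim_mul; [exact: lim_cst|exact: ec].
  by apply: (big _ _ _ gc); rewrite mulr0 addr0 subr_gt0 gtr_pMr.
have b3 : \forall x \near F, rho / 2 < mtr (N x) by apply: (big _ _ _ tN); lra.
have b4 : \forall x \near F, rho / 2 < m11 (N x) - m22 (N x).
  have gc : m11 (N x) - m22 (N x) @[x --> F] --> rho - 0.
    by apply: lim_add; [exact: n11|apply: lim_opp; exact: n22].
  by apply: (big _ _ _ gc); lra.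
have b5 : \forall x \near F, rho / 2 < m11 (Q x) - m22 (Q x).
  have gc : m11 (Q x) - m22 (Q x) @[x --> F] --> rho - 0.
    by apply: lim_add; [exact: q11|apply: lim_opp; exact: q22].
  by apply: (big _ _ _ gc); lra.
near=> x; split.
- by rewrite -subr_gt0; near: x; exact: b1.
- by rewrite -subr_gt0; near: x; exact: b2.
- by near: x; exact: b3.
- by split; near: x; [exact: small n12|exact: small n21|exact: b4].
- by split; near: x; [exact: small q12|exact: small q21|exact: b5].
Unshelve. all: by end_near.
Qed.

(** [M] and [Q] are conjugates of one long translation, seen from inside its first and its second
    arc. Far from the ends of the arcs both axes look like the imaginary axis, so the axis of [M]
    and the image under [K'] of that of [Q] cross near i as soon as [K'] makes the imaginary axis
    cross itself. *)
Lemma crossing_asymptotics K K' : mdet K = 1 -> mdet K' = 1 ->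
  0 < m11 K * m22 K < 1 -> 0 < m11 K' * m22 K' < 1 ->
  exists C0 B, forall X1 X2 Y1 Y2, C0 <= X1 -> C0 <= X2 -> C0 <= Y1 -> C0 <= Y2 ->
    let M := mmul (mmul (diagm X1) (mmul (mmul K (diagm (Y1 + Y2))) (madj K))) (diagm X2) in
    let Q := mmul (mmul (diagm Y1) (mmul (mmul (madj K) (diagm (X1 + X2))) K)) (diagm Y2) in
    let M' := mmul (mmul K' Q) (madj K') in
    [/\ 2 < mtr (mmul M M'), mtr (mmul M M') < mtr M ^+ 2 - 2,
        m11 K * m22 K / 2 * expR ((X1 + X2 + (Y1 + Y2)) / 2) < mtr M &
        forall z, 0 < z.2 -> on_axis M z -> on_axis Q (act (madj K') z) -> cosh2 z <= B].
Proof.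
move=> hK hK' ad ad'; have [zeta [B [z0 hB]]] := near_axis_bounded hK' ad'.
have /andP[ad0 ad1] := ad; set rho := m11 K * m22 K in ad0 ad1 *.
pose eta := zeta * rho / 2; have eta0 : 0 < eta by rewrite divr_gt0 // mulr_gt0.
pose T := ((R * R) * (R * R))%type.
pose o : T := ((0, 0), (0, 0)).
have c1 : w.1 @[w --> o] --> o.1 by exact: cvg_fst.
have c2 : w.2 @[w --> o] --> o.2 by exact: cvg_snd.
have c11 : w.1.1 @[w --> o] --> (0 : R) by exact: (lim_fst c1).
have c12 : w.1.2 @[w --> o] --> (0 : R) by exact: (lim_snd c1).
have c21 : w.2.1 @[w --> o] --> (0 : R) by exact: (lim_fst c2).
have c22 : w.2.2 @[w --> o] --> (0 : R) by exact: (lim_snd c2).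
have nb := @nmat_limits _ _ (nbhs_filter o) _ _ _ _ _ _ _ hK' ad ad' eta0 c11 c12 c21 c22.
have [d /= d0 hd] := (nbhs_ballP _ _).1 nb.
exists (ln (2 / d)), B => X1 X2 Y1 Y2 hX1 hX2 hY1 hY2.
set M := mmul (mmul (diagm X1) _) _; set Q := mmul (mmul (diagm Y1) _) _.
set M' := mmul (mmul K' _) _.
have dd : 0 < 2 / d by rewrite divr_gt0.
have small x : ln (2 / d) <= x -> `|0 - expR (- x)| < d.
  move=> hx; rewrite sub0r normrN gtr0_norm ?expR_gt0 // expRN.
  have h : 2 / d <= expR x by rewrite -[leLHS]lnK ?posrE // ler_expR.
  rewrite -[ltRHS]invrK ltf_pV2 ?posrE ?invr_gt0 ?expR_gt0 //.
  by apply: lt_le_trans h; rewrite ltr_pMl ?invr_gt0 // ltr1n.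
set e1 := expR (- X1); set e2 := expR (- X2); set f1 := expR (- Y1); set f2 := expR (- Y2).
have bl : ball o d ((e1, e2), (f1, f2)) by split; split; exact: small.
have := hd _ bl => /=; case; move: bl => _.
set E := expR ((X1 + X2 + (Y1 + Y2)) / 2); have E0 : 0 < E := expR_gt0 _.
have ME : M = mscale E (nmat K e1 e2 (f1 * f2)).
  by rewrite /M nmatE -expRD /E; congr (mscale _ (nmat _ _ _ (expR _))); ring.
have QE : Q = mscale E (nmat (madj K) f1 f2 (e1 * e2)).
  rewrite /Q -{2}[K]madjK nmatE -expRD /E; congr (mscale (expR _) (nmat _ _ _ (expR _))); ring.
set N := nmat K _ _ _ in ME *; set P := nmat (madj K) _ _ _ in QE *.
set G := mtr (mmul N _); set eps := e1 * e2 * _.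
have epsE : eps * E ^+ 2 = 1.
  by rewrite /eps /E expr2 -!expRD -[RHS]expR0; congr expR; field.
have E2 : 0 < E ^+ 2 by rewrite exprn_gt0.
have trM : mtr M = E * mtr N by rewrite ME /mtr /=; ring.
have trMM : mtr (mmul M M') = E ^+ 2 * G.
  by rewrite /M' ME QE /G /mtr /=; ring.
move=> g1 g2 g3 [n1 n2 n3] [q1 q2 q3]; split.
- have : 2 * eps * E ^+ 2 < G * E ^+ 2 by rewrite ltr_pM2r.
  by rewrite -mulrA epsE mulr1 trMM mulrC.
- have : (G + 2 * eps) * E ^+ 2 < mtr N ^+ 2 * E ^+ 2 by rewrite ltr_pM2r.
  by rewrite mulrDl -mulrA epsE mulr1 trMM trM exprMn; lra.
- by rewrite trM mulrC ltr_pM2l.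
have near_axis L w : near_rank1 rho eta L -> 0 < w.2 -> on_axis L w -> `|w.1| <= zeta * (1 + nsq w).
  move=> [h12 h21 h] w0; rewrite /on_axis => e.
  have nw := nsq_gt0 w0.
  have h2 : (m11 L - m22 L) * w.1 = m21 L * nsq w - m12 L by move: e; clear; lra.
  have rho2 : 0 < rho / 2 by exact: divr_gt0.
  have pos : 0 < m11 L - m22 L := lt_trans rho2 h.
  have : (m11 L - m22 L) * `|w.1| <= eta * (1 + nsq w).
    rewrite -[X in X * _](gtr0_norm pos) -normrM h2.
    apply: le_trans (ler_normB _ _) _; rewrite normrM (gtr0_norm nw).
    have -> : eta * (1 + nsq w) = eta * nsq w + eta by ring.
    rewrite lerD ?(ltW h12) //.
    by rewrite ler_pM2r // ltW.
  have : rho / 2 * `|w.1| <= (m11 L - m22 L) * `|w.1| by rewrite ler_wpM2r // ltW.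
  rewrite /eta => k1 k2; have k3 := le_trans k1 k2.
  by rewrite -(ler_pM2l rho2); move: k3; clear; lra.
move=> z zz; rewrite ME QE => /(on_axis_mscale (lt0r_neq0 E0)) zN /(on_axis_mscale (lt0r_neq0 E0)) zP.
apply: hB => //; first exact: near_axis zN.
by apply: near_axis zP => //; apply: act_gt0 => //; exact: mdet1_adj.
Qed.

End CrossingLimits.

(** * Distance estimates, diagonalisation and crossing of lines *)

Section HyperbolicEstimates.
Variable R : realType.
Implicit Types (z w : R * R) (M N K : mat R) (s t L : R).

Lemma cosh2_ge0 z : 0 < z.2 -> 0 <= cosh2 z.
Proof. by move=> z0; rewrite divr_ge0 ?(ltW z0) // addr_ge0 // ltW // nsq_gt0. Qed.

(** This is [cosh2] of the image of i, twice the hyperbolic cosine of the displacement of i. *)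
Definition mnorm2 M : R := m11 M ^+ 2 + m12 M ^+ 2 + m21 M ^+ 2 + m22 M ^+ 2.

Lemma mnorm2_ge0 M : 0 <= mnorm2 M.
Proof. by rewrite !addr_ge0 ?sqr_ge0. Qed.

Lemma cosh2_act M z : mdet M = 1 -> 0 < z.2 -> cosh2 (act M z) <= mnorm2 M * cosh2 z.
Proof.
move=> hM z0; have q0 := mden_gt0 hM z0; have n0 := nsq_gt0 z0.
have -> : cosh2 (act M z) =
    (mden M z + (m11 M * z.1 + m12 M) ^+ 2 + (m11 M * z.2) ^+ 2) / z.2.
  rewrite /cosh2 nsq_act // act2; have := lt0r_neq0 z0; have := lt0r_neq0 q0.
  by move=> h1 h2; field; rewrite h1 h2.
rewrite /cosh2 mulrA ler_pM2r ?invr_gt0 //.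
have cs (a b : R) : (a * z.1 + b) ^+ 2 + (a * z.2) ^+ 2 <= (a ^+ 2 + b ^+ 2) * (1 + nsq z).
  rewrite -subr_ge0 (_ : _ - _ = (a - b * z.1) ^+ 2 + b ^+ 2 * z.2 ^+ 2); last by rewrite /nsq; ring.
  by rewrite addr_ge0 ?sqr_ge0 // mulr_ge0 ?sqr_ge0.
have := cs (m11 M) (m12 M); have := cs (m21 M) (m22 M).
by rewrite /mnorm2 /mden; lra.
Qed.

Lemma expR_le_abs s : expR s <= expR `|s| /\ expR (- s) <= expR `|s|.
Proof. by rewrite !ler_expR ler_norm -normrN ler_norm. Qed.

Lemma cosh2_diagm s z : 0 < z.2 -> cosh2 (act (diagm s) z) <= expR `|s| * cosh2 z.
Proof.
move=> z0; have n0 := nsq_gt0 z0; have e0 := expR_gt0 s; have zn := lt0r_neq0 z0.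
rewrite /cosh2 nsq_diagm act_diagm /=.
have -> : (1 + expR s ^+ 2 * nsq z) / (expR s * z.2) = (expR (- s) + expR s * nsq z) / z.2.
  by rewrite expRN; have := lt0r_neq0 e0 => en; field; rewrite en zn.
rewrite mulrA ler_pM2r ?invr_gt0 //; have [h1 h2] := expR_le_abs s.
rewrite (_ : expR `|s| * (1 + nsq z) = expR `|s| + expR `|s| * nsq z); last by ring.
by rewrite lerD // ler_wpM2r // ltW.
Qed.

(** The triangle inequality through i in exponential form: the distance is at most |s| plus the
    distances of [z] and [w] from i. *)
Lemma qdist_diagm s z w : 0 < z.2 -> 0 < w.2 ->
  qdist (act (diagm s) z) w + 2 <= 2 * expR `|s| * (cosh2 z * cosh2 w).
Proof.
move=> z0 w0; have e0 := expR_gt0 s; have en := lt0r_neq0 e0.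
have zn := lt0r_neq0 z0; have wn := lt0r_neq0 w0.
have nz := nsq_gt0 z0; have nw := nsq_gt0 w0; have [h1 h2] := expR_le_abs s.
have -> : qdist (act (diagm s) z) w + 2 =
   (expR (- s) * (expR s * z.1 - w.1) ^+ 2 + expR s * z.2 ^+ 2 + expR (- s) * w.2 ^+ 2) / (z.2 * w.2).
  by rewrite /qdist act_diagm /= expRN; field; rewrite en zn wn.
have -> : cosh2 z * cosh2 w = (1 + nsq z) * (1 + nsq w) / (z.2 * w.2).
  by rewrite /cosh2; field; rewrite zn wn.
rewrite mulrA ler_pM2r ?invr_gt0 ?mulr_gt0 //.
have i0 := expR_gt0 (- s).
have k1 : expR (- s) * (expR s * z.1 - w.1) ^+ 2 <= 2 * (expR s * z.1 ^+ 2) + 2 * (expR (- s) * w.1 ^+ 2).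
  rewrite -subr_ge0 (_ : _ - _ = expR (- s) * (expR s * z.1 + w.1) ^+ 2).
    by rewrite mulr_ge0 ?sqr_ge0 // ltW.
  by rewrite expRN; field.
have k2 : expR s * nsq z <= expR `|s| * nsq z by rewrite ler_wpM2r // ltW.
have k3 : expR (- s) * nsq w <= expR `|s| * nsq w by rewrite ler_wpM2r // ltW.
have k4 : expR `|s| * (nsq z + nsq w) <= expR `|s| * ((1 + nsq z) * (1 + nsq w)).
  rewrite ler_wpM2l ?expR_ge0 //; have := mulr_gt0 nz nw; lra.
have k5 : 0 <= expR s * z.2 ^+ 2 by rewrite mulr_ge0 ?sqr_ge0 // ltW.
have k6 : 0 <= expR (- s) * w.2 ^+ 2 by rewrite mulr_ge0 ?sqr_ge0 // ltW.
have k7 : expR s * nsq z = expR s * z.1 ^+ 2 + expR s * z.2 ^+ 2 by rewrite /nsq mulrDr.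
have k8 : expR (- s) * nsq w = expR (- s) * w.1 ^+ 2 + expR (- s) * w.2 ^+ 2 by rewrite /nsq mulrDr.
lra.
Qed.

Lemma expR_sum_inj (x y : R) : 0 <= x -> 0 <= y ->
  expR x + expR (- x) <= expR y + expR (- y) -> x <= y.
Proof.
move=> x0 y0; apply: contraTT; rewrite -!ltNge => yx.
have ex : 1 < expR x by rewrite expR_gt1; lra.
have ey : 1 <= expR y by rewrite -[1]expR0 ler_expR.
have exy : expR y < expR x by rewrite ltr_expR.
rewrite -subr_gt0 !expRN.
have en := lt0r_neq0 (expR_gt0 x); have fn := lt0r_neq0 (expR_gt0 y).
rewrite (_ : _ - _ = (expR x - expR y) * (expR x * expR y - 1) / (expR x * expR y)).
  by rewrite divr_gt0 ?mulr_gt0 ?expR_gt0 // subr_gt0 //; nra.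
by field; rewrite en fn.
Qed.

Lemma diagonalize M : mdet M = 1 -> 2 < mtr M -> m21 M != 0 ->
  exists C L, [/\ mdet C = 1, 0 < L, mtr M = expR (L / 2) + expR (- (L / 2)) &
    M = mmul (mmul C (diagm L)) (madj C)].
Proof.
move=> hM tr2 c0; set tau := mtr M in tr2.
have d0 : 0 <= tau ^+ 2 - 4 by nra.
pose r := Num.sqrt (tau ^+ 2 - 4); have r0 : 0 <= r by exact: sqrtr_ge0.
have r2 : r ^+ 2 = tau ^+ 2 - 4 by rewrite sqr_sqrtr.
pose la := (tau + r) / 2.
have la1 : 1 < la by rewrite /la; lra.
have la0 : 0 < la by lra.
have lan := lt0r_neq0 la0.
have lai : la^-1 = (tau - r) / 2.
  by apply: (mulfI lan); rewrite divff // /la; nra.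
have rn : r != 0.
  by rewrite gt_eqF // sqrtr_gt0; nra.
(* The columns are the eigenvectors (v - d, c) for v = la and v = la^-1, the second one scaled to
   give determinant 1; here la - la^-1 = r. *)
pose C := Mat (la - m22 M) ((la^-1 - m22 M) / (m21 M * r)) (m21 M) (r^-1).
exists C, (2 * ln la).
have LE : expR (2 * ln la / 2) = la.
  by rewrite mulrAC divff // mul1r lnK.
have LE' : expR (- (2 * ln la / 2)) = la^-1 by rewrite expRN LE.
have hC : mdet C = 1.
  by rewrite /mdet /= lai /la; field; rewrite rn c0.
split=> //.
- by rewrite mulr_gt0 // ln_gt0.
- by rewrite LE LE' lai /la -/tau; field.
have q1 : la ^+ 2 = tau * la - 1 by rewrite /la; nra.
have q2 : la^-1 ^+ 2 = tau * la^-1 - 1 by rewrite lai; nra.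
have key (v : R) : v ^+ 2 = tau * v - 1 ->
    m11 M * (v - m22 M) + m12 M * m21 M = (v - m22 M) * v.
  move=> qv; transitivity ((m11 M * v - mdet M)); first by rewrite /mdet; ring.
  rewrite hM mulrBl -expr2 qv /tau /mtr; ring.
have E : mmul M C = mmul C (diagm (2 * ln la)).
  rewrite /diagm LE LE' /C; apply: matP => /=; rewrite ?mulr0 ?add0r ?addr0.
  - exact: key.
  - transitivity ((m11 M * (la^-1 - m22 M) + m12 M * m21 M) / (m21 M * r)).
      by field; rewrite rn c0 lan.
    by rewrite key //; ring.
  - by ring.
  - by field; rewrite rn c0 lan.
by rewrite -E mmulmK.
Qed.

(** The trace equals 2 + a d (tau^2 - 4), where a and d are the diagonal entries of [h] and tau is
    the trace of [diagm L]; so the two bounds amount to 0 < a d < 1. *)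
Lemma diag_conj_crossing h L : mdet h = 1 -> 0 < L ->
  2 < mtr (mmul (diagm L) (mmul (mmul h (diagm L)) (madj h))) ->
  mtr (mmul (diagm L) (mmul (mmul h (diagm L)) (madj h))) < (expR (L / 2) + expR (- (L / 2))) ^+ 2 - 2 ->
  0 < m11 h * m22 h < 1.
Proof.
move=> hh L0; set x := expR (L / 2); set y := expR (- (L / 2)).
have xy : x * y = 1 by rewrite /x /y -expRD subrr expR0.
have x1 : 1 < x by rewrite expR_gt1 divr_gt0.
have x0 : x != 0 by rewrite gt_eqF //; lra.
have yx : y = x^-1 by rewrite /y expRN.
have d0 : 0 < (x + y) ^+ 2 - 4.
  rewrite (_ : _ - 4 = (x - y) ^+ 2 + 4 * (x * y - 1)); last by ring.
  rewrite xy subrr mulr0 addr0 exprn_even_gt0 //= subr_eq0 gt_eqF //.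
  by rewrite /y /x ltr_expR; lra.
have -> : mtr (mmul (diagm L) (mmul (mmul h (diagm L)) (madj h))) =
   2 + m11 h * m22 h * ((x + y) ^+ 2 - 4).
  transitivity (m11 h * m22 h * (x ^+ 2 + y ^+ 2) - 2 * (m12 h * m21 h) * (x * y)).
    by rewrite /mtr /= -/x -/y; ring.
  rewrite xy mulr1 (_ : m12 h * m21 h = m11 h * m22 h - 1); last by rewrite -hh /mdet; ring.
  by rewrite (_ : x ^+ 2 + y ^+ 2 = (x + y) ^+ 2 - 2 * (x * y)); [rewrite xy; ring|ring].
move: (m11 h * m22 h) => ad; move: ((x + y) ^+ 2) d0 => D d0 h1 h2.
have : 0 < ad * (D - 4) by lra.
rewrite pmulr_lgt0 // => ->; rewrite /= -(ltr_pM2r d0); lra.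
Qed.

Lemma act_axis h t : mdet h = 1 -> let q := m22 h ^+ 2 + m21 h ^+ 2 * expR t ^+ 2 in
  q != 0 /\ act h (axis t) = ((m12 h * m22 h + m11 h * m21 h * expR t ^+ 2) / q, expR t / q).
Proof.
move=> hh q; have := mden_neq0 hh (axis_gt0 t); rewrite /mden /= mulr0 add0r exprMn => q0.
by split=> //; rewrite /act /mobius /= !mulr0 !add0r exprMn.
Qed.

Lemma line_crossing h : mdet h = 1 -> 0 < m11 h * m22 h < 1 ->
  exists s t, axis s = act h (axis t).
Proof.
move=> hh /andP[ad0 ad1]; have bc : m12 h * m21 h < 0 by move: hh; rewrite /mdet; lra.
(* The real part of [act h (axis t)] vanishes exactly when e^(2 t) takes this value. *)
pose u2 := - (m12 h * m22 h) / (m11 h * m21 h).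
have ac : m11 h * m21 h != 0.
  rewrite mulf_neq0 //; first by apply: contraTneq ad0 => ->; rewrite mul0r ltxx.
  by apply: contraTneq bc => ->; rewrite mulr0 ltxx.
have u20 : 0 < u2.
  rewrite -(pmulr_lgt0 _ (_ : 0 < (m11 h * m21 h) ^+ 2)); last by rewrite exprn_even_gt0.
  rewrite (_ : _ * _ = - (m12 h * m21 h) * (m11 h * m22 h)).
    by rewrite mulr_gt0 // oppr_gt0.
  rewrite /u2; field; move: ac; rewrite mulf_eq0 negb_or => /andP[-> ->] //.
pose u := Num.sqrt u2; have u0 : 0 < u by rewrite sqrtr_gt0.
have uu : u ^+ 2 = u2 by rewrite sqr_sqrtr // ltW.
have [q0 e] := act_axis (ln u) hh; have p0 := act_gt0 hh (axis_gt0 (ln u)).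
exists (ln (act h (axis (ln u))).2), (ln u); rewrite /axis lnK ?posrE //.
rewrite [RHS]surjective_pairing; congr pair; rewrite -/(axis _) e /= lnK ?posrE // uu /u2.
rewrite (_ : _ + _ = 0) ?mul0r //.
field; move: ac; rewrite mulf_eq0 negb_or => /andP[-> ->] //.
Qed.

Lemma line_crossing_unique h s t s' t' : mdet h = 1 -> 0 < m11 h * m22 h < 1 ->
  axis s = act h (axis t) -> axis s' = act h (axis t') -> s = s' /\ t = t'.
Proof.
move=> hh /andP[ad0 ad1]; have bc : m12 h * m21 h < 0 by move: hh; rewrite /mdet; lra.
have ac : m11 h * m21 h != 0.
  rewrite mulf_neq0 //; first by apply: contraTneq ad0 => ->; rewrite mul0r ltxx.
  by apply: contraTneq bc => ->; rewrite mulr0 ltxx.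
have key v v' : axis v = act h (axis v') -> m12 h * m22 h + m11 h * m21 h * expR v' ^+ 2 = 0.
  have [q0 ->] := act_axis v' hh => -[/esym/eqP + _].
  by rewrite mulf_eq0 invr_eq0 (negPf q0) orbF => /eqP.
move=> e e'; have k := key _ _ e; have k' := key _ _ e'.
have tt : t = t'.
  apply: expR_inj; apply/eqP; rewrite -(@eqrXn2 _ 2%N) ?expR_ge0 //; apply/eqP.
  by apply: (mulfI ac); lra.
by split=> //; apply: axis_inj; rewrite e e' tt.
Qed.

End HyperbolicEstimates.

Section GroupWords.
Variable R : realType.
Implicit Types (M N K : mat R) (x y : R).

Lemma diagmDA x y N : mmul (diagm x) (mmul (diagm y) N) = mmul (diagm (x + y)) N.
Proof. by rewrite mmulA diagmD. Qed.

Lemma diagmK x N : mmul (diagm (- x)) (mmul (diagm x) N) = N.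
Proof. by rewrite diagmDA addNr diagm0 mul1m. Qed.

Lemma diagmKV x N : mmul (diagm x) (mmul (diagm (- x)) N) = N.
Proof. by rewrite diagmDA subrr diagm0 mul1m. Qed.

End GroupWords.

(** * The axis of a product of two translations and its translates *)

Section CrossingFamily.
Variable R : realType.
Implicit Types (z w : R * R) (M N K C P : mat R) (s t x y L : R).

(* For [X = n l1], [Y = m l2], [x = i l1] and [y = j l2], [word_T] is
   [T1 ^ n * T2 ^ m], and [word_h] maps its axis to the translate that crosses it
   in turn [i] around [c1] and turn [j] around [c2], at the frame [K']. *)
Definition word_T K (X Y : R) := mmul (diagm X) (mmul K (mmul (diagm Y) (madj K))).
Definition word_h K K' (x y X : R) :=
  mmul (diagm x) (mmul K' (mmul (diagm (- y)) (mmul (madj K) (diagm (- X))))).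

Lemma mdet_word_T K X Y : mdet K = 1 -> mdet (word_T K X Y) = 1.
Proof. by move=> hK; rewrite !mdet_mul !mdet_diagm mdet_adj hK !mulr1. Qed.

Lemma mdet_word_h K K' x y X : mdet K = 1 -> mdet K' = 1 -> mdet (word_h K K' x y X) = 1.
Proof. by move=> hK hK'; rewrite !mdet_mul !mdet_diagm mdet_adj hK hK' !mulr1. Qed.

(** When the axes cross this is a convex combination of the traces of translations by X + Y and by X
    - Y. Hence the product is hyperbolic and its length is at most X + Y. *)
Lemma mtr_word_T K X Y : mdet K = 1 -> mtr (word_T K X Y) =
  m11 K * m22 K * (expR ((X + Y) / 2) + expR (- ((X + Y) / 2))) +
  (1 - m11 K * m22 K) * (expR ((X - Y) / 2) + expR (- ((X - Y) / 2))).
Proof.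
move=> hK; have -> : 1 - m11 K * m22 K = - (m12 K * m21 K) by rewrite -hK /mdet; ring.
have -> : expR ((X + Y) / 2) = expR (X / 2) * expR (Y / 2) by rewrite -expRD; congr expR; field.
have -> : expR (- ((X + Y) / 2)) = expR (- (X / 2)) * expR (- (Y / 2)) by rewrite -expRD; congr expR; field.
have -> : expR ((X - Y) / 2) = expR (X / 2) * expR (- (Y / 2)) by rewrite -expRD; congr expR; field.
have -> : expR (- ((X - Y) / 2)) = expR (- (X / 2)) * expR (Y / 2) by rewrite -expRD; congr expR; field.
by rewrite /mtr /=; ring.
Qed.

Lemma cosh_ge2 (u : R) : 2 <= expR u + expR (- u).
Proof.
have u0 := expR_gt0 u; rewrite expRN -subr_ge0.
rewrite (_ : _ - 2 = (expR u - 1) ^+ 2 / expR u); first by rewrite divr_ge0 ?sqr_ge0 // ltW.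
by field; rewrite gt_eqF.
Qed.

Lemma cosh_gt2 (u : R) : 0 < u -> 2 < expR u + expR (- u).
Proof.
move=> hu; have u0 := expR_gt0 u; rewrite expRN -subr_gt0.
have u1 : 1 < expR u by rewrite expR_gt1.
rewrite (_ : _ - 2 = (expR u - 1) ^+ 2 / expR u).
  by rewrite divr_gt0 ?exprn_gt0 // subr_gt0.
by field; rewrite gt_eqF.
Qed.

Lemma cosh_le (x y : R) : `|x| <= y -> expR x + expR (- x) <= expR y + expR (- y).
Proof.
move=> xy; have y0 : 0 <= y by apply: le_trans xy.
have -> : expR x + expR (- x) = expR `|x| + expR (- `|x|).
  by have [?|?] := leP 0 x; [rewrite ger0_norm|rewrite ltr0_norm // opprK addrC].
rewrite -subr_ge0; have a0 : 0 <= `|x| by [].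
have ea := expR_gt0 `|x|; have ey := expR_gt0 y.
rewrite !expRN (_ : _ - _ = (expR y - expR `|x|) * (expR y * expR `|x| - 1) / (expR y * expR `|x|)).
  rewrite divr_ge0 ?mulr_ge0 ?expR_ge0 ?subr_ge0 ?ler_expR //.
  by rewrite -expRD -[leLHS]expR0 ler_expR addr_ge0.
by field; rewrite !gt_eqF.
Qed.

Lemma word_T_diag K X Y : mdet K = 1 -> 0 < m11 K * m22 K < 1 -> 0 < X -> 0 < Y ->
  exists C L, [/\ mdet C = 1, 0 < L, mtr (word_T K X Y) = expR (L / 2) + expR (- (L / 2)),
    word_T K X Y = mmul (mmul C (diagm L)) (madj C) & L <= X + Y].
Proof.
move=> hK /andP[ad0 ad1] X0 Y0; have hT := mdet_word_T X Y hK.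
have c1 := cosh_gt2 (_ : 0 < (X + Y) / 2); have c2 := cosh_ge2 ((X - Y) / 2).
have tr2 : 2 < mtr (word_T K X Y).
  rewrite mtr_word_T //.
  have k1 : m11 K * m22 K * 2 < m11 K * m22 K * (expR ((X + Y) / 2) + expR (- ((X + Y) / 2))).
    by rewrite ltr_pM2l // c1 //; lra.
  have k2 : (1 - m11 K * m22 K) * 2 <= (1 - m11 K * m22 K) * (expR ((X - Y) / 2) + expR (- ((X - Y) / 2))).
    by rewrite ler_pM2l // subr_gt0.
  lra.
have bc : m12 K * m21 K < 0 by move: hK; rewrite /mdet; lra.
have c0 : m21 (word_T K X Y) != 0.
  rewrite /=; rewrite (_ : _ + _ = expR (- (X / 2)) * (m21 K * m22 K * (expR (Y / 2) - expR (- (Y / 2))))); last by ring.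
  have n1 : expR (Y / 2) - expR (- (Y / 2)) != 0 by rewrite subr_eq0 gt_eqF // ltr_expR; lra.
  have n2 : m21 K != 0 by apply: contraTneq bc => ->; rewrite mulr0 ltxx.
  have n3 : m22 K != 0 by apply: contraTneq ad0 => ->; rewrite mulr0 ltxx.
  exact: mulf_neq0 (lt0r_neq0 (expR_gt0 _)) (mulf_neq0 (mulf_neq0 n2 n3) n1).
have [C [L [hC L0 trL TE]]] := diagonalize hT tr2 c0.
exists C, L; split=> //.
have XY : `|(X - Y) / 2| <= (X + Y) / 2 by rewrite ler_norml; apply/andP; split; lra.
have h : L / 2 <= (X + Y) / 2.
  apply: expR_sum_inj; [lra|lra|].
  rewrite -trL mtr_word_T //; have k := cosh_le XY.
  have : (1 - m11 K * m22 K) * (expR ((X - Y) / 2) + expR (- ((X - Y) / 2))) <=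
    (1 - m11 K * m22 K) * (expR ((X + Y) / 2) + expR (- ((X + Y) / 2))) by rewrite ler_pM2l // subr_gt0.
  lra.
lra.
Qed.

(** [X2] and [Y2] are the positions of a crossing along the two arcs, [X1] and [Y1] what remains of
    them; [C] makes the axis imaginary. Besides the crossing it records that L is at least X + Y
    minus a constant, and that the crossing point lies, on both branches, at bounded distance from
    the expected place. *)
Definition word_bound K K' (C0 B : R) := forall X1 X2 Y1 Y2, C0 <= X1 -> C0 <= X2 -> C0 <= Y1 -> C0 <= Y2 ->
  forall C L, mdet C = 1 -> 0 < L -> mtr (word_T K (X1 + X2) (Y1 + Y2)) = expR (L / 2) + expR (- (L / 2)) ->
  word_T K (X1 + X2) (Y1 + Y2) = mmul (mmul C (diagm L)) (madj C) ->
  let h := mmul (madj C) (mmul (word_h K K' X2 Y2 (X1 + X2)) C) in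
  [/\ 0 < m11 h * m22 h < 1,
      (m11 K * m22 K) ^+ 2 / 16 * expR (X1 + X2 + (Y1 + Y2)) <= expR L &
      forall s t, axis s = act h (axis t) -> exists z, [/\ 0 < z.2,
        act C (axis s) = act (diagm X2) z, cosh2 z <= B &
        act C (axis t) = act (diagm (X1 + X2)) (act K (act (diagm Y2) (act (madj K') z)))]].

Lemma word_bound_exists K K' : mdet K = 1 -> mdet K' = 1 ->
  0 < m11 K * m22 K < 1 -> 0 < m11 K' * m22 K' < 1 -> exists C0 B : R, word_bound K K' C0 B.
Proof.
move=> hK hK' ad ad'; have [C0 [B hB]] := crossing_asymptotics hK hK' ad ad'.
exists C0, B => X1 X2 Y1 Y2 hX1 hX2 hY1 hY2 C L hC L0 trT TE.
have {hB} := hB _ _ _ _ hX1 hX2 hY1 hY2; cbv zeta.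
set X := X1 + X2; set Y := Y1 + Y2 in trT TE *; rewrite -/X in trT TE.
set M := mmul (mmul (diagm X1) _) _; set Q := mmul (mmul (diagm Y1) _) _.
set M' := mmul (mmul K' _) _; set h := mmul (madj C) _ => -[h1 h2 h3 h4].
pose P := mmul (diagm (- Y2)) (mmul (madj K) (diagm (- X))).
have hC' := mdet1_adj hC; have hKa := mdet1_adj hK; have hKa' := mdet1_adj hK'.
have dd := @mdet_diagm R.
have hP : mdet P = 1 by apply: mdet1_mul; [|apply: mdet1_mul].
have hh : mdet h = 1 by apply: mdet1_mul => //; apply: mdet1_mul => //; exact: mdet_word_h.
have hE : word_h K K' X2 Y2 X = mmul (diagm X2) (mmul K' P) by [].
(* [M] and [Q] are [word_T] conjugated by the changes of viewpoint [diagm (- X2)] and [P]. Since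
   [word_h] is [diagm X2] times [K' P], the trace of [M M'] is that of [diagm L] times its conjugate
   by [h]. *)
have ME : M = mmul (mmul (diagm (- X2)) (word_T K X Y)) (diagm X2).
  rewrite /M /word_T -!mmulA diagmDA; congr (mmul (diagm _) _).
  by rewrite /X; ring.
have QE : Q = mmul (mmul P (word_T K X Y)) (madj P).
  rewrite /Q /P /word_T !madjM !madj_diagm !opprK madjK -!mmulA diagmK mmulKm // diagmDA.
  by congr (mmul (diagm _) _); rewrite /Y; ring.
have trMM : mtr (mmul M M') = mtr (mmul (diagm L) (mmul (mmul h (diagm L)) (madj h))).
  have e1 : mmul M M' = mmul (mmul (diagm (- X2)) (mmul (mmul C (mmul (diagm L)
     (mmul (mmul h (diagm L)) (madj h)))) (madj C))) (madj (diagm (- X2))).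
    rewrite /M' ME QE TE /h hE !madjM !madj_diagm !opprK madjK -!mmulA.
    by rewrite mmulKm // diagmD addNr diagm0 mmul1.
  by rewrite e1 !mtr_conj ?mdet_diagm.
have trM : mtr M = expR (L / 2) + expR (- (L / 2)).
  have -> : M = mmul (mmul (diagm (- X2)) (word_T K X Y)) (madj (diagm (- X2))) by rewrite madj_diagm opprK.
  by rewrite mtr_conj.
split.
- by apply: (diag_conj_crossing hh L0); rewrite -?trM -trMM.
- have r0 : 0 < m11 K * m22 K by case/andP: ad.
  have le2 : expR (L / 2) + expR (- (L / 2)) <= 2 * expR (L / 2).
    have : expR (- (L / 2)) <= expR (L / 2) by rewrite ler_expR; lra.
    lra.
  have E1 : expR L = expR (L / 2) ^+ 2 by rewrite expr2 -expRD; congr expR; field.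
  have E2 : expR (X + Y) = expR ((X + Y) / 2) ^+ 2 by rewrite expr2 -expRD; congr expR; field.
  rewrite E1 E2; move: h3; rewrite trM -/X -/Y => h3.
  have h5 : m11 K * m22 K / 4 * expR ((X + Y) / 2) <= expR (L / 2) by lra.
  have h6 : 0 <= m11 K * m22 K / 4 * expR ((X + Y) / 2) by rewrite mulr_ge0 ?expR_ge0 // divr_ge0 // ltW.
  have : (m11 K * m22 K / 4 * expR ((X + Y) / 2)) ^+ 2 <= expR (L / 2) ^+ 2.
    by rewrite lerXn2r ?nnegrE ?expR_ge0.
  by rewrite exprMn expr_div_n (_ : 4 ^+ 2 = 16 :> R) //; ring.
move=> s t st.
have zz := act_gt0 hC (axis_gt0 s); have tt := act_gt0 hC (axis_gt0 t).
pose z := act (diagm (- X2)) (act C (axis s)).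
have z0 : 0 < z.2 by apply: act_gt0; rewrite ?mdet_diagm.
have zE : act C (axis s) = act (diagm X2) z.
  by rewrite /z -act_mul ?mdet_diagm // diagmD subrr diagm0 act_one.
have wE : act (madj K') z = act (mmul P C) (axis t).
  rewrite /z st -(act_mul hC hh (axis_gt0 t)) -(act_mul (dd _) (mdet1_mul hC hh) (axis_gt0 t)).
  rewrite -(act_mul hKa' (mdet1_mul (dd _) (mdet1_mul hC hh)) (axis_gt0 t)).
  by rewrite /h hE -!mmulA mmulKVm // diagmK mmulKm.
exists z; split=> //.
  apply: h4 => //.
    have -> : M = mmul (mmul (mmul (diagm (- X2)) C) (diagm L)) (madj (mmul (diagm (- X2)) C)).
      by rewrite ME TE madjM madj_diagm opprK -!mmulA.
    rewrite /z -act_mul ?mdet_diagm ?axis_gt0 //.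
    by apply: on_axis_line; rewrite mdet1_mul ?mdet_diagm.
  have -> : Q = mmul (mmul (mmul P C) (diagm L)) (madj (mmul P C)).
    by rewrite QE TE madjM -!mmulA.
  by rewrite wE; apply: on_axis_line; rewrite mdet1_mul.
rewrite wE -!act_mul ?axis_gt0 ?mdet1_mul ?mdet_diagm //.
congr (act _ (axis t)).
- by rewrite /P -!mmulA diagmKV mmulKVm // diagmKV.
- by apply: act_gt0; [apply: mdet1_mul|exact: axis_gt0].
- by apply: act_gt0; [apply: mdet1_mul => //; apply: mdet1_mul|exact: axis_gt0].
Qed.

End CrossingFamily.

(** * Inequivalence of the crossings *)

Section FamilySeparation.
Variable R : realType.
Implicit Types (z w v : R * R) (M N C P : mat R) (s t x y X Y L : R).

Lemma word_boundW K K' (C0 B C1 B1 : R) : C0 <= C1 -> B <= B1 ->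
  word_bound K K' C0 B -> word_bound K K' C1 B1.
Proof.
move=> hC hB wb X1 X2 Y1 Y2 h1 h2 h3 h4 C L hc L0 trT TE.
have [k1 k2 k3] := wb X1 X2 Y1 Y2 (le_trans hC h1) (le_trans hC h2) (le_trans hC h3)
  (le_trans hC h4) C L hc L0 trT TE.
split=> // s t /k3[z [z0 e1 e2 e3]]; exists z; split=> //; exact: le_trans hB.
Qed.

Lemma int_far L (a : int) : 0 < L -> a != 0 -> expR L <= expR (L * a%:~R) + expR (- (L * a%:~R)).
Proof.
move=> L0 a0; have [|] := ltP 0 a => ha.
  have h : L <= L * a%:~R by rewrite ler_peMr ?(ltW L0) // -[1]/(1%:~R) ler_int.
  have := expR_ge0 (- (L * a%:~R)); have : expR L <= expR (L * a%:~R) by rewrite ler_expR.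
  by lra.
have ha' : a <= -1 by move: a0 ha; case: a => [[|n]|n] //.
have h : L <= - (L * a%:~R).
  by rewrite -mulrN ler_peMr ?(ltW L0) // lerNr -[-1]/((-1)%:~R) ler_int.
have := expR_ge0 (L * a%:~R); have : expR L <= expR (- (L * a%:~R)) by rewrite ler_expR.
by lra.
Qed.

Lemma cosh2_nsq z (B : R) : 0 < z.2 -> cosh2 z <= B -> nsq z <= B ^+ 2 /\ 4 * nsq z <= B ^+ 2 * z.2 ^+ 2.
Proof.
move=> z0; rewrite /cosh2 ler_pdivrMr // => h; have n0 := nsq_gt0 z0.
have B0 : 0 <= B.
  have : 0 < B * z.2 by lra.
  by rewrite pmulr_lgt0 // => /ltW.
have h2 : (1 + nsq z) ^+ 2 <= (B * z.2) ^+ 2 by rewrite lerXn2r ?nnegrE //; [lra|rewrite mulr_ge0 // ltW].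
have zn : z.2 ^+ 2 <= nsq z by rewrite /nsq lerDr sqr_ge0.
rewrite exprMn in h2; have B2 := sqr_ge0 B; split; last by have := sqr_ge0 (nsq z - 1); nra.
have k : B ^+ 2 * z.2 ^+ 2 <= B ^+ 2 * nsq z by rewrite ler_wpM2l.
have : nsq z * nsq z <= B ^+ 2 * nsq z by nra.
by rewrite ler_pM2r.
Qed.

Variables (I : finType) (k0 : I) (K : I -> mat R).
Hypotheses (hK : forall k, mdet (K k) = 1) (had : forall k, 0 < m11 (K k) * m22 (K k) < 1).

Let K0 := K k0.

Definition conj_h C k x y X := mmul (madj C) (mmul (word_h K0 (K k) x y X) C).

Definition margins (C0 X Y x y : R) := [/\ C0 <= x, C0 <= X - x, C0 <= y & C0 <= Y - y].

Lemma margins_bounds (C0 X Y x y x' y' : R) : 0 < C0 -> margins C0 X Y x y -> margins C0 X Y x' y' ->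
  [/\ `|- x' + x| <= X + Y - 2 * C0, `|- y' + y| <= X + Y - 2 * C0,
      X - x + y' <= X + Y - 2 * C0 & 2 * C0 <= (X - x) + (X - x)].
Proof.
move=> h [h1 h2 h3 h4] [h1' h2' h3' h4'].
by split; rewrite ?ler_norml; try (apply/andP; split); lra.
Qed.

(** A line crosses the axis only once, so an identity with powers a, b of [diagm L] shifts the two
    crossing parameters by multiples a and b of L. Within the margins these parameters differ by
    less than L, so a = b = 0. Against an inverse the argument gives a = 0, and then a point of the
    first arc would lie on the second. *)
Lemma family_separation : exists2 C0, 0 < C0 & forall X Y C L, mdet C = 1 -> 0 < L ->
  mtr (word_T K0 X Y) = expR (L / 2) + expR (- (L / 2)) ->
  word_T K0 X Y = mmul (mmul C (diagm L)) (madj C) ->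
  forall k1 x1 y1, margins C0 X Y x1 y1 ->
  0 < m11 (conj_h C k1 x1 y1 X) * m22 (conj_h C k1 x1 y1 X) < 1 /\
  forall k2 x2 y2 (a b : int), margins C0 X Y x2 y2 ->
  ((forall z, 0 < z.2 -> act (mmul (diagm (L * a%:~R)) (mmul (conj_h C k1 x1 y1 X) (diagm (L * b%:~R)))) z =
     act (conj_h C k2 x2 y2 X) z) ->
   forall z, 0 < z.2 -> act (conj_h C k1 x1 y1 X) z = act (conj_h C k2 x2 y2 X) z) /\
  ~ (forall z, 0 < z.2 -> act (mmul (diagm (L * a%:~R)) (mmul (conj_h C k1 x1 y1 X) (diagm (L * b%:~R)))) z =
     act (madj (conj_h C k2 x2 y2 X)) z).
Proof.
have /choice[f hf] : forall k, exists CB : R * R, word_bound K0 (K k) CB.1 CB.2.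
  move=> k; have [c [B h]] := word_bound_exists (hK k0) (hK k) (had k0) (had k).
  by exists (c, B).
have sum_ge (F : I -> R) k : F k <= \sum_j `|F j|.
  rewrite (bigD1 k) //=; apply: (le_trans (ler_norm _)); rewrite lerDl; exact: sumr_ge0.
pose C1 := \sum_k `|(f k).1|; pose B := \sum_k `|(f k).2|.
have wb k : word_bound K0 (K k) C1 B.
  apply: (word_boundW _ _ (hf k)); first exact: (sum_ge (fun k => (f k).1)).
  exact: (sum_ge (fun k => (f k).2)).
have B0 : 0 <= B by apply: sumr_ge0.
have C10 : 0 <= C1 by apply: sumr_ge0.
pose n1 := \sum_k `|mnorm2 (madj (K k))|; have n10 : 0 <= n1 by apply: sumr_ge0.
pose B2 := n1 * B + 2; have B20 : 0 < B2 by rewrite ltr_wpDl // mulr_ge0.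
have B22 : 2 <= B2 by rewrite lerDr mulr_ge0.
pose n0 := mnorm2 K0; have n00 : 0 <= n0 := mnorm2_ge0 _.
have th0 : 0 <= 1 - 4 / B2 ^+ 2.
  by rewrite subr_ge0 ler_pdivrMr ?exprn_gt0 // mul1r (_ : 4 = 2 ^+ 2 :> R); [rewrite lerXn2r ?nnegrE ?(ltW B20)|ring].
(* Points with [cosh2] at most [B2] satisfy 4 |w|^2 <= B2^2 y^2, hence lie in the cone with this
   opening, as do their dilates. *)
pose th := Num.sqrt (1 - 4 / B2 ^+ 2).
have th1 : 0 <= th < 1.
  rewrite sqrtr_ge0 -[ltRHS]sqrtr1 ltr_sqrt // ltrBlDr ltrDl divr_gt0 ?exprn_gt0 //.
have [m [M [m0 hm]]] := nsq_act_cone (hK k0) (had k0) th1.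
have /andP[r0 r1] := had k0; set rho := m11 (K k0) * m22 (K k0) in r0 r1.
pose kap := rho ^+ 2 / 16; have kap0 : 0 < kap by rewrite divr_gt0 // exprn_gt0.
(* [W] adds up the coefficients of the three distance estimates below. The margin is chosen so that
   e^(2 C0) exceeds W / kap, which excludes nonzero powers, and B^2 / m, which separates the two
   arcs. *)
pose W := 2 * B ^+ 2 + 2 * B2 ^+ 2 + 2 * (B * (n0 * B2)).
have W0 : 0 <= W by rewrite /W !addr_ge0 ?mulr_ge0 ?sqr_ge0 // ltW.
pose V := W / kap + B ^+ 2 / m.
have V0 : 0 <= V by rewrite addr_ge0 ?divr_ge0 ?sqr_ge0 ?(ltW m0) ?(ltW kap0).
exists (C1 + V + 1); first by rewrite ltr_wpDl // addr_ge0.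
set C0 := C1 + V + 1 => X Y C L hC L0 trT TE.
have C0C1 : C1 <= C0 by rewrite /C0; lra.
have VC : V < expR (2 * C0).
  apply: lt_le_trans (expR_ge1Dx _); rewrite /C0; lra.
have VW : W < kap * expR (2 * C0).
  rewrite mulrC -ltr_pdivrMr //; apply: le_lt_trans VC.
  by rewrite lerDl divr_ge0 ?sqr_ge0 // ltW.
have VB : B ^+ 2 < expR (2 * C0) * m.
  rewrite -ltr_pdivrMr //; apply: le_lt_trans VC.
  by rewrite lerDr divr_ge0 // ltW.
have main k x y : margins C0 X Y x y -> let h := conj_h C k x y X in
  [/\ 0 < m11 h * m22 h < 1, kap * expR (X + Y) <= expR L &
   forall s t, axis s = act h (axis t) -> exists z w, [/\ 0 < z.2 /\ 0 < w.2,
     act C (axis s) = act (diagm x) z, cosh2 z <= B, cosh2 w <= B2 &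
     act C (axis t) = act (diagm X) (act K0 (act (diagm y) w))]].
  move=> [hx hx' hy hy'] h.
  have eX : X - x + x = X by rewrite subrK.
  have eY : Y - y + y = Y by rewrite subrK.
  have := wb k (X - x) x (Y - y) y (le_trans C0C1 hx') (le_trans C0C1 hx)
    (le_trans C0C1 hy') (le_trans C0C1 hy) C L hC L0.
  rewrite eX eY => /(_ trT TE) [g1 g2 g3]; split=> // s t /g3[z [z0 e1 e2 e3]].
  exists z, (act (madj (K k)) z).
  have w0 : 0 < (act (madj (K k)) z).2 by apply: act_gt0 => //; exact: mdet1_adj.
  split=> //; apply: le_trans (cosh2_act (mdet1_adj (hK k)) z0) _.
  apply: (@le_trans _ _ (n1 * B)); last by rewrite lerDl.
  apply: ler_pM => //; [exact: mnorm2_ge0|exact: cosh2_ge0|].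
  exact: (sum_ge (fun k => mnorm2 (madj (K k)))).
have hcd k x y : mdet (conj_h C k x y X) = 1.
  by apply: mdet1_mul; [exact: mdet1_adj|apply: mdet1_mul => //; exact: (mdet_word_h _ _ _ (hK k0) (hK k))].
(* A nonzero [a] would put the two points at distance at least L, too far because e^L is at least
   kap e^(X + Y). *)
have far (a : int) (s u Z : R) z w : kap * expR (X + Y) <= expR L -> s = u + L * a%:~R ->
    act C (axis u) = z -> act C (axis s) = w -> qdist z w + 2 <= Z * expR (X + Y) * expR (- (2 * C0)) -> Z <= W -> a = 0.
  move=> kL -> ez ew qZ ZW; apply/eqP/negPn/negP => a0.
  have := int_far L0 a0.
  move: qZ; rewrite -ez -ew (qdist_act hC (axis_gt0 _) (axis_gt0 _)) qdist_axis.
  rewrite (_ : u - (u + L * a%:~R) = - (L * a%:~R)); last by ring.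
  rewrite opprK => qZ lL.
  have E0 := expR_gt0 (X + Y); have E1 := expR_gt0 (- (2 * C0)).
  have k1 : kap * expR (X + Y) <= Z * expR (- (2 * C0)) * expR (X + Y) by lra.
  rewrite ler_pM2r // in k1.
  have k2 : Z * expR (- (2 * C0)) <= W * expR (- (2 * C0)) by rewrite ler_pM2r.
  have k3 : W * expR (- (2 * C0)) < kap.
    by rewrite expRN ltr_pdivrMr ?expR_gt0.
  lra.
move=> k1 x1 y1 h1; split; first by have [] := main k1 x1 y1 h1.
move=> k2 x2 y2 a b h2.
have [ad1 kL g1] := main k1 x1 y1 h1; have [ad2 _ g2] := main k2 x2 y2 h2.
set H1 := conj_h C k1 x1 y1 X in ad1 g1 *; set H2 := conj_h C k2 x2 y2 X in ad2 g2 *.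
have hH1 : mdet H1 = 1 := hcd _ _ _; have hH2 : mdet H2 = 1 := hcd _ _ _.
have [s1 [t1 st1]] := line_crossing hH1 ad1; have [s2 [t2 st2]] := line_crossing hH2 ad2.
have [z1 [w1 [[z10 w10] ez1 cz1 cw1 ew1]]] := g1 _ _ st1.
have [z2 [w2 [[z20 w20] ez2 cz2 cw2 ew2]]] := g2 _ _ st2.
have [m1 m2 m3 m4] := h1; have [m1' m2' m3' m4'] := h2.
have dd := @mdet_diagm R.
have shift s t : act (mmul (diagm (L * a%:~R)) (mmul H1 (diagm (L * b%:~R)))) (axis t) = axis s ->
    s1 = s - L * a%:~R /\ t1 = t + L * b%:~R.
  rewrite (act_mul (dd _) (mdet1_mul hH1 (dd _)) (axis_gt0 t)) (act_mul hH1 (dd _) (axis_gt0 t)).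
  rewrite act_diagm_axis => e.
  have e' : axis (s - L * a%:~R) = act H1 (axis (t + L * b%:~R)).
    rewrite [t + _]addrC [s - _]addrC -act_diagm_axis -e -act_mul ?dd //.
      by rewrite diagmD addNr diagm0 act_one.
    by apply: act_gt0 => //; exact: axis_gt0.
  by have [] := line_crossing_unique hH1 ad1 st1 e'.
have C00 : 0 < C0 by rewrite /C0; lra.
have est (u q q' Z : R) : `|u| <= X + Y - 2 * C0 -> 0 <= q -> 0 <= q' -> q <= Z -> q' <= Z ->
    2 * expR `|u| * (q * q') <= 2 * Z ^+ 2 * expR (X + Y) * expR (- (2 * C0)).
  move=> hu q0 q0' qZ qZ'; rewrite -[leRHS]mulrA -expRD.
  rewrite (_ : 2 * expR `|u| * (q * q') = 2 * (q * q') * expR `|u|); last by ring.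
  apply: ler_pM; rewrite ?expR_ge0 ?mulr_ge0 ?ler_expR //.
  by rewrite ler_pM2l // expr2; apply: ler_pM.
split.
  move=> hact.
  have [es et] : s1 = s2 - L * a%:~R /\ t1 = t2 + L * b%:~R.
    by apply: shift; rewrite hact ?axis_gt0 // st2.
  have a0 : a = 0.
    apply: (far a s2 s1 (2 * B ^+ 2) _ _ kL _ ez1 ez2); first by rewrite es subrK.
      rewrite -(qdist_act (dd (- x2))) ?act_gt0 // -!act_mul // !diagmD addNr diagm0 act_one.
      apply: le_trans (qdist_diagm _ z10 z20) _.
      have [k1' _ _ _] := margins_bounds C00 h1 h2.
      by apply: est; rewrite ?cosh2_ge0.
    by rewrite /W -addrA lerDl addr_ge0 ?mulr_ge0 ?sqr_ge0 // ltW.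
  have b0 : b = 0.
    apply: (far b t1 t2 (2 * B2 ^+ 2) _ _ kL et ew2 ew1).
      rewrite qdist_act ?dd ?act_gt0 ?hK //.
      rewrite qdist_act ?hK ?act_gt0 ?dd //.
      rewrite -(qdist_act (dd (- y1))) ?act_gt0 // -!act_mul // !diagmD addNr diagm0 act_one.
      apply: le_trans (qdist_diagm _ w20 w10) _.
      have [_ k1' _ _] := margins_bounds C00 h2 h1.
      by apply: est; rewrite ?cosh2_ge0.
    by rewrite /W addrAC lerDr addr_ge0 ?mulr_ge0 ?sqr_ge0 // ltW.
  move=> z z0; rewrite -hact // a0 b0 mulr0 diagm0 mul1m mmul1 //.
move=> hact.
have [es et] : s1 = t2 - L * a%:~R /\ t1 = s2 + L * b%:~R.
  by apply: shift; rewrite hact ?axis_gt0 // st2 actK ?axis_gt0.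
have v0 : 0 < (act K0 (act (diagm y2) w2)).2 by rewrite !act_gt0 ?hK ?dd.
have a0 : a = 0.
  apply: (far a t2 s1 (2 * (B * (n0 * B2))) _ _ kL _ ez1 ew2); first by rewrite es subrK.
    rewrite -(qdist_act (dd (- X))) ?act_gt0 //.
    rewrite -(act_mul (dd (- X)) (dd x1) z10) -(act_mul (dd (- X)) (dd X) v0) !diagmD addNr diagm0 act_one.
    apply: le_trans (qdist_diagm _ z10 v0) _.
    have c3 : cosh2 (act K0 (act (diagm y2) w2)) <= n0 * (expR y2 * B2).
      apply: le_trans (cosh2_act (hK k0) _) _; first by rewrite act_gt0 ?dd.
      rewrite ler_wpM2l //; apply: le_trans (cosh2_diagm _ w20) _.
      by rewrite ger0_norm ?ler_pM2l ?expR_gt0 // (le_trans (ltW C00)).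
    have k1' : `|- X + x1| = X - x1.
      by rewrite addrC -opprB normrN ger0_norm // (le_trans (ltW C00)).
    rewrite k1'.
    have k4 : cosh2 z1 * cosh2 (act K0 (act (diagm y2) w2)) <= B * (n0 * (expR y2 * B2)).
      by apply: ler_pM; rewrite ?cosh2_ge0.
    have k5 : 2 * expR (X - x1) * (cosh2 z1 * cosh2 (act K0 (act (diagm y2) w2))) <=
       2 * expR (X - x1) * (B * (n0 * (expR y2 * B2))).
      by rewrite ler_wpM2l // mulr_ge0 // expR_ge0.
    apply: le_trans k5 _.
    have -> : 2 * expR (X - x1) * (B * (n0 * (expR y2 * B2))) =
      2 * (B * (n0 * B2)) * (expR (X - x1) * expR y2) by ring.
    rewrite -[leRHS]mulrA -!expRD ler_wpM2l ?ler_expR //; last by have [] := margins_bounds C00 h1 h2.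
    by rewrite !mulr_ge0 // ltW.
  - exact: hK.
  by rewrite /W lerDr addr_ge0 // mulr_ge0 ?sqr_ge0.
(* A point of the first arc would be one of the second. Seen from its place on the first arc it
   satisfies |z|^2 <= B^2, whereas being on the second it has |z|^2 above e^(2 C0) m. *)
have e : act (diagm x1) z1 = act (diagm X) (act K0 (act (diagm y2) w2)).
  by rewrite -ez1 -ew2 es a0 mulr0 subr0.
have {}e : z1 = act (diagm (X - x1)) (act K0 (act (diagm y2) w2)).
  have := congr1 (act (diagm (- x1))) e.
  rewrite -(act_mul (dd (- x1)) (dd x1) z10) -(act_mul (dd (- x1)) (dd X) v0) !diagmD addNr diagm0 act_one.
  by rewrite addrC.
have [nz _] := cosh2_nsq z10 cz1.
have [_ nw] := cosh2_nsq w20 cw2.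
have /andP[hm1 _] : m < nsq (act K0 (act (diagm y2) w2)) < M.
  apply: hm; first by rewrite act_gt0 ?dd.
  rewrite nsq_diagm act_diagm /= exprMn [leRHS]mulrCA ler_pM2l ?exprn_gt0 ?expR_gt0 //.
  rewrite sqr_sqrtr // mulrBl mul1r {1}/nsq lerBrDr lerD2l.
  by rewrite mulrAC ler_pdivrMr ?exprn_gt0 // [_ * B2 ^+ 2]mulrC.
move: nz; rewrite e nsq_diagm.
have E2 : expR (2 * C0) <= expR (X - x1) ^+ 2.
  by rewrite expr2 -expRD ler_expR; have [] := margins_bounds C00 h1 h2.
apply/negP; rewrite -ltNge; apply: (lt_le_trans VB).
apply: (@le_trans _ _ (expR (X - x1) ^+ 2 * m)); first by rewrite ler_pM2r.
by rewrite ler_wpM2l ?sqr_ge0 // ltW.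
Qed.

End FamilySeparation.

(** * Equality of isometries, and deck transformations between lines *)

Section ActEq.
Variable R : realType.
Implicit Types (z w : R * R) (M N P Q : mat R).

(** Equality in PSL(2, R), expressed through the action so that signs need not be followed. *)
Definition act_eq M N := forall z, 0 < z.2 -> act M z = act N z.

Lemma act_eq_sym M N : act_eq M N -> act_eq N M.
Proof. by move=> h z z0; rewrite h. Qed.

Lemma act_eq_mul P M N Q : mdet P = 1 -> mdet M = 1 -> mdet N = 1 -> mdet Q = 1 ->
  act_eq M N -> act_eq (mmul P (mmul M Q)) (mmul P (mmul N Q)).
Proof.
move=> hP hM hN hQ h z z0; rewrite !act_mul ?mdet1_mul //.
by rewrite h //; exact: act_gt0.
Qed.

Lemma act_eq_adj M N : mdet M = 1 -> mdet N = 1 -> act_eq M N -> act_eq (madj M) (madj N).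
Proof.
move=> hM hN h z z0; have w0 := act_gt0 (mdet1_adj hN) z0.
by rewrite -{1}(actVK hN z0) -h // actK.
Qed.

End ActEq.

Section DeckLines.
Variables (R : realType) (g : nat) (X : hyperbolic_surface R g).
Implicit Types (z w : R * R) (M N K C : mat R) (s t L : R).
Variable p : R * R -> X.
Hypothesis hp : covering p.

Lemma deck_act_eq M N : mdet N = 1 -> act_eq M N -> deck p M -> deck p N.
Proof. by move=> hN h [_ pM]; split=> // z z0; rewrite -h // pM. Qed.

Lemma line_act_eq M N : mdet M = 1 -> mdet N = 1 ->
  (forall t, act M (axis t) = act N (axis t)) -> act_eq M N.
Proof.
move=> hM hN h z _.
have ne : (0 : R) <> 1 by apply/eqP; rewrite eq_sym oner_eq0.
by have [->|->] := line_agree hM hN ne (h 0) (h 1); rewrite ?act_opp.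
Qed.

(** Both lines lift one geodesic. The deck transformation matching their points at time 0 matches
    them entirely, by uniqueness of path lifts, and so acts as K' K^-1. *)
Lemma deck_of_lines K K' : mdet K = 1 -> mdet K' = 1 ->
  (forall t, p (act K (axis t)) = p (act K' (axis t))) -> deck p (mmul K' (madj K)).
Proof.
move=> hK hK' e.
have z0 := act_gt0 hK (axis_gt0 (R := R) 0); have w0 := act_gt0 hK' (axis_gt0 (R := R) 0).
have [M hM eM] := covering_transitive hp hp z0 w0 (e 0).
have lK : path_lift p (fun t => p (act K (axis t))) (fun t => act K (axis t)).
  exact: line_path_lift.
have lK' : path_lift p (fun t => p (act K (axis t))) (fun t => act K' (axis t)).
  exact: line_path_lift.
have E t : act M (act K (axis t)) = act K' (axis t).
  exact: (@path_lift_unique _ _ _ p hp _ _ _ 0 t (path_lift_act hM lK) lK' eM).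
have [dM _] := hM.
have E' : act_eq (mmul M K) K'.
  apply: line_act_eq => // [|t]; first exact: mdet1_mul.
  by rewrite act_mul ?axis_gt0.
have d1 : mdet (mone R) = 1 := mdet_one R.
have := act_eq_mul d1 (mdet1_mul dM hK) hK' (mdet1_adj hK) E'.
rewrite !mul1m mmulmK // => /deck_act_eq; apply => //.
by apply: mdet1_mul => //; exact: mdet1_adj.
Qed.

Lemma deck_conj C N : mdet C = 1 -> deck (p \o act C) N -> deck p (mmul C (mmul N (madj C))).
Proof.
move=> hC [hN h]; have hC' := mdet1_adj hC; split; first by rewrite !mdet1_mul.
move=> z z0; have w0 := act_gt0 hC' z0.
rewrite (act_mul hC (mdet1_mul hN hC') z0) (act_mul hN hC' z0).
by have := h _ w0; rewrite /= actVK.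
Qed.

Lemma deck_conj_adj C N : mdet C = 1 -> deck p N -> deck (p \o act C) (mmul (madj C) (mmul N C)).
Proof.
move=> hC [hN h]; have hC' := mdet1_adj hC; split; first by rewrite !mdet1_mul.
move=> z z0; have w0 := act_gt0 hC z0.
rewrite /= (act_mul hC' (mdet1_mul hN hC) z0) (act_mul hN hC z0) actVK ?h //.
exact: act_gt0.
Qed.

End DeckLines.

Lemma nat_frac (R : realType) (s t : R) (i j : nat) : 0 <= s < 1 -> 0 <= t < 1 ->
  s + i%:R = t + j%:R -> i = j /\ s = t.
Proof.
move=> /andP[s0 s1] /andP[t0 t1] e; have ij : i = j.
  apply/eqP; rewrite eqn_leq; apply/andP; split; rewrite -ltnS -(ltr_nat R) -natr1; lra.
by split=> //; move: e; rewrite ij => /addIr.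
Qed.

(** * Self-intersections of the product geodesic *)

Section CrossingLowerBound.
Variables (R : realType) (g : nat) (X : hyperbolic_surface R g).
Variable p : R * R -> X.
Hypothesis hp : covering p.
Variables (I : finType) (k0 : I) (K : I -> mat R) (l1 l2 : R) (s t : I -> R).
Hypotheses (l10 : 0 < l1) (l20 : 0 < l2) (hK : forall k, mdet (K k) = 1)
  (had : forall k, 0 < m11 (K k) * m22 (K k) < 1)
  (hs : forall k, 0 <= s k < 1) (ht : forall k, 0 <= t k < 1)
  (hst : forall k k', s k = s k' -> t k = t k' -> k = k')
  (meet : forall k, act (K k) (axis (l2 * t k)) = axis (l1 * s k))
  (d1 : deck p (diagm l1)) (d2 : deck (p \o act (K k0)) (diagm l2))
  (dK : forall k, deck p (mmul (K k) (madj (K k0)))).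

Let dd := @mdet_diagm R.

(** After cancelling a common right factor, the translate crosses the axis at the parameters l1 (s +
    i) and l2 (t + j); integer and fractional parts recover the turns and the intersection point. *)
Lemma word_h_inj (k k' : I) (i i' j j' : nat) (Z : R) :
  act_eq (word_h (K k0) (K k) (l1 * i%:R) (l2 * j%:R) Z)
         (word_h (K k0) (K k') (l1 * i'%:R) (l2 * j'%:R) Z) -> [/\ k = k', i = i' & j = j'].
Proof.
pose u k i j := mmul (diagm (l1 * i%:R)) (mmul (K k) (diagm (- (l2 * j%:R)))).
have hu k1 i1 j1 : mdet (u k1 i1 j1) = 1 by rewrite !mdet1_mul.
have uad k1 i1 j1 : 0 < m11 (u k1 i1 j1) * m22 (u k1 i1 j1) < 1.
  suff -> : m11 (u k1 i1 j1) * m22 (u k1 i1 j1) = m11 (K k1) * m22 (K k1) by [].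
  rewrite /u /=; set x := _ / 2; set y := _ / 2.
  transitivity ((expR x * expR (- x)) * (expR y * expR (- y)) * (m11 (K k1) * m22 (K k1))); first by ring.
  have e (v : R) : expR v * expR (- v) = 1 by rewrite -expRD subrr expR0.
  by rewrite !e !mul1r.
have umeet k1 i1 j1 : axis (l1 * (s k1 + i1%:R)) = act (u k1 i1 j1) (axis (l2 * (t k1 + j1%:R))).
  rewrite /u (act_mul (dd _) (mdet1_mul (hK _) (dd _)) (axis_gt0 _)) (act_mul (hK _) (dd _) (axis_gt0 _)).
  rewrite act_diagm_axis (_ : - (l2 * j1%:R) + l2 * (t k1 + j1%:R) = l2 * t k1); last by ring.
  by rewrite meet act_diagm_axis mulrDr addrC.
move=> h; have {}h : act_eq (u k i j) (u k' i' j').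
  have P k1 i1 j1 : mmul (mone R) (mmul (word_h (K k0) (K k1) (l1 * i1%:R) (l2 * j1%:R) Z)
      (mmul (diagm Z) (K k0))) = u k1 i1 j1.
    by rewrite mul1m /word_h -!mmulA diagmK mmulVm // mmul1.
  rewrite -(P k) -(P k'); apply: act_eq_mul => //; try exact: mdet_one; try exact: mdet_word_h.
  exact: mdet1_mul.
have e := umeet k i j; have e' := umeet k' i' j'; rewrite -h ?axis_gt0 // in e'.
have [e1 e2] := line_crossing_unique (hu k i j) (uad k i j) e e'.
have [ii ss] := nat_frac (hs k) (hs k') (mulfI (lt0r_neq0 l10) e1).
have [jj tt] := nat_frac (ht k) (ht k') (mulfI (lt0r_neq0 l20) e2).
by split=> //; exact: hst.
Qed.

(** [q] turns of either geodesic are at least as long as the margin. With [q] of them set aside at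
    each end of each arc, every pair of the remaining [n] and [m] turns contributes all points of
    [I]. *)
Lemma crossing_lower_bound : exists q : nat, forall n m : nat, exists c : closed_geodesic X,
  geod_length c <= l1 * (n + 2 * q)%:R + l2 * (m + 2 * q)%:R /\
  ((#|I| * n * m * 2)%:R%:E <= geom_intersection c c)%E.
Proof.
have [C0 C00 sep] := family_separation k0 hK had.
have [q qP] : exists q : nat, [/\ (0 < q)%N, C0 <= l1 * q%:R & C0 <= l2 * q%:R].
  exists (Num.bound (C0 / l1) + Num.bound (C0 / l2)).+1; split=> //.
    rewrite mulrC -ler_pdivrMr //; apply: le_trans (ltW (archi_boundP _)) _; first by rewrite divr_ge0 // ltW.
    by rewrite ler_nat -addnS leq_addr.
  rewrite mulrC -ler_pdivrMr //; apply: le_trans (ltW (archi_boundP _)) _; first by rewrite divr_ge0 // ltW.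
  by rewrite ler_nat -addSn leq_addl.
case: qP => q0 q1 q2; exists q => n m.
set XX := l1 * _; set YY := l2 * _.
have q0' : 0 < q%:R :> R by rewrite ltr0n.
have XX0 : 0 < XX by rewrite mulr_gt0 // ltr0n addn_gt0 muln_gt0 q0 orbT.
have YY0 : 0 < YY by rewrite mulr_gt0 // ltr0n addn_gt0 muln_gt0 q0 orbT.
have [C [L [hC L0 trT TE LXY]]] := word_T_diag (hK k0) (had k0) XX0 YY0.
have {}sep := sep _ _ _ _ hC L0 trT TE.
have dD1 (a : nat) : deck p (diagm (l1 * a%:R)) by exact: (deck_diagm_int d1 a).
have hp0 := covering_act (hK k0) hp.
have dD2 (a : nat) : deck p (mmul (K k0) (mmul (diagm (l2 * a%:R)) (madj (K k0)))).
  by apply: deck_conj => //; exact: (deck_diagm_int d2 a).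
have dT : deck p (word_T (K k0) XX YY) by apply: deck_mul; [exact: dD1|exact: dD2].
have dh k (i j : nat) : deck p (word_h (K k0) (K k) (l1 * i%:R) (l2 * j%:R) XX).
  have -> : word_h (K k0) (K k) (l1 * i%:R) (l2 * j%:R) XX = mmul (diagm (l1 * i%:R))
     (mmul (mmul (K k) (madj (K k0))) (mmul (madj (mmul (K k0) (mmul (diagm (l2 * j%:R)) (madj (K k0)))))
       (madj (diagm XX)))).
    by rewrite !madjM madjK !madj_diagm -!mmulA mmulKm.
  apply: deck_mul; first exact: dD1.
  apply: deck_mul; first exact: dK.
  by apply: deck_mul; apply: deck_adj; [exact: dD2|exact: dD1].
have hpC := covering_act hC hp.
have dL : deck (p \o act C) (diagm L).
  have := deck_conj_adj hC dT; rewrite TE -!mmulA mmulVm // mmul1 mmulKm //.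
have cg := line_geodesic hp hC.
have per u : p (act C (axis (u + L))) = p (act C (axis u)).
  by rewrite addrC -act_diagm_axis; have [_ h] := dL; apply: h; exact: axis_gt0.
exists (ClosedGeodesic L0 cg per); split=> //.
apply: le_ereal_inf_tmp => _ [nn [al [be [[[ac _] ha] [[bc _] hb] _ card]]] <-].
rewrite lee_fin ler_nat.
pose hj (j : I * 'I_n * 'I_m) := conj_h k0 K C j.1.1 (l1 * (q + j.1.2)%:R) (l2 * (q + j.2)%:R) XX.
have hjd j : mdet (hj j) = 1.
  by apply: mdet1_mul; [exact: mdet1_adj|apply: mdet1_mul => //; exact: (mdet_word_h _ _ _ (hK _) (hK _))].
(* The boolean selects [hj] or its inverse: each crossing of the geodesic with itself gives two
   pairs of parameters, in either order, and by [sep2] these are never equivalent. *)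
pose J := ((I * 'I_n * 'I_m) * bool)%type.
pose h (j : J) := if j.2 then madj (hj j.1) else hj j.1.
have mg (j : I * 'I_n * 'I_m) : margins C0 XX YY (l1 * (q + j.1.2)%:R) (l2 * (q + j.2)%:R).
  have bnd l (N : nat) (i : 'I_N) : 0 < l -> C0 <= l * q%:R -> C0 <= l * (q + i)%:R /\
      C0 <= l * (N + 2 * q)%:R - l * (q + i)%:R.
    move=> l0 lq; split.
      by apply: le_trans lq _; rewrite ler_pM2l // ler_nat leq_addr.
    apply: le_trans lq _; rewrite -mulrBr ler_pM2l // lerBrDr -natrD ler_nat.
    by have := ltn_ord i; clear; lia.
  by have [b1 b2] := bnd _ _ j.1.2 l10 q1; have [b3 b4] := bnd _ _ j.2 l20 q2; split.
have sep1 j j' (a b : int) :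
    act_eq (mmul (diagm (L * a%:~R)) (mmul (hj j) (diagm (L * b%:~R)))) (hj j') -> j = j'.
  move=> e; have [_ /(_ j'.1.1 _ _ a b (mg j'))[/(_ e) e' _]] := sep j.1.1 _ _ (mg j).
  have : act_eq (word_h (K k0) (K j.1.1) (l1 * (q + j.1.2)%:R) (l2 * (q + j.2)%:R) XX)
      (word_h (K k0) (K j'.1.1) (l1 * (q + j'.1.2)%:R) (l2 * (q + j'.2)%:R) XX).
    have E k i1 j1 : mmul C (mmul (conj_h k0 K C k i1 j1 XX) (madj C)) = word_h (K k0) (K k) i1 j1 XX.
      by rewrite /conj_h -mmulA mmulKVm // mmulmK.
    rewrite -!E; apply: act_eq_mul => //; [exact: (hjd j)|exact: (hjd j')|exact: mdet1_adj].
  move=> /word_h_inj[e1 /addnI e2 /addnI e3].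
  move: e1 e2 e3; case: j {e e'} => [[k i] jj]; case: j' => [[k' i'] jj'] /= -> e2 e3.
  by congr (_, _, _); apply: val_inj.
have sep2 j j' (a b : int) :
    ~ act_eq (mmul (diagm (L * a%:~R)) (mmul (hj j) (diagm (L * b%:~R)))) (madj (hj j')).
  by have [_ /(_ j'.1.1 _ _ a b (mg j'))[_]] := sep j.1.1 _ _ (mg j).
have -> : (#|I| * n * m * 2 = #|{: J}|)%N by rewrite !card_prod !card_ord card_bool.
have adjdiag (a : int) : madj (diagm (L * a%:~R)) = diagm (L * (- a)%:~R).
  by rewrite madj_diagm mulrNz mulrN.
have move_over (M N : mat R) (a b : int) : mdet M = 1 -> mdet N = 1 ->
    act_eq (mmul (diagm (L * a%:~R)) (mmul M (diagm (L * b%:~R)))) N ->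
    act_eq (mmul (diagm (L * (- a)%:~R)) (mmul N (diagm (L * (- b)%:~R)))) M.
  move=> hM hN e; have hT : mdet (mmul (diagm (L * a%:~R)) (mmul M (diagm (L * b%:~R)))) = 1.
    by rewrite !mdet1_mul.
  have := act_eq_sym (act_eq_mul (dd (L * (- a)%:~R)) hT hN (dd (L * (- b)%:~R)) e).
  by rewrite -!adjdiag -!mmulA mmulmV // mmul1 mmulKm.
apply: (count_lower_bound hpC L0 dL (h := h) _ _ _ ac ha bc hb card).
- have dj j : deck (p \o act C) (hj j) by apply: deck_conj_adj.
  by move=> [j []]; rewrite /h /=; [exact: deck_adj|].
- move=> [j b]; rewrite /h /=; have [adj _] := sep j.1.1 _ _ (mg j).
  by case: b => //=; rewrite mulrC.
move=> [j b] [j' b'] a1 a2; rewrite /h /=; case: b; case: b' => e.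
- congr (_, _); have hT : mdet (mmul (diagm (L * a1%:~R)) (mmul (madj (hj j)) (diagm (L * a2%:~R)))) = 1.
    by rewrite !mdet1_mul ?mdet1_adj.
  apply: (sep1 j j' (- a2) (- a1)).
  have := act_eq_adj hT (mdet1_adj (hjd j')) e.
  by rewrite !madjM !madjK -!adjdiag -mmulA.
- by case: (sep2 j' j (- a1) (- a2)); apply: move_over => //; exact: mdet1_adj.
- by case: (sep2 j j' a1 a2).
- by congr (_, _); exact: sep1 e.
Qed.

End CrossingLowerBound.

(** * Letting the numbers of turns grow *)

Section LowerBoundLimit.
Variable R : realType.

(** [m] is the integer part of n l1 / l2, so the arcs are nearly equally long; this ratio makes n m
    / (n l1 + m l2)^2 largest. *)
Lemma sequence_lower_bound (l1 l2 N v : R) (q : nat) : 0 < l1 -> 0 < l2 -> 0 <= N ->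
  v < N / (2 * (l1 * l2)) -> exists n m : nat, (0 < n)%N /\
  v < N * n%:R * m%:R * 2 / (l1 * (n + 2 * q)%:R + l2 * (m + 2 * q)%:R) ^+ 2.
Proof.
move=> l10 l20 N0 hv; pose a := 2 * q%:R * (l1 + l2).
have l1n := lt0r_neq0 l10; have l2n := lt0r_neq0 l20.
(* At e = 1 / n this is the quotient with [m] replaced by n l1 / l2 - 1 in the numerator and by n l1
   / l2 in the denominator; it is continuous at 0, with the desired value there. *)
pose F (e : R) := N * 2 * (l1 / l2 - e) * (2 * l1 + a * e)^-1 ^+ 2.
have Fc : F e @[e --> (0 : R)] --> N * 2 * (l1 / l2 - 0) * (2 * l1 + a * 0)^-1 ^+ 2.
  by rewrite /F; lims; rewrite mulr0 addr0 mulf_neq0.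
have F0 : N * 2 * (l1 / l2 - 0) * (2 * l1 + a * 0)^-1 ^+ 2 = N / (2 * (l1 * l2)).
  by rewrite mulr0 addr0 subr0; field; rewrite l1n l2n.
rewrite F0 in Fc.
have [d d0 hd] := (near_lineP _ _).1 (cvgr_gt _ Fc _ hv).
pose n := (Num.bound (d^-1) + Num.bound (l2 / l1)).+1; have n0 : 0 < n%:R :> R by rewrite ltr0n.
have nn := lt0r_neq0 n0.
have nd : `|0 - n%:R^-1| < d.
  rewrite sub0r normrN gtr0_norm ?invr_gt0 // -[ltRHS]invrK ltf_pV2 ?posrE ?invr_gt0 //.
  apply: lt_le_trans (archi_boundP _) _; first by rewrite invr_ge0 ltW.
  by rewrite ler_nat /n -addnS leq_addr.
have nl : l2 / l1 <= n%:R.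
  apply: le_trans (ltW (archi_boundP _)) _; first by rewrite divr_ge0 // ltW.
  by rewrite ler_nat /n -addSn leq_addl.
have x0 : 0 <= n%:R * l1 / l2 by rewrite divr_ge0 ?mulr_ge0 // ltW.
pose m := Num.truncn (n%:R * l1 / l2).
have /andP[m1 m2] : (m%:R <= n%:R * l1 / l2 < m.+1%:R) by exact: truncn_itv.
exists n, m; split=> //; apply: lt_le_trans (hd _ nd) _.
have lm : l2 * m%:R <= n%:R * l1 by rewrite mulrC -ler_pdivlMr.
have q0 : 0 <= q%:R :> R by [].
have D1 : 0 < l1 * (n + 2 * q)%:R + l2 * (m + 2 * q)%:R.
  by rewrite ltr_pwDl ?mulr_ge0 ?(ltW l20) // mulr_gt0 // ltr0n addn_gt0.
have D2 : l1 * (n + 2 * q)%:R + l2 * (m + 2 * q)%:R <= 2 * l1 * n%:R + a.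
  have e k : (k + 2 * q)%:R = k%:R + 2 * q%:R :> R by rewrite natrD natrM.
  by rewrite /a !e; lra.
have D3 : 0 < 2 * l1 * n%:R + a by apply: lt_le_trans D2.
have -> : F n%:R^-1 = N * n%:R * (n%:R * l1 / l2 - 1) * 2 / (2 * l1 * n%:R + a) ^+ 2.
  by rewrite /F; field; rewrite nn l2n lt0r_neq0 //= mulrC.
have mm : n%:R * l1 / l2 - 1 <= m%:R by move: m2; rewrite -natr1; lra.
have p0 : 0 <= n%:R * l1 / l2 - 1.
  rewrite subr_ge0 ler_pdivlMr // mul1r; move: nl; rewrite ler_pdivrMr //.
move: (n%:R * l1 / l2 - 1) mm p0 => k mm p0.
rewrite -!mulrA in D2 D3 *; rewrite ler_wpM2l // ler_wpM2l ?(ltW n0) //.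
apply: ler_pM => //; first by rewrite mulr_ge0 // invr_ge0 sqr_ge0.
rewrite ler_pM2l // lef_pV2 ?posrE ?exprn_gt0 //.
by rewrite lerXn2r ?nnegrE ?(ltW D1) ?(ltW D3).
Qed.

Lemma le_ereal_of_lt (x : \bar R) (r : R) : (forall v, v < r -> (v%:E <= x)%E) -> (r%:E <= x)%E.
Proof.
move=> h; case: x h => [y h| h|h]; last 2 first.
- by rewrite leey.
- by have := h (r - 1) ltac:(lra).
rewrite lee_fin leNgt; apply/negP => yr.
by have := h ((y + r) / 2) ltac:(lra); rewrite lee_fin; lra.
Qed.

End LowerBoundLimit.

Section IDeltaBound.
Variables (R : realType) (g : nat) (X : hyperbolic_surface R g).

Lemma I_Delta_ge (N l1 l2 : R) (q : nat) : 0 < l1 -> 0 < l2 -> 0 <= N ->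
  (forall n m : nat, exists c : closed_geodesic X,
    geod_length c <= l1 * (n + 2 * q)%:R + l2 * (m + 2 * q)%:R /\
    ((N * n%:R * m%:R * 2)%:E <= geom_intersection c c)%E) ->
  ((N / (2 * (l1 * l2)))%:E <= I_Delta X)%E.
Proof.
move=> l10 l20 N0 h; apply: le_ereal_of_lt => v hv.
have [n [m [n0 vl]]] := sequence_lower_bound q l10 l20 N0 hv.
have [c [cl ci]] := h n m; have L0 := geod_length_gt0 c.
apply: le_ereal_sup_tmp; exists (geom_intersection c c * ((geod_length c ^+ 2)^-1)%:E)%E; first by exists c.
apply: (@le_trans _ _ ((N * n%:R * m%:R * 2)%:E * ((geod_length c ^+ 2)^-1)%:E)%E); last first.
  by rewrite lee_wpmul2r // lee_fin invr_ge0 sqr_ge0.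
rewrite -EFinM lee_fin; apply: (le_trans (ltW vl)).
have D1 : 0 < l1 * (n + 2 * q)%:R + l2 * (m + 2 * q)%:R.
  by rewrite ltr_pwDl ?mulr_ge0 ?(ltW l20) // mulr_gt0 // ltr0n addn_gt0 n0.
rewrite ler_wpM2l ?mulr_ge0 // lef_pV2 ?posrE ?exprn_gt0 //.
by rewrite lerXn2r ?nnegrE ?(ltW L0) ?(ltW D1).
Qed.

End IDeltaBound.

(** * Transversality of geodesics *)

Section PairDerivative.
Variable R : realType.

Lemma is_derive_pair (f1 f2 : R -> R) (t d1 d2 : R) :
  is_derive t 1 f1 d1 -> is_derive t 1 f2 d2 ->
  is_derive t (1 : R) (fun u => (f1 u, f2 u) : R * R) (d1, d2).
Proof.
move=> [c1 e1] [c2 e2].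
have l1 : (fun h : R => h^-1 *: ((f1 \o shift t) (h *: (1 : R)) - f1 t)) @ 0^' --> d1.
  by rewrite -e1; exact: c1.
have l2 : (fun h : R => h^-1 *: ((f2 \o shift t) (h *: (1 : R)) - f2 t)) @ 0^' --> d2.
  by rewrite -e2; exact: c2.
have l12 := cvg_pair l1 l2.
have lim12 : (fun h : R => h^-1 *: (((fun u => (f1 u, f2 u) : R * R) \o shift t) (h *: (1 : R)) - (f1 t, f2 t))) @ 0^' --> (d1, d2).
  exact: l12.
split; first by apply/cvg_ex; exists (d1, d2).
by apply/cvg_lim => //; exact: norm_hausdorff.
Qed.

Lemma is_derive_axis_scale (l t : R) : is_derive t 1 (fun u => expR (l * u)) (l * expR (l * t)).
Proof.
have h : is_derive t 1 (fun u : R => l * u) l.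
  have h0 := is_deriveZ l (is_derive_id t (1 : R)).
  by apply: (is_derive_eq h0); rewrite /GRing.scale /= mulr1.
have := @is_derive1_comp R expR (fun u => l * u) t (expR (l * t)) l (is_derive_expR _) h.
by move=> k; apply: (is_derive_eq k); rewrite mulrC.
Qed.

(** With y = e^(l t), the complex number l i y / (d + i c y)^2, written in real coordinates. *)
Definition line_velocity (M : mat R) (l t : R) : R * R :=
  let y := expR (l * t) in let q := m22 M ^+ 2 + m21 M ^+ 2 * y ^+ 2 in
  (l * (2 * (m21 M * m22 M) * y ^+ 2 / q ^+ 2), l * (y * (m22 M ^+ 2 - m21 M ^+ 2 * y ^+ 2) / q ^+ 2)).

Lemma is_derive_line (M : mat R) (l t : R) : mdet M = 1 ->
  is_derive t (1 : R) (fun u => act M (axis (l * u))) (line_velocity M l t).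
Proof.
move=> hM; case: M hM => a b c d hM; rewrite /mdet /= in hM.
pose E u := expR (l * u).
pose q u := d ^+ 2 + c ^+ 2 * E u ^+ 2.
have q0 u : q u != 0 by have [] := act_axis (l * u) (hM : mdet (Mat a b c d) = 1).
have -> : (fun u => act (Mat a b c d) (axis (l * u))) =
    (fun u => ((b * d + a * c * E u ^+ 2) * (q u)^-1, E u * (q u)^-1)).
  by apply/funext => u; have [_ ->] := act_axis (l * u) (hM : mdet (Mat a b c d) = 1).
have dE := is_derive_axis_scale l t : is_derive t 1 E (l * E t).
have dE2 : is_derive t 1 (fun u => E u ^+ 2) (2 * l * E t ^+ 2).
  have k := is_deriveM dE dE.
  by apply: (is_derive_eq k); rewrite /GRing.scale /=; ring.
have dq : is_derive t 1 q (c ^+ 2 * (2 * l * E t ^+ 2)).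
  have k := is_deriveD (is_derive_cst (d ^+ 2) t (1 : R)) (is_deriveZ (c ^+ 2) dE2).
  by apply: (is_derive_eq k); rewrite /GRing.scale /= add0r.
have dn : is_derive t 1 (fun u => b * d + a * c * E u ^+ 2) (a * c * (2 * l * E t ^+ 2)).
  have k := is_deriveD (is_derive_cst (b * d) t (1 : R)) (is_deriveZ (a * c) dE2).
  by apply: (is_derive_eq k); rewrite /GRing.scale /= add0r.
have dqi := is_deriveV (q0 t) dq.
have k1 := is_deriveM dn dqi; have k2 := is_deriveM dE dqi.
have {}q0 := q0 t.
apply: is_derive_pair.
  apply: (is_derive_eq k1); rewrite /GRing.scale /= -/(E t) -/(q t).
  transitivity (l * (2 * (c * d) * (a * d - b * c) * E t ^+ 2 / q t ^+ 2)); last by rewrite hM mulr1.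
  by move: q0; rewrite /q => q0; field; rewrite exprMn.
apply: (is_derive_eq k2); rewrite /GRing.scale /= -/(E t) -/(q t).
by move: q0; rewrite /q => q0; field; rewrite exprMn.
Qed.

Lemma line_velocity_continuous (M : mat R) (l t : R) : mdet M = 1 ->
  line_velocity M l u @[u --> t] --> line_velocity M l t.
Proof.
move=> hM; have [q0 _] := act_axis (l * t) hM.
have q2 : (m22 M ^+ 2 + m21 M ^+ 2 * expR (l * t) ^+ 2) ^+ 2 != 0 by rewrite expf_neq0.
have ec : expR (l * u) @[u --> t] --> expR (l * t).
  have lt : l * u @[u --> t] --> l * t by apply: lim_mul; [exact: lim_cst|exact: cvg_id].
  by apply: (cvg_comp _ _ lt); exact: continuous_expR.
by rewrite /line_velocity /=; lims.
Qed.

(** Real and imaginary parts of a i y + b = i y' (c i y + d), where y = e^t and y' = e^s. *)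
Lemma axis_to_axis (K : mat R) (s t : R) : mdet K = 1 -> axis s = act K (axis t) ->
  m12 K = - m21 K * (expR s * expR t) /\ m11 K * expR t = m22 K * expR s.
Proof.
move=> hK; have [q0 ->] := act_axis t hK; case: K hK q0 => a b c d; rewrite /mdet /= => h.
set q := d ^+ 2 + _ => q0; have t0 := lt0r_neq0 (expR_gt0 t).
case=> /esym/eqP; rewrite mulf_eq0 invr_eq0 (negPf q0) orbF => /eqP e1 e2.
have e3 : expR s * q = expR t by rewrite e2 mulfVK.
split; apply: (mulIf q0).
  transitivity (d * (b * d + a * c * expR t ^+ 2) - c * (a * d - b * c) * expR t ^+ 2); first by rewrite /q; ring.
  rewrite e1 h; transitivity (- c * expR t * (expR s * q)); last by ring.
  by rewrite e3; ring.
transitivity (expR t * (d * (a * d - b * c) + c * (b * d + a * c * expR t ^+ 2))); first by rewrite /q; ring.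
by rewrite e1 h -[RHS]mulrA e3; ring.
Qed.

(* In the complex notation [w = d + i c y], the derivative of [M] at [i y] is
   [w ^ -2]; the cross product of two velocities is an imaginary part. *)
Lemma crossing_velocities (M K : mat R) (l1 l2 s t : R) : mdet M = 1 -> mdet K = 1 ->
  0 < m11 K * m22 K < 1 -> l1 != 0 -> l2 != 0 -> axis (l1 * s) = act K (axis (l2 * t)) ->
  let v := line_velocity M l1 s in let w := line_velocity (mmul M K) l2 t in
  v.1 * w.2 - v.2 * w.1 != 0.
Proof.
move=> hM hK ad l10 l20 e; have [e1 e2] := axis_to_axis hK e.
have [q1 _] := act_axis (l1 * s) hM; have [q2 _] := act_axis (l2 * t) (mdet1_mul hM hK).
have /andP[ad0 ad1] := ad.
have c0 : m21 K != 0.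
  apply: contraTneq ad1 => c0; move: hK; rewrite /mdet c0 mulr0 subr0 => ->; by rewrite ltxx.
have d0 : m22 K != 0 by apply: contraTneq ad0 => ->; rewrite mulr0 ltxx.
rewrite /line_velocity; move: q1 q2; cbv zeta.
have y0 := lt0r_neq0 (expR_gt0 (l1 * s)); have z0 := lt0r_neq0 (expR_gt0 (l2 * t)).
move: y0 z0 e1 e2; move: (expR (l1 * s)) (expR (l2 * t)) => y z y0 z0 e1 e2.
set Q1 := _ + _ => q1; set Q2 := _ + _ => q2; rewrite [_.1]/= [_.2]/= [_.1]/= [_.2]/=.
set c := m21 M in Q1 q1 *; set d := m22 M in Q1 q1 *.
set c2 := m21 (mmul M K) in Q2 q2 *; set d2 := m22 (mmul M K) in Q2 q2 *.
have d2E : d2 = d * m22 K - c * m21 K * (y * z) by rewrite /d2 /= e1 /c /d; ring.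
have c2E : c2 * z = c * m22 K * y + d * m21 K * z.
  by rewrite /c2 /= -/c -/d mulrDl -!mulrA e2; ring.
have i1 : c * y * d2 - c2 * z * d = - (m21 K * z) * Q1 by rewrite c2E d2E /Q1; ring.
have i2 : d * d2 + c * y * (c2 * z) = m22 K * Q1 by rewrite c2E d2E /Q1; ring.
have -> : l1 * (2 * (c * d) * y ^+ 2 / Q1 ^+ 2) * (l2 * (z * (d2 ^+ 2 - c2 ^+ 2 * z ^+ 2) / Q2 ^+ 2)) -
  l1 * (y * (d ^+ 2 - c ^+ 2 * y ^+ 2) / Q1 ^+ 2) * (l2 * (2 * (c2 * d2) * z ^+ 2 / Q2 ^+ 2)) =
  2 * l1 * l2 * y * z * ((c * y * d2 - c2 * z * d) * (d * d2 + c * y * (c2 * z))) / (Q1 ^+ 2 * Q2 ^+ 2).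
  by field; rewrite q1 q2.
rewrite i1 i2.
have n2 : (2 : R) != 0 by rewrite pnatr_eq0.
by rewrite !mulf_neq0 // ?oppr_eq0 ?invr_eq0 ?mulf_neq0 // ?expf_neq0.
Qed.

End PairDerivative.

Section GeodesicsC1.
Variables (R : realType) (g : nat) (X : hyperbolic_surface R g).
Variable p : R * R -> X.
Hypothesis hp : covering p.

Lemma line_chart_velocity (N : mat R) (l t : R) phi M : mdet (mmul M N) = 1 ->
  (\forall u \near l * t, chart_map phi (p (act N (axis u))) = act (mmul M N) (axis u)) ->
  derivable (chart_map phi \o (fun u => p (act N (axis (l * u))))) t 1 /\
  derive1 (chart_map phi \o (fun u => p (act N (axis (l * u))))) t = line_velocity (mmul M N) l t.
Proof.
move=> hMN nb; have lc : l * u @[u --> t] --> l * t.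
  by apply: lim_mul; [exact: lim_cst|exact: cvg_id].
have nb' : \forall u \near t, act (mmul M N) (axis (l * u)) =
    (chart_map phi \o (fun u => p (act N (axis (l * u))))) u.
  have h : \forall u \near t, chart_map phi (p (act N (axis (l * u)))) = act (mmul M N) (axis (l * u)).
    exact: (lc _ nb).
  by apply: filterS h => u.
have [h1 h2] := near_eq_is_derive nb' (is_derive_line l t hMN).
split; first exact: h1.
by rewrite derive1E.
Qed.

(** Makes closed geodesics themselves admissible among the representatives over which the
    intersection number is minimised. *)
Lemma line_C1 (N : mat R) (l : R) : mdet N = 1 ->
  C1_curve (fun u => p (act N (axis (l * u)))).
Proof.
move=> hN phi t aphi d.
have [M hM /nbhs_interior nb] := line_chart hp hN aphi d.
have hMN := mdet1_mul hM hN.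
have lc : l * u @[u --> t] --> l * t.
  by apply: lim_mul; [exact: lim_cst|exact: cvg_id].
have nb' : \forall u \near t, derivable (chart_map phi \o (fun u => p (act N (axis (l * u))))) u 1 /\
    derive1 (chart_map phi \o (fun u => p (act N (axis (l * u))))) u = line_velocity (mmul M N) l u.
  have h : \forall u \near t, \forall v \near l * u, chart_dom phi (p (act N (axis v))) /\
      chart_map phi (p (act N (axis v))) = act (mmul M N) (axis v) by exact: (lc _ nb).
  apply: filterS h => u hu; apply: line_chart_velocity => //.
  by apply: filterS hu => v [].
have [h1 h2] := nbhs_singleton nb'; split; first exact: h1.
apply: (@near_eq_continuous _ _ (line_velocity (mmul M N) l)).
  by apply: filterS nb' => u [_ ->].
exact: line_velocity_continuous.
Qed.

End GeodesicsC1.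

Lemma injection_of_card_le (T : Type) (U : pointedType) (A : set T) (B : set U) :
  (A #<= B)%card -> exists2 f : T -> U, {in A &, injective f} & forall i, A i -> B (f i).
Proof.
move=> /pcard_leP[f]; exists f; first exact: inj.
by move=> i Ai; apply: funS.
Qed.

(** * Pairs of geodesics that only cross *)

Section CrossingCase.
Variables (R : realType) (g : nat) (X : hyperbolic_surface R g).
Implicit Types (c : closed_geodesic X) (s t u : R).

Lemma geodesic_covering c : exists2 p, covering p & forall u, p (axis u) = geod_map c u.
Proof.
have [p p0 hp] := covering_exists (geod_map c 0).
have [|N hN pN] := geodesic_lift hp (geod_geodesic c).
  by exists (0, 1); rewrite //= ltr01.
exists (p \o act N) => // z z0.
exact: covering_act.
Qed.

Lemma geod_curve_closed c : closed_curve (geod_curve c).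
Proof.
split=> t; last by rewrite /geod_curve mulrDr mulr1 geod_periodic.
have [cc _] := geod_geodesic c.
have lt : geod_length c * u @[u --> t] --> geod_length c * t.
  by apply: lim_mul; [exact: lim_cst|exact: cvg_id].
by apply: (cvg_comp _ _ lt); exact: cc.
Qed.

Lemma homotopic_refl (alpha : R -> X) : closed_curve alpha -> homotopic alpha alpha.
Proof.
move=> [ac ap]; exists (alpha \o snd); split=> //.
  apply: continuous_subspaceT => z.
  by apply: (@cvg_comp _ _ _ snd alpha (nbhs z) (nbhs z.2)); [exact: cvg_snd|exact: ac].
by move=> u t _ /=; rewrite ap.
Qed.

Lemma geod_curve_C1 c : C1_closed_curve (geod_curve c).
Proof.
split; first exact: geod_curve_closed.
have [p hp pc] := geodesic_covering c.
have -> : geod_curve c = fun u => p (act (mone R) (axis (geod_length c * u))).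
  by apply/funext => u; rewrite act_one pc.
exact: (@line_C1 _ _ _ p hp (mone R) (geod_length c) (mdet_one R)).
Qed.

Lemma geom_intersection_ge0 c c' : (0 <= geom_intersection c c')%E.
Proof. by apply: le_ereal_inf_tmp => _ [n _ <-]; rewrite lee_fin. Qed.

Lemma I_Delta_ge0 c : (0 <= I_Delta X)%E.
Proof.
apply: le_ereal_sup_tmp; exists (geom_intersection c c * ((geod_length c ^+ 2)^-1)%:E)%E.
  by exists c.
by rewrite mule_ge0 ?geom_intersection_ge0 // lee_fin invr_ge0 sqr_ge0.
Qed.

Lemma geodesic_deck c p : covering p -> (forall u, p (axis u) = geod_map c u) ->
  deck p (diagm (geod_length c)).
Proof.
move=> hp pc.
have h : forall t, p (act (mone R) (axis t)) = p (act (diagm (geod_length c)) (axis t)).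
  by move=> t; rewrite act_one act_diagm_axis !pc addrC geod_periodic.
have := deck_of_lines hp (mdet_one R) (mdet_diagm _) h.
suff -> : madj (mone R) = mone R by rewrite mmul1.
by apply: matP; rewrite /= ?oppr0.
Qed.

Variables c1 c2 : closed_geodesic X.
Let l1 := geod_length c1.
Let l2 := geod_length c2.
Variables p q : R * R -> X.
Hypotheses (hp : covering p) (hq : covering q)
  (pc : forall u, p (axis u) = geod_map c1 u) (qc : forall u, q (axis u) = geod_map c2 u).

(** At a meeting of the geodesics, [K] places the line of [c2] in the plane over which [p] develops
    [c1]. *)
Definition meeting_frame s t (K : mat R) := [/\ mdet K = 1,
  forall z, 0 < z.2 -> p (act K z) = q z & act K (axis (l2 * t)) = axis (l1 * s)].

Lemma meeting_frame_exists s t : geod_curve c1 s = geod_curve c2 t ->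
  exists K, meeting_frame s t K.
Proof.
move=> e; have e' : q (axis (l2 * t)) = p (axis (l1 * s)) by rewrite pc qc; exact: esym.
by have [K [hK pK] eK] := covering_transitive hq hp (axis_gt0 _) (axis_gt0 _) e'; exists K.
Qed.

Definition all_crossing := forall s t K, meeting_frame s t K -> 0 < m11 K * m22 K < 1.

Hypothesis allX : all_crossing.

Lemma l1_gt0 : 0 < l1. Proof. exact: geod_length_gt0. Qed.
Lemma l2_gt0 : 0 < l2. Proof. exact: geod_length_gt0. Qed.

Lemma crossing_family_bound (n : nat) (f : 'I_n -> R * R) : injective f ->
  (forall i, intersections (geod_curve c1) (geod_curve c2) (f i)) -> (0 < n)%N ->
  ((n%:R / (2 * (l1 * l2)))%:E <= I_Delta X)%E.
Proof.
move=> finj fA n0.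
have /choice[K hK] : forall i, exists K, meeting_frame (f i).1 (f i).2 K.
  by move=> i; apply: meeting_frame_exists; have [] := fA i.
have hK1 i : mdet (K i) = 1 by have [] := hK i.
pose k0 := Ordinal n0.
have d1 := geodesic_deck hp pc; have d2 := geodesic_deck hq qc.
have d2' : deck (p \o act (K k0)) (diagm l2).
  have [h1 h2] := d2; split; first exact: mdet_diagm.
  move=> z z0; have [_ pK _] := hK k0.
  by rewrite /= !pK ?h2 // act_gt0 // mdet_diagm.
have dK k : deck p (mmul (K k) (madj (K k0))).
  have h1 := mdet1_adj (hK1 k0); split; first exact: mdet1_mul.
  move=> z z0; have w0 := act_gt0 h1 z0.
  have [_ pK _] := hK k; have [_ pK0 _] := hK k0.
  by rewrite act_mul // pK // -pK0 // actVK.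
have [|||||q0 hq0] := crossing_lower_bound hp l1_gt0 l2_gt0 hK1 _ _ _ _ _ d1 d2' dK
  (s := fun i => (f i).1) (t := fun i => (f i).2).
- by move=> i; exact: allX (hK i).
- by move=> i; have [h1 _ _] := fA i.
- by move=> i; have [_ h2 _] := fA i.
- by move=> i j e1 e2; apply: finj; rewrite [f i]surjective_pairing e1 e2 -surjective_pairing.
- by move=> i; have [] := hK i.
apply: (I_Delta_ge l1_gt0 l2_gt0 _ (q := q0)); first by [].
move=> a b; have [c [h1 h2]] := hq0 a b; exists c; split=> //.
by move: h2; rewrite card_ord !natrM.
Qed.

Lemma crossing_transversal : transversal_curves (geod_curve c1) (geod_curve c2).
Proof.
move=> phi s t aphi d e.
have [K hK] := meeting_frame_exists e; have ad := allX hK.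
have [dK pK eK] := hK.
have c1E : geod_curve c1 = fun u => p (act (mone R) (axis (l1 * u))).
  by apply/funext => u; rewrite act_one pc.
have c2E : geod_curve c2 = fun u => p (act K (axis (l2 * u))).
  by apply/funext => u; rewrite pK ?axis_gt0 // qc.
have z0 := axis_gt0 (R := R) (l1 * s).
have [M hM gM] : exists2 M, mdet M = 1 & chart_germ phi M (axis (l1 * s)) p.
  by apply: hloc_chart => //; [exact: hp|rewrite pc].
have nb N u : mdet N = 1 -> act N (axis u) = axis (l1 * s) -> \forall v \near u,
    chart_map phi (p (act N (axis v))) = act (mmul M N) (axis v).
  move=> hN eN; have h : \forall v \near u, chart_dom phi (p (act N (axis v))) /\
      chart_map phi (p (act N (axis v))) = act M (act N (axis v)).
    by have := @line_continuous R N u hN; rewrite eN => /(_ _ gM).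
  by apply: filterS h => v [_ ->]; rewrite act_mul // axis_gt0.
have h1 := mdet_one R.
have [_ v1] := line_chart_velocity (l := l1) (t := s) (mdet1_mul hM h1) (nb _ _ h1 (act_one _)).
have [_ v2] := line_chart_velocity (l := l2) (t := t) (mdet1_mul hM dK) (nb _ _ dK eK).
rewrite c1E c2E v1 v2 mmul1.
by apply: crossing_velocities => //; rewrite gt_eqF // ?l1_gt0 ?l2_gt0.
Qed.

(** Being transversal, the geodesics compete in the infimum, so the intersection number is at most
    the number of their meetings, and that number is what the lower bound for [I_Delta] involves. *)
Lemma crossing_pair_le : (geom_intersection c1 c2 * ((l1 * l2)^-1)%:E <= 2%:E * I_Delta X)%E.
Proof.
have l12 : 0 < l1 * l2 by rewrite mulr_gt0 ?l1_gt0 ?l2_gt0.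
pose A := intersections (geod_curve c1) (geod_curve c2).
have D0 := I_Delta_ge0 c1.
have bnd n (f : nat -> R * R) : {in `I_n &, injective f} -> (forall i, (i < n)%N -> A (f i)) ->
    ((n%:R / (2 * (l1 * l2)))%:E <= I_Delta X)%E.
  move=> finj fA; have [->|n0] := posnP n; first by rewrite mul0r.
  apply: (@crossing_family_bound n (fun i => f i)) => // [i j e|i]; last exact: fA.
  by apply: val_inj; apply: finj => //; rewrite inE /=.
have [finA|infA] := pselect (finite_set A); last first.
  (* Infinitely many meetings contain families of any finite size, so the bound makes [I_Delta]
     infinite. *)
  suff -> : I_Delta X = +oo%E by rewrite gt0_muley ?leey // lte_fin.
  have [f finj fA] := injection_of_card_le ((infiniteP _).1 infA).
  apply/eqyP => r r0.
  pose n := Num.bound (r * (2 * (l1 * l2))).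
  have f_inj : {in `I_n &, injective f} by move=> i j _ _; apply: finj; rewrite inE.
  apply: le_trans (bnd n f f_inj _); last by move=> i _; exact: fA.
  rewrite lee_fin ler_pdivlMr; last by rewrite mulr_gt0.
  apply: ltW; apply: archi_boundP.
  by rewrite mulr_ge0 ?(ltW r0) // mulr_ge0 // ltW.
have [n An] := finA.
have i_le : (geom_intersection c1 c2 <= n%:R%:E)%E.
  apply: ereal_inf_lbound; exists n => //; exists (geod_curve c1), (geod_curve c2).
  by split=> //; [split; [exact: geod_curve_C1|apply: homotopic_refl; exact: geod_curve_closed]
    |split; [exact: geod_curve_C1|apply: homotopic_refl; exact: geod_curve_closed]
    |exact: crossing_transversal].
have [f finj fA] : exists2 f : nat -> R * R, {in `I_n &, injective f} & forall i, (i < n)%N -> A (f i).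
  by apply: injection_of_card_le; have /card_eqPle[] := An.
have h := bnd n f finj fA.
apply: (@le_trans _ _ (n%:R%:E * ((l1 * l2)^-1)%:E)%E).
  by rewrite lee_wpmul2r // lee_fin invr_ge0 ltW.
rewrite -EFinM; have -> : n%:R / (l1 * l2) = 2 * (n%:R / (2 * (l1 * l2))).
  by field; rewrite !gt_eqF ?l1_gt0 ?l2_gt0.
by rewrite EFinM lee_wpmul2l.
Qed.

End CrossingCase.

(** * Geodesics with the same image *)

Section Reparametrization.
Variables (R : realType) (g : nat) (X : hyperbolic_surface R g).
Implicit Types (alpha beta : R -> X) (k : int) (r s t : R).

(** The |k|-fold multiple of a closed curve, reversed when k is negative, with its starting point
    moved; an integer [k] preserves period 1. *)
Definition reparam k r alpha t := alpha (k%:~R * t + r).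

Lemma affine_continuous k r t : (k%:~R : R) * u + r @[u --> t] --> k%:~R * t + r.
Proof. by lims. Qed.

Lemma closed_curve_int alpha : closed_curve alpha -> forall k t, alpha (t + k%:~R) = alpha t.
Proof. by move=> [_ ap] k t; have := periodic_int ap k t; rewrite mul1r. Qed.

Lemma reparam_closed k r alpha : closed_curve alpha -> closed_curve (reparam k r alpha).
Proof.
move=> ca; have [ac _] := ca; split=> t.
  by apply: (cvg_comp _ _ (@affine_continuous k r t)); exact: ac.
by rewrite /reparam mulrDr mulr1 addrAC closed_curve_int.
Qed.

Lemma reparam_homotopic k r alpha beta : homotopic alpha beta ->
  homotopic (reparam k r alpha) (reparam k r beta).
Proof.
move=> [H [Hc Hp H0 H1]]; exists (fun z => H (z.1, k%:~R * z.2 + r)); split.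
- apply/subspace_continuousP => z /= Az.
  have hz := (subspace_continuousP _ _).1 Hc (z.1, k%:~R * z.2 + r) Az.
  have lz : (w.1, (k%:~R : R) * w.2 + r) @[w --> z] --> (z.1, k%:~R * z.2 + r).
    have c1 : w.1 @[w --> z] --> z.1 by exact: cvg_fst.
    have c2 : w.2 @[w --> z] --> z.2 by exact: cvg_snd.
    by lims.
  move=> B /hz hB; have h : \forall w \near z, 0 <= w.1 <= 1 -> B (H (w.1, k%:~R * w.2 + r)).
    exact: (lz _ hB).
  exact: h.
- move=> u t u01 /=; rewrite mulrDr mulr1 addrAC.
  have hu v : H (u, v + 1) = H (u, v) by exact: Hp.
  by have := periodic_int hu k (k%:~R * t + r); rewrite mul1r.
- by move=> t; rewrite H0.
- by move=> t; rewrite H1.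
Qed.

Lemma is_derive_affine k r (f : R -> R * R) t : derivable f (k%:~R * t + r) 1 ->
  is_derive t (1 : R) (fun u => f (k%:~R * u + r)) (k%:~R *: derive1 f (k%:~R * t + r)).
Proof.
move=> df; pose a u : R := k%:~R * u + r.
have da : is_derive t (1 : R) a k%:~R.
  have h := is_deriveD (is_deriveZ k%:~R (is_derive_id t (1 : R))) (is_derive_cst r t (1 : R)).
  by apply: (is_derive_eq h); rewrite /GRing.scale /= mulr1 addr0.
have Da : differentiable a t by apply/derivable1_diffP; have [] := da.
have Df : differentiable f (a t) by apply/derivable1_diffP.
have D : differentiable (f \o a) t by exact: differentiable_comp.
split; first by apply/derivable1_diffP.
rewrite -derive1E (derive1E' D) diff_comp // (diff1E Df) /= -(derive1E' Da).
by rewrite derive1E; have [_ ->] := da.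
Qed.

Lemma reparam_velocity k r alpha phi t : C1_curve alpha -> atlas phi ->
  chart_dom phi (reparam k r alpha t) ->
  derivable (chart_map phi \o reparam k r alpha) t 1 /\
  derive1 (chart_map phi \o reparam k r alpha) t =
    k%:~R *: derive1 (chart_map phi \o alpha) (k%:~R * t + r).
Proof.
move=> ac aphi d; have [h _] := ac phi (k%:~R * t + r) aphi d.
have [h1 h2] := is_derive_affine h; split; first exact: h1.
by rewrite derive1E.
Qed.

Lemma reparam_C1 k r alpha : C1_closed_curve alpha -> C1_closed_curve (reparam k r alpha).
Proof.
move=> [ca ac]; have cr := reparam_closed k r ca; split=> // phi t aphi d.
have [h1 h2] := reparam_velocity ac aphi d; split; first exact: h1.
have domO := atlas_open aphi.
have nb : \forall u \near t, k%:~R *: derive1 (chart_map phi \o alpha) (k%:~R * u + r) =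
    derive1 (chart_map phi \o reparam k r alpha) u.
  have h : \forall u \near t, chart_dom phi (reparam k r alpha u).
    have [cc _] := cr; apply: (cc t); exact: open_nbhs_nbhs.
  apply: filterS h => u du.
  have [_ e] := reparam_velocity ac aphi du; exact: esym e.
apply: (near_eq_continuous nb).
have [_ c1] := ac phi (k%:~R * t + r) aphi d.
apply: cvgZr; exact: (cvg_comp _ _ (@affine_continuous k r t) c1).
Qed.

Lemma reparam_transversal k k' r r' alpha beta : k != 0 -> k' != 0 ->
  C1_curve alpha -> C1_curve beta -> transversal_curves alpha beta ->
  transversal_curves (reparam k r alpha) (reparam k' r' beta).
Proof.
move=> k0 k'0 ac bc ab phi s t aphi d e.
have [_ ->] := reparam_velocity ac aphi d.
rewrite e in d; have [_ ->] := reparam_velocity bc aphi d.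
have := ab phi (k%:~R * s + r) (k'%:~R * t + r') aphi; rewrite -/(reparam k r alpha s) e.
move=> /(_ d erefl).
move: (derive1 _ _) (derive1 _ _) => [w1 w2] [v1 v2] /= vw.
rewrite /=.
rewrite [X in X != 0](_ : _ = k%:~R * k'%:~R * (v1 * w2 - v2 * w1)); last first.
  by rewrite /GRing.scale /=; ring.
by rewrite !mulf_neq0 // intr_eq0.
Qed.

Definition frac r : R := r - (Num.floor r)%:~R.

(** The map t -> k t + r of the circle takes each value |k| times, and the integer part modulo k
    numbers these preimages. *)
Lemma frac_mod_inj k r s t : k != 0 -> 0 <= s < 1 -> 0 <= t < 1 ->
  frac (k%:~R * s + r) = frac (k%:~R * t + r) ->
  `|(Num.floor (k%:~R * s + r) %% k)%Z|%N = `|(Num.floor (k%:~R * t + r) %% k)%Z|%N -> s = t.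
Proof.
move=> k0 s01 t01; rewrite /frac.
move: (Num.floor _) (Num.floor _) => n m e em.
have {em} : (m %% k)%Z = (n %% k)%Z.
  by rewrite -[LHS]gez0_abs ?modz_ge0 // -[RHS]gez0_abs ?modz_ge0 // em.
move=> /eqP; rewrite eqz_mod_dvd => /dvdzP[j ej].
have kr : (k%:~R : R) != 0 by rewrite intr_eq0.
have est : s - t = j%:~R.
  apply: (mulfI kr); transitivity ((m - n)%:~R : R).
    by rewrite intrB mulrBr; lra.
  by rewrite ej intrM mulrC.
have : j%:~R = 0%:~R :> R.
  congr (_%:~R); have : (-1 < j%:~R :> R) /\ (j%:~R < 1 :> R) by rewrite -est; lra.
  by rewrite -[-1]/((-1)%:~R) -[1]/(1%:~R) !ltr_int; lia.
by rewrite -est => /eqP; rewrite subr_eq0 => /eqP.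
Qed.

Lemma card_le_injection (T U : Type) (A : set T) (B : set U) (f : T -> U) :
  {in A &, injective f} -> (forall x, A x -> B (f x)) -> (A #<= B)%card.
Proof.
move=> finj fA; rewrite -(card_le_eql (inj_card_eq finj)).
by apply: subset_card_le => _ [x Ax <-]; exact: fA.
Qed.

(** Each old intersection accounts for at most |k| |k'| new ones. Its number and the two preimage
    numbers are coded in mixed radix as one natural number. *)
Lemma reparam_intersections k k' r r' alpha beta n : k != 0 -> k' != 0 ->
  closed_curve alpha -> closed_curve beta -> (intersections alpha beta #= `I_n)%card ->
  exists2 m, (m <= n * (`|k| * `|k'|))%N &
    (intersections (reparam k r alpha) (reparam k' r' beta) #= `I_m)%card.
Proof.
move=> k0 k'0 ca cb hn; set B := intersections (reparam _ _ _) _.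
have [f finj fA] : exists2 f : R * R -> nat, {in intersections alpha beta &, injective f} &
    forall z, intersections alpha beta z -> (f z < n)%N.
  have /card_eqPle[h _] := hn; have [f f1 f2] := injection_of_card_le h; by exists f.
pose F z := (frac (k%:~R * z.1 + r), frac (k'%:~R * z.2 + r')).
have BF z : B z -> intersections alpha beta (F z).
  move=> [z1 z2 e]; split; try exact: frac_itv.
  by rewrite /F /frac /= -!mulrNz !closed_curve_int.
pose d (z : R * R) := `|(Num.floor (k%:~R * z.1 + r) %% k)%Z|%N.
pose d' (z : R * R) := `|(Num.floor (k'%:~R * z.2 + r') %% k')%Z|%N.
have dk z : (d z < `|k|)%N.
  rewrite /d; move: (Num.floor _) => u.
  by have := modz_ge0 u k0; have := ltz_mod u k0; lia.
have dk' z : (d' z < `|k'|)%N.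
  rewrite /d'; move: (Num.floor _) => u.
  by have := modz_ge0 u k'0; have := ltz_mod u k'0; lia.
have enc (a b a' b' c : nat) : (b < c)%N -> (b' < c)%N -> (a * c + b = a' * c + b')%N -> a = a' /\ b = b'.
  move=> bc b'c /[dup] /(congr1 (divn^~ c)) e1 /(congr1 (modn^~ c)); move: e1 => /=.
  have c0 : (0 < c)%N by exact: leq_ltn_trans bc.
  by rewrite !divnMDl // !modnMDl !divn_small // !modn_small // !addn0.
have encle (a b c n' : nat) : (a < n')%N -> (b < c)%N -> (a * c + b < n' * c)%N by nia.
have Ble : (B #<= `I_(n * (`|k| * `|k'|)))%card.
  apply: (@card_le_injection _ _ _ _ (fun z => (f (F z) * (`|k| * `|k'|) + (d z * `|k'| + d' z))%N)).
    move=> z w /set_mem Bz /set_mem Bw /enc[||e1 /enc[||e2 e3]] //; try exact: encle.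
    move/finj: e1 => /(_ (mem_set (BF _ Bz)) (mem_set (BF _ Bw))) [f1 f2].
    have [z1 z2 _] := Bz; have [w1 w2 _] := Bw.
    rewrite [z]surjective_pairing [w]surjective_pairing.
    congr (_, _); [exact: (frac_mod_inj k0 z1 w1 f1 e2)|exact: (frac_mod_inj k'0 z2 w2 f2 e3)].
  by move=> z Bz /=; apply: (encle); [exact: fA (BF _ Bz)|exact: (encle)].
have [m Bm] : finite_set B by exact: card_le_finite Ble (finite_II _).
exists m => //; rewrite -card_le_II.
by apply: card_le_trans Ble; have /card_eqPle[] := Bm.
Qed.

(** Reparametrising a pair of transversal representatives gives a pair of transversal
    representatives of the multiples. *)
Lemma intersection_number_reparam k k' r r' alpha beta : k != 0 -> k' != 0 ->
  (intersection_number (reparam k r alpha) (reparam k' r' beta) *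
    (((`|k| * `|k'|)%N%:R)^-1)%:E <= intersection_number alpha beta)%E.
Proof.
move=> k0 k'0; have K0 : 0 < (`|k| * `|k'|)%N%:R :> R by rewrite ltr0n muln_gt0 !absz_gt0 k0.
apply: le_ereal_inf_tmp => _ [n [a [b [[ac ha] [bc hb] ab hn]]] <-].
have [ca dca] := ac; have [cb dcb] := bc.
have [m mn hm] := reparam_intersections r r' k0 k'0 ca cb hn.
rewrite lee_pdivrMr // -EFinM -natrM.
apply: (@le_trans _ _ m%:R%:E); last by rewrite lee_fin ler_nat.
apply: ereal_inf_lbound; exists m => //; exists (reparam k r a), (reparam k' r' b).
split=> //.
- by split; [exact: reparam_C1|exact: reparam_homotopic].
- by split; [exact: reparam_C1|exact: reparam_homotopic].
- exact: reparam_transversal.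
Qed.

End Reparametrization.

(** Euclid's algorithm by subtraction; every step lowers x + y by at least [e], and [n] bounds the
    number of steps. *)
Lemma common_divisor (R : realType) (P : R -> Prop) (e x y : R) : 0 < e ->
  (forall u v, P u -> P v -> P (u - v)) -> (forall u, 0 < u -> P u -> e <= u) ->
  0 < x -> 0 < y -> P x -> P y -> exists d (a b : nat),
    [/\ 0 < d, P d, x = a%:R * d & y = b%:R * d].
Proof.
move=> e0 PB Pe x0 y0 Px Py.
have [n] : exists n : nat, x + y <= n%:R * e.
  exists (Num.bound ((x + y) / e)); rewrite -ler_pdivrMr //.
  by apply: ltW; apply: archi_boundP; rewrite divr_ge0 ?addr_ge0 // ltW.
elim: n x y x0 y0 Px Py => [|n IH] x y x0 y0 Px Py xy; first by lra.
have ex := Pe _ x0 Px; have ey := Pe _ y0 Py; rewrite -natr1 in xy.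
have [lt|lt|<-] := ltrgtP x y; last by exists x, 1%N, 1%N; split; rewrite ?mul1r.
  have [|||||d [a [b [d0 Pd xE yE]]]] := IH x (y - x) => //; [lra|exact: PB|lra|].
  by exists d, a, (a + b)%N; split=> //; rewrite natrD; lra.
have [|||||d [a [b [d0 Pd xE yE]]]] := IH (x - y) y => //; [lra|exact: PB|lra|].
by exists d, (a + b)%N, b; split=> //; rewrite natrD; lra.
Qed.

(** * Geodesics along one line, and the conclusion *)

Section SameLine.
Variables (R : realType) (g : nat) (X : hyperbolic_surface R g).
Implicit Types (c : closed_geodesic X) (s t u : R).

(** At a meeting a d = d^2 e^(s - t) and b c = - c^2 e^(s + t), so a d lies in [0, 1] anyway. It is
    an endpoint only if c = 0 or d = 0, and then [K] preserves the axis, keeping or reversing its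
    direction. *)
Lemma axis_frame (K : mat R) s t : mdet K = 1 -> axis s = act K (axis t) ->
  ~~ (0 < m11 K * m22 K < 1) -> exists2 k : int, (`|k| = 1)%N &
    exists tau, forall u, act K (axis u) = axis (k%:~R * u + tau).
Proof.
move=> hK e nX; have [e1 e2] := axis_to_axis hK e.
have ax u := act_axis u hK.
case: K hK e e1 e2 ax nX => a b c d; rewrite /mdet /= => h _ e1 e2 ax nX.
have s0 := expR_gt0 s; have t0 := expR_gt0 t.
have [c0|c0] := eqVneq c 0.
  exists 1%R => //; exists (s - t) => u; have [q0 ->] := ax u.
  have b0 : b = 0 by rewrite e1 c0 oppr0 mul0r.
  rewrite c0 b0 !(mul0r, mulr0, add0r, addr0, subr0, expr0n) in h q0 *.
  rewrite mul1r /axis !expRD expRN; congr (_, _); congr (_ * _).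
  apply: (mulfI q0); rewrite mulfV //; apply: (mulIf (lt0r_neq0 t0)).
  transitivity (d * (d * expR s)); first by rewrite mul1r -e2; rewrite mulrA (mulrC d) h mul1r.
  by rewrite -!mulrA mulVf ?mulr1 ?lt0r_neq0 // expr2 !mulrA.
have [d0|d0] := eqVneq d 0.
  exists (- 1)%R => //; exists (s + t) => u; have [q0 ->] := ax u.
  have a0 : a = 0 by apply: (mulIf (lt0r_neq0 t0)); rewrite e2 d0 !mul0r.
  rewrite a0 d0 !(mul0r, mulr0, add0r, addr0, expr0n) in h q0 *.
  have cc : c ^+ 2 * (expR s * expR t) = 1 by rewrite -h e1; ring.
  rewrite mulN1r /axis !expRD expRN; congr (_, _).
  apply: (mulfI q0); rewrite mulrCA mulfV // mulr1.
  have u0 := lt0r_neq0 (expR_gt0 u).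
  transitivity (expR u * (c ^+ 2 * (expR s * expR t))); first by rewrite cc mulr1.
  by field.
exfalso; move/negP: nX; apply; have c2 : 0 < c ^+ 2 by rewrite exprn_even_gt0.
have d2 : 0 < d ^+ 2 by rewrite exprn_even_gt0.
have ad : a * d * expR t = d ^+ 2 * expR s by rewrite mulrAC e2; ring.
rewrite -(pmulr_lgt0 _ t0) ad mulr_gt0 //=.
have : 0 < c ^+ 2 * (expR s * expR t) by exact: mulr_gt0 c2 (mulr_gt0 s0 t0).
have -> : c ^+ 2 * (expR s * expR t) = - (b * c) by rewrite e1; ring.
by move: h; lra.
Qed.

(** Local injectivity of the covering at one point of the lift rules out short periods; this makes
    Euclid's algorithm stop. *)
Lemma geodesic_period_bounded_below c : exists2 e, 0 < e &
  forall u, 0 < u -> (forall t, geod_map c (t + u) = geod_map c t) -> e <= u.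
Proof.
have [p hp pc] := geodesic_covering c.
have [d d0 inj] := hloc_near_inj (hp _ (axis_gt0 0)).
have [e e0 he] := (near_lineP _ _).1 (@axis_continuous R 0 _ (nbhsx_ballx _ _ d0)).
exists e => // u u0 per; rewrite leNgt; apply/negP => ue.
have h : axis u = axis 0.
  apply: inj; [|exact: ballxx|by rewrite !pc -(per 0) add0r].
  by apply: he; rewrite sub0r normrN gtr0_norm.
by move/axis_inj: h u0 => ->; rewrite ltxx.
Qed.

Lemma same_line_pair_le c1 c2 (k : int) tau : (`|k| = 1)%N ->
  (forall u, geod_map c2 u = geod_map c1 (k%:~R * u + tau)) ->
  (geom_intersection c1 c2 * ((geod_length c1 * geod_length c2)^-1)%:E <= I_Delta X)%E.
Proof.
move=> k1 c12; have [l10 l20] := (geod_length_gt0 c1, geod_length_gt0 c2).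
have kk : (k%:~R : R) * k%:~R = 1.
  by rewrite -intrM; have -> : k * k = 1 by lia.
pose P l := forall t, geod_map c1 (t + l) = geod_map c1 t.
have P1 : P (geod_length c1) by exact: geod_periodic.
(* [k] is its own inverse, so the length of [c2], read along [c1], is a period whichever the
   direction. *)
have P2 : P (geod_length c2).
  have Pk : P (k%:~R * geod_length c2).
    move=> t; have := geod_periodic c2 (k%:~R * (t - tau)).
    by rewrite !c12 mulrDr mulrA kk mul1r addrAC subrK.
  move=> t; have := periodic_int Pk k t; by rewrite mulrAC kk mul1r.
have PB u v : P u -> P v -> P (u - v).
  by move=> Pu Pv t; rewrite addrA addrAC Pu -[in RHS](subrK v t) Pv.
have [e e0 Pe] := geodesic_period_bounded_below c1.
have [d [a [b [d0 Pd aE bE]]]] := common_divisor e0 PB Pe l10 l20 P1 P2.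
have a0 : (a != 0)%N by apply: contraTneq l10 => a0; rewrite aE a0 mul0r ltxx.
have b0 : (b != 0)%N by apply: contraTneq l20 => b0; rewrite bE b0 mul0r ltxx.
pose c := ClosedGeodesic d0 (geod_geodesic c1) Pd.
have dn := lt0r_neq0 d0.
have c1E : geod_curve c1 = reparam a%:Z 0 (geod_curve c).
  apply/funext => t; rewrite /reparam /geod_curve /= aE addr0; congr geod_map.
  by rewrite -pmulrn; ring.
have c2E : geod_curve c2 = reparam (k * b%:Z) (tau / d) (geod_curve c).
  apply/funext => t; rewrite /reparam /geod_curve c12 /= bE; congr geod_map.
  by rewrite intrM -[b%:~R]pmulrn; field.
have kb0 : k * b%:Z != 0 by lia.
have az0 : a%:Z != 0 by lia.
have := intersection_number_reparam 0 (tau / d) (geod_curve c) (geod_curve c) az0 kb0.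
rewrite -c1E -c2E abszM k1 mul1n absz_nat => h.
apply: le_ereal_sup_tmp; exists (geom_intersection c c * ((geod_length c ^+ 2)^-1)%:E)%E; first by exists c.
have -> : (geod_length c1 * geod_length c2)^-1 = (a * b)%N%:R^-1 * (d ^+ 2)^-1.
  by rewrite aE bE natrM; field; rewrite !pnatr_eq0 a0 b0 dn.
rewrite EFinM muleA; apply: lee_wpmul2r => //.
by rewrite lee_fin invr_ge0 sqr_ge0.
Qed.

(** A single meeting that is not a crossing already puts both geodesics on one line. Geodesics that
    never meet fall under the crossing case, with zero intersections. *)
Lemma pair_le c1 c2 :
  (geom_intersection c1 c2 * ((geod_length c1 * geod_length c2)^-1)%:E <= 2%:E * I_Delta X)%E.
Proof.
have [p hp pc] := geodesic_covering c1; have [q hq qc] := geodesic_covering c2.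
have [allX|/existsNP[s /existsNP[t /existsNP[K /not_implyP[hK /negP nX]]]]] :=
    pselect (all_crossing c1 c2 p q); first exact: (crossing_pair_le hp hq pc qc allX).
have [dK pK eK] := hK.
have [k k1 [tau htau]] := axis_frame dK (esym eK) nX.
have D0 := I_Delta_ge0 c1.
apply: (@le_trans _ _ (I_Delta X)).
  apply: (same_line_pair_le k1 (tau := tau)) => u.
  by rewrite -qc -pK ?axis_gt0 // htau pc.
by rewrite -[leLHS]mul1e lee_wpmul2r // lee_fin ler1n.
Qed.

End SameLine.

Theorem proposition2p8 (R : realType) (g : nat) (hg : (2 <= g)%N)
    (X : hyperbolic_surface R g) :
  ((2^-1)%:E * I_sup X <= I_Delta X <= I_sup X)%E.
Proof.
apply/andP; split.
  rewrite lee_pdivrMl //; apply: ge_ereal_sup => _ [[c1 c2] _ <-]; exact: pair_le.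
apply: ge_ereal_sup => _ [c _ <-]; apply: ereal_sup_ubound.
by exists (c, c) => //=; rewrite expr2.
Qed.
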